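(* Assume $(\mathbf H_\Omega)$ and that, for all $\varepsilon>0$, the functions $b_1^\varepsilon,b_2^\varepsilon,l_1^\varepsilon,l_2^\varepsilon$ satisfy (C1)--(C3) (see context) with constants uniform in $\varepsilon$. Suppose that, as $\varepsilon\to0$, $(b_1^\varepsilon,b_2^\varepsilon,l_1^\varepsilon,l_2^\varepsilon)\to(b_1,b_2,l_1,l_2)$ locally uniformly ($b_i^\varepsilon\to b_i$ and $l_i^\varepsilon\to l_i$ uniformly on $K\times[0,T]\times A_i$ for every compact $K\subset\overline{\Omega_i}$) and $g^\varepsilon\to g$ locally uniformly in $\mathbb R^N$, and that $b_1,b_2$ satisfy (C4). Then the associated value functions $\mathbf U^-_\varepsilon$ and $\mathbf U^+_\varepsilon$ converge respectively to $\mathbf U^-$ and $\mathbf U^+$ as $\varepsilon\to0$.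
   Context: Geometry $(\mathbf H_\Omega)$: $\mathbb R^N=\Omega_1\cup\Omega_2\cup\mathcal H$, where $\Omega_1,\Omega_2$ are disjoint open sets and $\mathcal H=\partial\Omega_1=\partial\Omega_2$ is a $W^{2,\infty}$-hypersurface in $\mathbb R^N$. For $z\in\mathcal H$, $\mathbf n_i(z)$ is the unit normal to $\partial\Omega_i$ at $z$ pointing outwards $\Omega_i$. Control data: $T>0$, control sets $A_1,A_2$ (not depending on $\varepsilon$); for $i=1,2$, dynamics $b_i:\overline{\Omega_i}\times[0,T]\times A_i\to\mathbb R^N$ and running costs $l_i:\overline{\Omega_i}\times[0,T]\times A_i\to\mathbb R$ (and likewise $b_i^\varepsilon,l_i^\varepsilon$); $g,g^\varepsilon:\mathbb R^N\to\mathbb R$ are bounded and continuous. (C1) $A_i$ is a compact metric space, $b_i$ is continuous, $|b_i|\le M_b$ and $|b_i(z,s,\alpha_i)-b_i(z',s',\alpha_i)|\le L_b(|z-z'|+|s-s'|)$. (C2) $l_i$ is uniformly continuous, $|l_i|\le M_l$, and $|l_i(z,s,\alpha_i)-l_i(z',s',\alpha_i)|\le m_l(|z-z'|+|s-s'|)$ for a modulus of continuity $m_l$. (C3) For all $z\in\overline{\Omega_i}$, $s\in[0,T]$, the set $\{(b_i(z,s,\alpha_i),l_i(z,s,\alpha_i)):\alpha_i\in A_i\}$ is closed and convex. (C4) There is $\delta>0$ such that for $i=1,2$, $z\in\mathcal H$, $s\in[0,T]$: $\{b_i(z,s,\alpha_i)\cdot\mathbf n_i(z):\alpha_i\in A_i\}\supset[-\delta,\delta]$.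 ''Constants uniform in $\varepsilon$'' refers to $M_b,L_b,M_l,m_l$. Interface dynamics: $A:=A_1\times A_2\times[0,1]$; for $z\in\mathcal H$, $a=(\alpha_1,\alpha_2,\mu)\in A$, $b_{\mathcal H}(z,s,a)=\mu b_1(z,s,\alpha_1)+(1-\mu)b_2(z,s,\alpha_2)$, $l_{\mathcal H}(z,s,a)=\mu l_1(z,s,\alpha_1)+(1-\mu)l_2(z,s,\alpha_2)$; $A_0^{\mathrm{reg}}(z,s)=\{a\in A: b_{\mathcal H}(z,s,a)\cdot\mathbf n_1(z)=0,\ b_i(z,s,\alpha_i)\cdot\mathbf n_i(z)\ge0,\ i=1,2\}$. Trajectories: for $x\in\mathbb R^N$, $t\in[0,T)$, $\mathcal T_{x,t}$ is the set of pairs $(X,a)$ with $X:[0,t]\to\mathbb R^N$ Lipschitz, $X(0)=x$, $a=(\alpha_1,\alpha_2,\mu)\in L^\infty(0,T;A)$ and, for a.e. $s\in(0,t)$, $\dot X(s)=\sum_{i=1,2}b_i(X(s),t-s,\alpha_i(s))\mathbf 1_{\{X(s)\in\Omega_i\}}+b_{\mathcal H}(X(s),t-s,a(s))\mathbf 1_{\{X(s)\in\mathcal H\}}$. $\mathcal T^{\mathrm{reg}}_{x,t}$ is the subset of those with $a(s)\in A_0^{\mathrm{reg}}(X(s),t-s)$ for a.e. $s$ with $X(s)\in\mathcal H$. Cost: $J(x,t;(X,a))=\int_0^t\ell(X(s),t-s,a(s))\,ds+g(X(t))$, where $\ell(X(s),t-s,a(s))=\sum_{i=1,2} l_i(X(s),t-s,\alpha_i(s))\mathbf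 1_{\{X(s)\in\Omega_i\}}+l_{\mathcal H}(X(s),t-s,a(s))\mathbf 1_{\{X(s)\in\mathcal H\}}$. Value functions: $\mathbf U^-(x,t)=\inf_{(X,a)\in\mathcal T_{x,t}}J(x,t;(X,a))$ and $\mathbf U^+(x,t)=\inf_{(X,a)\in\mathcal T^{\mathrm{reg}}_{x,t}}J(x,t;(X,a))$. $\mathbf U^\pm_\varepsilon$ are defined in the same way with $b_i^\varepsilon,l_i^\varepsilon,g^\varepsilon$ in place of $b_i,l_i,g$. *)

(* Defs.v *)
From HB Require Import structures.
From mathcomp Require Import all_boot all_order all_algebra.
From mathcomp Require Import all_classical all_reals all_analysis.

Set Implicit Arguments.
Unset Strict Implicit.
Unset Printing Implicit Defensive.
Import Order.TTheory GRing.Theory Num.Theory.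
Import numFieldNormedType.Exports.
Local Open Scope classical_set_scope.
Local Open Scope ring_scope.

(* The library norm on 'rV[R]_N is the sup norm; the Euclidean norm is needed
   for unit normals and for the bounds and Lipschitz constants of the data. *)
Definition dot (R : realType) (N : nat) (u v : 'rV[R]_N) : R :=
  \sum_(i < N) u ord0 i * v ord0 i.

Definition enorm (R : realType) (N : nat) (u : 'rV[R]_N) : R :=
  Num.sqrt (dot u u).

Definition boundary (E : topologicalType) (D : set E) : set E :=
  closure D `\` interior D.

Section Geometry.
Context (R : realType) (N : nat).
Implicit Types (Omega H V : set 'rV[R]_N) (phi : 'rV[R]_N -> R).
Implicit Types (z n : 'rV[R]_N).

Definition gradient phi z : 'rV[R]_N :=
  \row_i ('D_(delta_mx ord0 i) phi z).

(* W^{2,oo} through its usual local description C^{1,1}: phi is differentiable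
   with Lipschitz gradient.  Its gradient does not vanish on V. *)
Definition W2oo_submersion V phi : Prop :=
  [/\ forall z, V z -> differentiable phi z,
      exists k : R, forall z z', V z -> V z' ->
        enorm (gradient phi z - gradient phi z') <= k * enorm (z - z')
    & forall z, V z -> gradient phi z != 0].

Definition W2oo_hypersurface H : Prop :=
  forall z, H z -> exists V phi,
    [/\ open V, V z, W2oo_submersion V phi
      & H `&` V = [set y | phi y = 0] `&` V].

(* Near z, Omega is the sublevel set {phi < 0}, so that the gradient of phi
   points out of Omega. *)
Definition outward_unit_normal Omega z n : Prop :=
  exists V phi,
    [/\ open V, V z, W2oo_submersion V phi,
        Omega `&` V = [set y | phi y < 0] `&` V
      & n = (enorm (gradient phi z))^-1 *: gradient phi z].

Definition H_Omega (Omega1 Omega2 : set 'rV[R]_N) H : Prop :=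
  [/\ open Omega1, open Omega2, Omega1 `&` Omega2 = set0,
      Omega1 `|` Omega2 `|` H = setT
    & [/\ H = boundary Omega1, H = boundary Omega2 & W2oo_hypersurface H]].

End Geometry.

Section ControlData.
Context (R : realType) (N : nat).

Definition modulus (m : R -> R) : Prop :=
  [/\ m 0 = 0, (forall r r', 0 <= r -> r <= r' -> m r <= m r')
    & m r @[r --> 0^'+] --> 0].

Section OneSide.
Context (A : metricType R) (Omega : set 'rV[R]_N) (T : R).
Implicit Types (b : 'rV[R]_N -> R -> A -> 'rV[R]_N) (l : 'rV[R]_N -> R -> A -> R).

(* b and l are total functions; only their values for z in the closure of Omega
   and s in [0, T] are meaningful, and only these are ever constrained. *)
Definition condC1 (Mb Lb : R) b : Prop :=
  [/\ compact [set: A],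
      {within (closure Omega `*` `[0, T]%classic) `*` [set: A],
         continuous (fun p : 'rV[R]_N * R * A => b p.1.1 p.1.2 p.2)},
      (forall z s alpha, closure Omega z -> s \in `[0, T] ->
         enorm (b z s alpha) <= Mb)
    & (forall z z' s s' alpha, closure Omega z -> closure Omega z' ->
         s \in `[0, T] -> s' \in `[0, T] ->
         enorm (b z s alpha - b z' s' alpha) <=
           Lb * (enorm (z - z') + `|s - s'|))].

Definition condC2 (Ml : R) (ml : R -> R) l : Prop :=
  [/\ (forall e, 0 < e -> exists2 d, 0 < d &
         forall z z' s s' alpha alpha', closure Omega z -> closure Omega z' ->
           s \in `[0, T] -> s' \in `[0, T] ->
           enorm (z - z') < d -> `|s - s'| < d -> mdist alpha alpha' < d ->
           `|l z s alpha - l z' s' alpha'| < e),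
      (forall z s alpha, closure Omega z -> s \in `[0, T] ->
         `|l z s alpha| <= Ml)
    & (forall z z' s s' alpha, closure Omega z -> closure Omega z' ->
         s \in `[0, T] -> s' \in `[0, T] ->
         `|l z s alpha - l z' s' alpha| <= ml (enorm (z - z') + `|s - s'|))].

Definition BL b l z s : set ('rV[R]_N * R^o) :=
  [set (b z s alpha, l z s alpha) | alpha in [set: A]].

Definition condC3 b l : Prop :=
  forall z s, closure Omega z -> s \in `[0, T] ->
    closed (BL b l z s) /\ convex_set (BL b l z s).

Definition condC4 (H : set 'rV[R]_N) (n : 'rV[R]_N -> 'rV[R]_N) (delta : R) b
    : Prop :=
  forall z s, H z -> s \in `[0, T] ->
    `[- delta, delta]%classic `<=`
      [set dot (b z s alpha) (n z) | alpha in [set: A]].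

(* Uniform convergence, as e -> 0 with e > 0, on K x [0, T] x A for every
   compact subset K of the closure of Omega. *)
Definition loc_unif_cvg (V : normedModType R)
    (fe : R -> 'rV[R]_N -> R -> A -> V) (f : 'rV[R]_N -> R -> A -> V) : Prop :=
  forall K : set 'rV[R]_N, compact K -> K `<=` closure Omega ->
    {uniform (K `*` `[0, T]%classic) `*` [set: A],
       (fun e (p : 'rV[R]_N * R * A) => fe e p.1.1 p.1.2 p.2) @ 0^'+ -->
       (fun p : 'rV[R]_N * R * A => f p.1.1 p.1.2 p.2)}.

End OneSide.

Context (A1 A2 : metricType R).

Record control_data := ControlData {
  b1 : 'rV[R]_N -> R -> A1 -> 'rV[R]_N;
  b2 : 'rV[R]_N -> R -> A2 -> 'rV[R]_N;
  l1 : 'rV[R]_N -> R -> A1 -> R;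
  l2 : 'rV[R]_N -> R -> A2 -> R;
  g : 'rV[R]_N -> R }.

Definition bounded_continuous (f : 'rV[R]_N -> R) : Prop :=
  continuous f /\ exists M : R, forall x, `|f x| <= M.

Definition condC123 (Omega1 Omega2 : set 'rV[R]_N) (T Mb Lb Ml : R)
    (ml : R -> R) (D : control_data) : Prop :=
  [/\ condC1 Omega1 T Mb Lb (b1 D) /\ condC1 Omega2 T Mb Lb (b2 D),
      condC2 Omega1 T Ml ml (l1 D) /\ condC2 Omega2 T Ml ml (l2 D)
    & condC3 Omega1 T (b1 D) (l1 D) /\ condC3 Omega2 T (b2 D) (l2 D)].

(* The controls (alpha_1, alpha_2, mu); A = A_1 x A_2 x [0, 1] is the subset
   [Aset] of this type. *)
Definition control : Type := (A1 * A2 * R)%type.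

Definition Aset : set (A1 * A2 * R) := [set a | 0 <= a.2 <= 1].

Definition bH (D : control_data) (z : 'rV[R]_N) (s : R) (a : control)
    : 'rV[R]_N :=
  a.2 *: b1 D z s a.1.1 + (1 - a.2) *: b2 D z s a.1.2.

Definition lH (D : control_data) (z : 'rV[R]_N) (s : R) (a : control) : R :=
  a.2 * l1 D z s a.1.1 + (1 - a.2) * l2 D z s a.1.2.

Section ValueFunctions.
Context (Omega1 Omega2 H : set 'rV[R]_N) (n1 n2 : 'rV[R]_N -> 'rV[R]_N) (T : R).
Context (D : control_data).
Implicit Types (z x : 'rV[R]_N) (s t : R) (X : R -> 'rV[R]_N).
Implicit Types (a : control) (c : R -> control).

Definition A0reg z s : set control :=
  [set a | [/\ Aset a, dot (bH D z s a) (n1 z) = 0,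
               0 <= dot (b1 D z s a.1.1) (n1 z)
             & 0 <= dot (b2 D z s a.1.2) (n2 z)]].

(* Measurable representatives of L^oo(0, T; A): A is compact, so boundedness is
   automatic; measurability is with respect to the Borel sets of A_1 x A_2 x R. *)
Definition Linfty_control c : Prop :=
  (forall s, s \in `]0, T[ -> Aset (c s)) /\
  (forall U : set (A1 * A2 * R), open U ->
     measurable (`]0, T[%classic `&` c @^-1` U)).

Definition velocity z s a : 'rV[R]_N :=
  \1_Omega1 z *: b1 D z s a.1.1 + \1_Omega2 z *: b2 D z s a.1.2 +
  \1_H z *: bH D z s a.

Definition running_cost z s a : R :=
  \1_Omega1 z * l1 D z s a.1.1 + \1_Omega2 z * l2 D z s a.1.2 +
  \1_H z * lH D z s a.

(* Trajectories are total functions of which only the restriction to [0, t]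
   matters. *)
Definition traj x t : set ((R -> 'rV[R]_N) * (R -> control)) :=
  [set Xc | [/\ [lipschitz Xc.1 s | s in `[0, t]%classic], Xc.1 0 = x,
      Linfty_control Xc.2
    & {ae lebesgue_measure, forall s : R, s \in `]0, t[ ->
         is_derive s 1 Xc.1 (velocity (Xc.1 s) (t - s) (Xc.2 s))}]].

Definition traj_reg x t : set ((R -> 'rV[R]_N) * (R -> control)) :=
  [set Xc | traj x t Xc /\
    {ae lebesgue_measure, forall s : R, s \in `]0, t[ -> H (Xc.1 s) ->
       A0reg (Xc.1 s) (t - s) (Xc.2 s)}].

Definition J t (Xc : (R -> 'rV[R]_N) * (R -> control)) : R :=
  \int[lebesgue_measure]_(s in `[0, t])
    running_cost (Xc.1 s) (t - s) (Xc.2 s) + g D (Xc.1 t).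

Definition Uminus x t : \bar R := ereal_inf [set (J t Xc)%:E | Xc in traj x t].

Definition Uplus x t : \bar R :=
  ereal_inf [set (J t Xc)%:E | Xc in traj_reg x t].

End ValueFunctions.

End ControlData.

(* Local uniform convergence on R^N x [0, T[ as e -> 0 with e > 0.  Written with
   two inequalities so that it is also meaningful where both functions are +oo
   (infimum over an empty set); where they are finite it is
   |Ue x t - U x t| <= eta. *)
Definition value_cvg (R : realType) (N : nat) (T : R)
    (Ue : R -> 'rV[R]_N -> R -> \bar R) (U : 'rV[R]_N -> R -> \bar R) : Prop :=
  forall K : set ('rV[R]_N * R), compact K -> K `<=` [set: _] `*` `[0, T[%classic ->
  forall eta : R, 0 < eta ->
  \forall e \near 0^'+, forall p, K p ->
    (Ue e p.1 p.2 <= U p.1 p.2 + eta%:E)%E /\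
    (U p.1 p.2 <= Ue e p.1 p.2 + eta%:E)%E.

(* Main.v *)
(* Proof idea.  Let (X, a) be a trajectory for one set of data and let other data,
   with normal controllability of size c0 near the interface, be close to the first.
   Slow the first trajectory down: Y = X o sigma with sigma' = 1 - lam and
   lam s = lam0 exp (K s).  The time lost frees a share lam of the control, since
   (1 - lam) b + lam b(+-) is admissible by convexity, where b(+-) are controls
   pointing into either side of the interface.  Let Phi be a C^{1,1} function on R^N
   that is negative in Omega_1, positive in Omega_2 and has normal gradient on H, and
   choose the weights of the b(+-) by feedback so that the new trajectory Z satisfies
   Phi(Z) = Phi(Y) (1 + q) with q small.  Then Z and Y are always in the same phase
   and sit on H at the same times, with proportional normal velocities, so regular
   controls stay regular.  The growth rate K absorbs the Lipschitz errors, which gives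
   Z - Y = O(lam), and Filippov's selection lemma turns the averaged velocities and
   costs into controls.  Hence J' <= J + eta.

   This transfer is symmetric: it is applied from the limit data to the approximate
   data and back, so no compactness of trajectories is needed.  The solution Z is a
   Picard fixed point for the McShane extensions of the one-sided fields. *)

Require Import Defs.
From HB Require Import structures.
From mathcomp Require Import all_boot all_order all_algebra.
From mathcomp Require Import all_classical all_reals all_analysis.
From mathcomp Require Import measurable_realfun.
From mathcomp Require Import ring lra.

Set Implicit Arguments.
Unset Strict Implicit.
Unset Printing Implicit Defensive.
Import Order.TTheory GRing.Theory Num.Theory.
Import numFieldNormedType.Exports.
Local Open Scope classical_set_scope.
Local Open Scope ring_scope.

(** * Lipschitz functions of one real variable *)

Section Derivatives.
Context {R : realType}.

(** The dynamics jump across [H]: two paths driven by close controls separate as soon as they cross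
    [H] at different times, so a Gronwall estimate in the state alone is useless and the sign of
    [Phi] has to be copied exactly. Near [H], normal controllability gives the freed share enough
    authority to prescribe the normal velocity, and [q] is frozen. Where [Phi (Y s)] has size at
    least [r], no direction is assumed available; there [q] itself absorbs the mismatch, at the
    price of a division by [Phi (Y s)]. A correction of size [lam] can only repair perturbations of
    size [a * lam], whether they come from the change of data or from the time shift. The
    exponential form of [lam] keeps the accumulated error of order [lam / K], so [K] can be fixed
    before [lam0]. The order of choice is: [r] and [c0] from (C4) on a compact set, then [a] and
    [K], then the lag [lam0 * expR (K * T)] from [eta], and last the data error [err], a fixed
    fraction of [lam0]. Since (C4) concerns the limit data, close data inherit it with half the
    size. *)

Lemma near0_norm_lt (e : R) : 0 < e -> \forall h \near (0 : R), `|h| < e.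
Proof. by move=> e0; exact: (@pseudometric_normed_Zmodule.nbhs0_lt R R e e0). Qed.

Lemma near0_norm_le (e : R) : 0 < e -> \forall h \near (0 : R), `|h| <= e.
Proof. by move=> e0; near do apply: ltW; exact: near0_norm_lt.
Unshelve. all: by end_near. Qed.

(** The derivative as a remainder estimate with no division by [h], convenient for the chain rule
    and for passing to coordinates. *)
Definition hasd (W : normedModType R) (f : R -> W) (s : R) (v : W) : Prop :=
  forall e : R, 0 < e ->
    \forall h \near (0 : R), `|f (s + h) - f s - h *: v| <= e * `|h|.

Lemma hasdP (W : normedModType R) (f : R -> W) s v :
  hasd f s v <-> is_derive s 1 f v.
Proof.
split=> [H|[dfs dfv] e e0].
  have C : h^-1 *: (f (h *: (1 : R) + s) - f s) @[h --> (0 : R)^'] --> v.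
    apply/cvgrPdist_le => /= e e0.
    near=> h.
    have h0 : h != 0 by near: h; exact: nbhs_dnbhs_neq.
    have -> : v - h^-1 *: (f (h *: (1 : R) + s) - f s) =
       - (h^-1 *: (f (s + h) - f s - h *: v)).
      by rewrite [_ *: 1]mulr1 (addrC h) !scalerBr scalerA mulVf// scale1r !opprB.
    rewrite normrN normrZ normfV ler_pdivrMl ?normr_gt0// [leRHS]mulrC.
    by near: h; apply: nbhs_dnbhs; exact: H.
  have dfs : derivable f s 1 by apply/cvg_ex; exists v.
  by apply: DeriveDef => //; exact/cvg_lim.
have /cvgrPdist_le : h^-1 *: (f (h *: (1 : R) + s) - f s) @[h --> (0 : R)^'] --> v.
  by rewrite -dfv; exact: dfs.
move=> /(_ e e0)/nbhs_ballP[d /= d0 dP].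
near=> h.
have [->|h0] := eqVneq h 0.
  by rewrite scale0r addr0 subr0 subrr !normr0 mulr0.
have hp : 0 < `|h| by rewrite normr_gt0.
have := dP h; rewrite /ball/= sub0r normrN => /(_ _ h0).
rewrite -(ler_pM2l hp) -normrZ scalerBr scalerA mulfV// scale1r.
rewrite [_ *: 1]mulr1 (addrC h) distrC [leRHS]mulrC; apply.
by near: h; exact: near0_norm_lt.
Unshelve. all: by end_near. Qed.

Lemma hasd_coord n (f : R -> 'rV[R]_n) s v :
  hasd f s v <-> forall j, hasd (fun r => f r ord0 j) s (v ord0 j).
Proof.
split=> [H j e e0|H e e0].
  apply: filterS (H e e0) => h; apply: le_trans.
  rewrite [leRHS]/Num.Def.normr/= mx_normrE.
  by have := le_bigmax 0 (fun i => `|(f (s + h) - f s - h *: v) i.1 i.2|) (ord0, j); rewrite !mxE.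
near=> h; rewrite [leLHS]/Num.Def.normr/= mx_normrE.
apply: bigmax_le => [|[i j] _ /=]; first by rewrite mulr_ge0// ltW.
rewrite !mxE (ord1 i); move: j; near: h; apply: filter_forall => j.
exact: H.
Unshelve. all: by end_near. Qed.

Lemma hasdD (W : normedModType R) (f g : R -> W) s v w :
  hasd f s v -> hasd g s w -> hasd (fun r => f r + g r) s (v + w).
Proof.
move=> Hf Hg e e0; have e20 : 0 < e / 2 by rewrite divr_gt0.
apply: filterS2 (Hf _ e20) (Hg _ e20) => h hf hg.
have -> : f (s + h) + g (s + h) - (f s + g s) - h *: (v + w) =
  (f (s + h) - f s - h *: v) + (g (s + h) - g s - h *: w).
  by rewrite scalerDr !opprD (addrACA (f _) (g _)) [LHS]addrACA.
apply: le_trans (ler_normD _ _) _.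
by rewrite {1}(splitr e) mulrDl lerD.
Qed.

Lemma hasdN (W : normedModType R) (f : R -> W) s v :
  hasd f s v -> hasd (fun r => - f r) s (- v).
Proof.
move=> H e e0; apply: filterS (H e e0) => h.
by rewrite -normrN scalerN !opprD !opprK.
Qed.

Lemma hasdB (W : normedModType R) (f g : R -> W) s v w :
  hasd f s v -> hasd g s w -> hasd (fun r => f r - g r) s (v - w).
Proof. by move=> Hf Hg; apply: hasdD => //; exact: hasdN. Qed.

Lemma hasd_cst (W : normedModType R) (c : W) s : hasd (fun=> c) s 0.
Proof.
move=> e e0; near=> h; rewrite scaler0 subrr subr0 normr0 mulr_ge0//; exact: ltW.
Unshelve. all: by end_near. Qed.

Lemma hasd_near (W : normedModType R) (f g : R -> W) s v :
  (\forall r \near s, f r = g r) -> hasd f s v -> hasd g s v.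
Proof.
move=> fg H e e0; have fgs : f s = g s by exact: nbhs_singleton fg.
have fg' : \forall h \near 0, f (s + h) = g (s + h) by move/nbhs0P : fg.
apply: filterS2 fg' (H e e0) => h; by rewrite fgs => ->.
Qed.

Lemma hasd_lin (W : normedModType R) (f : R -> W) s v :
  hasd f s v -> forall e : R, 0 < e ->
  \forall h \near (0 : R), `|f (s + h) - f s| <= (`|v| + e) * `|h|.
Proof.
move=> H e e0; apply: filterS (H e e0) => h fh.
rewrite -(subrK (h *: v) (f (s + h) - f s)).
apply: (le_trans (ler_normD _ _)); rewrite normrZ mulrDl [leRHS]addrC.
by rewrite lerD// mulrC.
Qed.

Lemma hasd_sub (W : normedModType R) (f : R -> W) s v (e : R) :
  hasd f s v -> 0 < e -> \forall h \near (0 : R), `|f (s + h) - f s| <= e.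
Proof.
move=> H e0; near=> h.
have : `|f (s + h) - f s| <= (`|v| + 1) * `|h| by near: h; exact: hasd_lin.
move=> /le_trans; apply; rewrite -ler_pdivlMl ?ltr_wpDl//.
by near: h; apply: near0_norm_le; rewrite mulr_gt0// invr_gt0 ltr_wpDl.
Unshelve. all: by end_near. Qed.

Lemma hasd_comp (W : normedModType R) (f : R -> W) (g : R -> R) s a v :
  hasd g s a -> hasd f (g s) v -> hasd (fun r => f (g r)) s (a *: v).
Proof.
move=> Hg Hf e e0.
pose e1 := e / 2 / (`|a| + 1); pose e2 := e / 2 / (`|v| + 1).
have a1 : 0 < `|a| + 1 by rewrite ltr_wpDl.
have v1 : 0 < `|v| + 1 by rewrite ltr_wpDl.
have e10 : 0 < e1 by rewrite !divr_gt0.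
have e20 : 0 < e2 by rewrite !divr_gt0.
have /nbhs_normP[d /= d0 dP] := Hf _ e10.
near=> h.
have kd : `|g (s + h) - g s| < d.
  apply: (@le_lt_trans _ _ (d / 2)); last by rewrite ltr_pdivrMr// ltr_pMr// ltr1n.
  by near: h; apply: hasd_sub Hg _; rewrite divr_gt0.
have ka : `|g (s + h) - g s| <= (`|a| + 1) * `|h| by near: h; exact: hasd_lin.
have ga : `|g (s + h) - g s - h *: a| <= e2 * `|h| by near: h; exact: Hg.
move: kd ka ga; set k := g (s + h) - g s => kd ka ga.
have := dP k; rewrite /ball_/= sub0r normrN => /(_ kd); rewrite /k addrCA subrr addr0 -/k => fk.
have -> : f (g (s + h)) - f (g s) - h *: (a *: v) =
   (f (g (s + h)) - f (g s) - k *: v) + (k - h *: a) *: v.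
  by rewrite [(k - _) *: v]scalerBl addrA subrK scalerA.
apply: (le_trans (ler_normD _ _)); rewrite normrZ (splitr e) mulrDl lerD//.
  apply: (le_trans fk); apply: (@le_trans _ _ (e1 * ((`|a| + 1) * `|h|))).
    by rewrite ler_wpM2l// ltW.
  by rewrite mulrA /e1 divfK// gt_eqF.
apply: (@le_trans _ _ (e2 * `|h| * (`|v| + 1))).
  by rewrite ler_pM// lerDl.
by rewrite mulrAC /e2 divfK// gt_eqF.
Unshelve. all: by end_near. Qed.

End Derivatives.

(** * Almost-everywhere comparison and primitives *)

Section Calculus.
Context {R : realType}.
Notation mu := (@lebesgue_measure R).
Notation l := (@wlength R idfun).

Lemma aeS (P Q : R -> Prop) : (forall s, P s -> Q s) ->
  {ae mu, forall s, P s} -> {ae mu, forall s, Q s}.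
Proof. by move=> PQ; apply: (@filterS _ _ (ae_filter_ringOfSetsType mu)). Qed.

Lemma aeS2 (P Q S : R -> Prop) : (forall s, P s -> Q s -> S s) ->
  {ae mu, forall s, P s} -> {ae mu, forall s, Q s} -> {ae mu, forall s, S s}.
Proof. by move=> H; apply: (@filterS2 _ _ (ae_filter_ringOfSetsType mu)). Qed.

Lemma aeS3 (P Q S U : R -> Prop) : (forall s, P s -> Q s -> S s -> U s) ->
  {ae mu, forall s, P s} -> {ae mu, forall s, Q s} -> {ae mu, forall s, S s} ->
  {ae mu, forall s, U s}.
Proof. by move=> H; apply: (@filterS3 _ _ (ae_filter_ringOfSetsType mu)). Qed.

(** An interval of a cover of [N] pulls back to a set of diameter at most [c] times its length,
    which fits into an interval of length [2 * c] times as large. This carries almost-everywhere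
    statements along a path over to its slowed-down version. *)
Lemma negligible_expand (sg : R -> R) (S N : set R) (c : R) : 0 < c ->
  (forall x y, S x -> S y -> `|x - y| <= c * `|sg x - sg y|) ->
  mu.-negligible N -> mu.-negligible (S `&` sg @^-1` N).
Proof.
move=> c0 Hc /negligible_outer_measure N0; apply/negligible_outer_measure.
apply/eqP; rewrite eq_le outer_measure_ge0 andbT.
apply/lee_addgt0Pr => e e0; rewrite add0e.
have e20 : 0 < e / (2 * c) by rewrite divr_gt0// mulr_gt0.
have : (ereal_inf [set \sum_(k <oo) l (F k) | F in open_itv_cover N] < (e / (2 * c))%:E)%E.
  by rewrite -outer_measure_open_itv_cover N0 lte_fin.
move=> /ereal_inf_lt[_ [F [Fi NF] <-]] Fe.
pose G k := S `&` sg @^-1` (F k).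
have SG : S `&` sg @^-1` N `<=` \bigcup_k G k.
  by move=> x [Sx /NF[k _ Fk]]; exists k.
have Gl k : ((l^* (G k))%mu <= (2 * c)%:E * l (F k))%E.
  have [[a b] /= Fab] := Fi k.
  have [G0|/set0P[x0 [Sx0 Fx0]]] := eqVneq (G k) set0.
    by rewrite G0 outer_measure0 mule_ge0// ?lee_fin ?mulr_ge0// ltW.
  have ab : a < b by move: Fx0; rewrite Fab /= in_itv/= => /andP[]; exact: lt_trans.
  have GI : G k `<=` `[x0 - c * (b - a), x0 + c * (b - a)]%classic.
    move=> x [Sx Fx]; rewrite /= in_itv/= -ler_distl.
    apply: (le_trans (Hc _ _ Sx Sx0)); rewrite ler_pM2l//.
    move: Fx Fx0; rewrite Fab /= !in_itv/= => /andP[? ?] /andP[? ?].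
    by rewrite ler_norml; apply/andP; split; lra.
  apply: (le_trans (le_outer_measure mu _ _ GI)).
  change (mu `[(x0 - c * (b - a))%R, (x0 + c * (b - a))%R]%classic <= (2 * c)%:E * l (F k))%E.
  rewrite lebesgue_measure_itv/= Fab wlength_itv/= !lte_fin ab.
  case: ifPn => _; rewrite -!EFinD -EFinM lee_fin; first lra.
  by rewrite !mulr_ge0 ?subr_ge0// ltW.
apply: (le_trans (le_outer_measure mu _ _ SG)).
apply: (le_trans (outer_measure_sigma_subadditive mu G)).
apply: (@le_trans _ _ (\sum_(k <oo) (2 * c)%:E * l (F k)))%E.
  by apply: lee_nneseries => // k _; exact: Gl.
rewrite nneseriesZl//.
have -> : e = (2 * c) * (e / (2 * c)) by rewrite mulrCA mulfV ?mulr1// mulf_neq0// gt_eqF.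
rewrite [leRHS]EFinM; apply: lee_wpmul2l; first by rewrite lee_fin mulr_ge0 ?ltW.
exact: ltW.
Qed.

(** The null set where the derivative is not known is enclosed in an open [U] of measure at most
    [eta]. With [g s] the measure of [U] in [[a, s]], the bound
    [f s <= f a + eta * (s - a) + C * g s] propagates from [a] to [b]: on [U] the last term grows as
    fast as [f] can, and off [U] the derivative is nonpositive. *)
Lemma lip_ae_nonincr (f : R -> R) (a b C : R) : a <= b ->
  (forall x y, x \in `[a, b] -> y \in `[a, b] -> `|f x - f y| <= C * `|x - y|) ->
  {ae mu, forall s, s \in `]a, b[ -> exists2 v, hasd f s v & v <= 0} ->
  f b <= f a.
Proof.
rewrite le_eqVlt => /predU1P[->//|ab] fC Hae.
have C0 : 0 <= C.
  have := fC a b; rewrite !in_itv/= !lexx (ltW ab) => /(_ isT isT) /(le_trans (normr_ge0 _)).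
  by rewrite pmulr_lge0// normr_gt0 subr_eq0 lt_eqF.
(* The endpoints join the null set, so that a point outside [U] is interior to the interval. *)
pose N := [set s | ~ (s \in `]a, b[ -> exists2 v, hasd f s v & v <= 0)] `|` [set a; b].
have N0 : mu.-negligible N.
  apply: negligibleU => //; apply/negligibleP; first exact: measurableU.
  apply: countable_lebesgue_measure0; apply: finite_set_countable.
  by rewrite finite_setU; split; exact: finite_set1.
suff Heta eta : 0 < eta -> f b <= f a + eta * (b - a + C).
  apply/ler_addgt0Pr => e e0.
  have c0 : 0 < b - a + C by rewrite ltr_wpDr// subr_gt0.
  by have := Heta (e / (b - a + C)); rewrite divfK ?gt_eqF//; apply; rewrite divr_gt0.
move=> eta0.
have [U [oU NO]] := outer_measure_open_le N eta0.
rewrite (negligible_outer_measure N).1// add0e => Oe.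
have mU : measurable U by exact: open_measurable.
have mOi s : measurable (U `&` `[a, s]%classic) by exact: measurableI.
have Ofin s : mu (U `&` `[a, s]%classic) \is a fin_num.
  rewrite ge0_fin_numE//; apply: (@le_lt_trans _ _ (mu U)).
    by apply: le_measure; [apply: mem_set; exact: mOi|apply: mem_set; exact: mU|exact: subIsetl].
  by apply: le_lt_trans Oe _; rewrite ltry.
pose g s := fine (mu (U `&` `[a, s]%classic)).
have gmono s s' : s <= s' -> g s <= g s'.
  move=> ss'; rewrite /g fine_le//; apply: le_measure; [apply: mem_set; exact: mOi|apply: mem_set; exact: mOi|].
  by apply: setIS => x /=; rewrite !in_itv/= => /andP[-> /le_trans]; exact.
have ge s : g s <= eta.
  rewrite -lee_fin /g fineK//; apply: le_trans Oe.
  by apply: le_measure; [apply: mem_set; exact: mOi|apply: mem_set; exact: mU|exact: subIsetl].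
have g0 s : 0 <= g s by rewrite /g fine_ge0.
have ginc s s' : a <= s -> s <= s' -> (forall x, s < x <= s' -> U x) ->
    s' - s <= g s' - g s.
  move=> as_ ss' H; rewrite lerBrDr -lee_fin EFinD /g !fineK//.
  have mI : mu `]s, s']%classic = (s' - s)%:E.
    rewrite lebesgue_measure_itv/= lte_fin; case: ltP => // s's.
    have -> : s' = s by apply/eqP; rewrite eq_le ss' s's.
    by rewrite subrr.
  have dj : `]s, s']%classic `&` (U `&` `[a, s]%classic) = set0.
    apply/seteqP; split=> // x /= -[]; rewrite !in_itv/= => /andP[sx _] [_ /andP[_ /(lt_le_trans sx)]].
    by rewrite ltxx.
  have <- : mu (`]s, s']%classic `|` (U `&` `[a, s]%classic)) = ((s' - s)%:E + mu (U `&` `[a, s]%classic))%E.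
    rewrite (measureU mu (measurable_itv _) (mOi s) dj).
    congr (_ + _)%E; exact: mI.
  apply: le_measure; [apply: mem_set; apply: measurableU => //; exact: mOi|apply: mem_set; exact: mOi|].
  move=> x /= [|[Ox]]; rewrite !in_itv/=.
    move=> /andP[sx xs']; split; first by apply: H; rewrite sx.
    by rewrite xs' (le_trans as_)// ltW.
  by move=> /andP[ax xs]; split=> //; rewrite ax (le_trans xs).
(* Continuous induction: the supremum [z] of [E] lies in [E], and if [z < b] some point to its right
   does too. *)
pose E := [set s | s \in `[a, b] /\ f s <= f a + eta * (s - a) + C * g s].
have Ea : E a.
  by split; [rewrite in_itv/= lexx ltW|rewrite subrr mulr0 addr0 lerDl mulr_ge0].
have Eb : ubound E b by move=> s [] /[!in_itv]/= /andP[].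
have supE : has_sup E by split; [exists a|exists b].
pose z := sup E.
have az : a <= z by apply: ub_le_sup => //; exists b.
have zb : z <= b by apply: ge_sup => //; exists a.
have zab : z \in `[a, b] by rewrite in_itv/= az.
have Ez : E z.
  split=> //; apply/ler_addgt0Pr => e e0.
  have e10 : 0 < e / (C + 1) by rewrite divr_gt0// ltr_wpDl.
  have [s Es zs] := sup_adherent e10 supE.
  have sz : s <= z by apply: ub_le_sup => //; exists b.
  have [sab fs] := Es.
  have zs0 : 0 <= z - s by rewrite subr_ge0.
  have := fC _ _ zab sab; rewrite (ger0_norm zs0) => /(le_trans (ler_norm _)) fzs.
  have h1 : C * (z - s) <= e.
    apply: (@le_trans _ _ ((C + 1) * (e / (C + 1)))).
      apply: ler_pM => //; rewrite ?subr_ge0// ?lerDl// lerBlDr addrC -lerBlDr.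
      exact: ltW.
    by rewrite mulrCA mulfV ?mulr1// gt_eqF// ltr_wpDl.
  have h2 : eta * (s - a) <= eta * (z - a) by rewrite ler_pM2l// lerD2r.
  have h3 : C * g s <= C * g z by rewrite ler_wpM2l// gmono.
  lra.
have zE s : z < s -> ~ E s.
  move=> zs Es; have : s <= z by apply: ub_le_sup => //; exists b.
  by rewrite leNgt zs.
have zeqb : z = b.
  apply/eqP; rewrite eq_le zb /= leNgt; apply/negP => zltb.
  suff [d d0 dE] : exists2 d : R, 0 < d & E (z + d).
    by apply: zE dE; rewrite ltrDl.
  have [Oz|NOz] := pselect (U z).
    have /nbhs_normP[d /= d0 dO] : \forall x \near z, U x by apply: open_nbhs_nbhs.
    pose r := Num.min (d / 2) (b - z).
    have r0 : 0 < r by rewrite lt_min divr_gt0//= subr_gt0.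
    have rd : r < d.
      by apply: (@le_lt_trans _ _ (d / 2)); [rewrite ge_min lexx|lra].
    have rb : z + r <= b by rewrite -lerBrDl ge_min lexx orbT.
    have zrab : z + r \in `[a, b] by rewrite in_itv/= rb andbT (le_trans az)// lerDl ltW.
    exists r => //; split => //.
    have zzr : z <= z + r by rewrite lerDl ltW.
    have H1 : r <= g (z + r) - g z.
      rewrite -[leLHS](addrK z) (addrC r) ginc// => x /andP[zx xz].
      by apply: dO; rewrite /ball_/= ltr0_norm ?subr_lt0//; lra.
    have := fC _ _ zrab zab; rewrite [z + r]addrC addrK (ger0_norm (ltW r0)).
    move=> /(le_trans (ler_norm _)); rewrite (addrC r) => H2.
    have [_ H3] := Ez.
    have H4 : C * r <= C * (g (z + r) - g z) by rewrite ler_wpM2l.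
    have H5 : eta * 0 <= eta * r by rewrite ler_wpM2l// ltW.
    rewrite mulr0 in H5; move: H4; rewrite mulrBr => H4.
    rewrite (_ : z + r - a = (z - a) + r); last by rewrite addrAC.
    rewrite mulrDr; lra.
  have nN : ~ N z by move=> /NO.
  have zoo : z \in `]a, b[.
    rewrite in_itv/= zltb andbT lt_neqAle az andbT; apply/eqP => za.
    by apply: nN; right; left.
  have [v fv v0] : exists2 v, hasd f z v & v <= 0.
    by apply: contrapT => H; apply: nN; left => /(_ zoo).
  have /nbhs_normP[d /= d0 dP] := fv _ eta0.
  pose r := Num.min (d / 2) (b - z).
  have r0 : 0 < r by rewrite lt_min divr_gt0//= subr_gt0.
  have rd : r < d.
    by apply: (@le_lt_trans _ _ (d / 2)); [rewrite ge_min lexx|lra].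
  have rb : z + r <= b by rewrite -lerBrDl ge_min lexx orbT.
  exists r => //; split; first by rewrite in_itv/= rb andbT (le_trans az)// lerDl ltW.
  have := dP r; rewrite /ball_/= sub0r normrN (gtr0_norm r0) => /(_ rd).
  move=> /(le_trans (ler_norm _)) H2.
  have [_ H3] := Ez.
  have H4 : C * g z <= C * g (z + r) by rewrite ler_wpM2l// gmono// lerDl ltW.
  have H5 : r * v <= 0 by rewrite mulr_ge0_le0// ltW.
  rewrite (_ : z + r - a = (z - a) + r); last by rewrite addrAC.
  have {}H2 : f (z + r) - f z - r * v <= eta * r by exact: H2.
  rewrite mulrDr; lra.
have [_ fz] := Ez; move: fz; rewrite zeqb => fz.
have gC : C * g b <= C * eta by rewrite ler_wpM2l.
lra.
Qed.

(** The mean value inequality, from monotonicity of [f - F] and [- f - F]. Allowing a nonconstant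
    majorant [F] makes exponential weights available. *)
Lemma lip_ae_le (f F : R -> R) (a b C C' : R) (v V : R -> R) : a <= b ->
  (forall x y, x \in `[a, b] -> y \in `[a, b] -> `|f x - f y| <= C * `|x - y|) ->
  (forall x y, x \in `[a, b] -> y \in `[a, b] -> `|F x - F y| <= C' * `|x - y|) ->
  {ae mu, forall s, s \in `]a, b[ -> hasd f s (v s)} ->
  {ae mu, forall s, s \in `]a, b[ -> hasd F s (V s)} ->
  {ae mu, forall s, s \in `]a, b[ -> `|v s| <= V s} ->
  `|f b - f a| <= F b - F a.
Proof.
move=> ab fC FC Hf HF HV.
have key (g : R -> R) (w : R -> R) :
    (forall x y, x \in `[a, b] -> y \in `[a, b] -> `|g x - g y| <= C * `|x - y|) ->
    {ae mu, forall s, s \in `]a, b[ -> hasd g s (w s)} ->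
    {ae mu, forall s, s \in `]a, b[ -> w s <= V s} -> g b - g a <= F b - F a.
  move=> gC Hg Hw.
  have : g b - F b <= g a - F a.
    apply: (@lip_ae_nonincr (fun s => g s - F s) a b (C + C') ab).
      move=> x y xab yab.
      have -> : g x - F x - (g y - F y) = (g x - g y) - (F x - F y) by ring.
      by rewrite (le_trans (ler_normB _ _))// mulrDl lerD ?gC ?FC.
    apply: aeS3 Hg HF Hw => s gs Fs ws sab.
    by exists (w s - V s); [apply: hasdB; [exact: gs|exact: Fs]|rewrite subr_le0 ws].
  lra.
rewrite ler_norml; apply/andP; split; last first.
  apply: (key f v) => //; apply: aeS HV => s H /H; apply: le_trans; exact: ler_norm.
suff : (- f b) - (- f a) <= F b - F a by lra.
apply: (key (fun s => - f s) (fun s => - v s)).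
- by move=> x y xab yab; rewrite opprK addrC distrC fC.
- by apply: aeS Hf => s H /H; exact: hasdN.
- by apply: aeS HV => s H /H; apply: le_trans; rewrite -normrN ler_norm.
Qed.

Lemma bounded_integrable (D : set R) (F : R -> R) (M : R) :
  measurable D -> (mu D < +oo)%E -> measurable_fun D F ->
  (forall s, D s -> `|F s| <= M) -> mu.-integrable D (EFin \o F).
Proof.
move=> mD fD mF FM; apply: measurable_bounded_integrable => //.
exists M; split; first exact: num_real.
by move=> x Mx s Ds /=; apply: le_trans (FM s Ds) _; exact: ltW.
Qed.

Section Primitive.
Variables (t M : R) (F : R -> R).
Hypothesis M0 : 0 <= M.
Hypothesis mF : measurable_fun setT F.
Hypothesis FM : forall s, s \in `[0, t] -> `|F s| <= M.

(** Cutting [F] off outside [[0, t]], where no bound on it is available, makes the primitive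
    Lipschitz on the whole line. *)
Definition prim (s : R) : R := \int[mu]_(r in `[0, s]) (F \_ `[0, t]%classic) r.

Let F2 := F \_ `[0, t]%classic.

Let F2M s : `|F2 s| <= M.
Proof.
rewrite /F2 patchE; case: ifPn => [|_]; last by rewrite normr0.
by move=> /set_mem; exact: FM.
Qed.

Let mF2 : measurable_fun setT F2.
Proof. by apply/(measurable_restrictT _ _).1 => //; exact: measurable_funTS. Qed.

Let itv_fin (a b : R) (x y : bool) : (mu [set` Interval (BSide x a) (BSide y b)] < +oo)%E.
Proof. by rewrite lebesgue_measure_itv/=; case: ifPn => // _; rewrite -EFinB ltry. Qed.

Let iF2 (D : set R) : measurable D -> (mu D < +oo)%E -> mu.-integrable D (EFin \o F2).
Proof.
move=> mD fD; apply: (@bounded_integrable _ _ M) => //; exact: measurable_funTS.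
Qed.

Let int_le (a b : R) (x y : bool) : a <= b ->
  `|\int[mu]_(r in [set` Interval (BSide x a) (BSide y b)]) F2 r| <= M * (b - a).
Proof.
move=> ab; set D := [set` _].
have mD : measurable D by exact: measurable_itv.
have fD : (mu D < +oo)%E by exact: itv_fin.
apply: le_trans (le_normr_Rintegral _ _) _; [by []|exact: iF2|].
apply: (@le_trans _ _ (\int[mu]_(r in D) M)).
  apply: le_Rintegral => //.
  - by have /integrable_norm := iF2 mD fD; apply.
  - apply: (@bounded_integrable _ _ `|M|) => //; exact: measurable_cst.
have mE : fine (mu D) <= b - a.
  by rewrite /D lebesgue_measure_itv/= lte_fin; case: ifPn => _ //=; rewrite subr_ge0.
by rewrite Rintegral_cst//; apply: ler_wpM2l.
Qed.

Lemma prim_lip s s' : `|prim s - prim s'| <= M * `|s - s'|.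
Proof.
wlog ss' : s s' / s' <= s.
  move=> H; have [/H//|/ltW/H] := leP s' s.
  by rewrite distrC (distrC s').
rewrite (ger0_norm (_ : 0 <= s - s')) ?subr_ge0//.
have [s'0|s'0] := ltP s' 0.
  have -> : prim s' = 0 by rewrite /prim set_itv_ge ?Rintegral_set0// bnd_simp -ltNge.
  have [s0|s0] := ltP s 0.
    have -> : prim s = 0 by rewrite /prim set_itv_ge ?Rintegral_set0// bnd_simp -ltNge.
    by rewrite subrr normr0 mulr_ge0// subr_ge0.
  rewrite subr0 /prim; apply: (le_trans (int_le _ _ s0)).
  by rewrite ler_wpM2l//; lra.
rewrite /prim Rintegral_itvB ?bnd_simp//; last exact: iF2.
exact: int_le.
Qed.

Lemma prim0 : prim 0 = 0.
Proof. by rewrite /prim set_itv1 Rintegral_set1. Qed.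

Lemma primE : prim t = \int[mu]_(r in `[0, t]) F r.
Proof. by apply: eq_Rintegral => x xt; rewrite patchE xt. Qed.

Lemma prim_ae : {ae mu, forall s, s \in `]0, t[ -> hasd prim s (F s)}.
Proof.
have := @FTC1 R F2 (BLeft 0) (fun y => iF2 (measurable_itv _) (itv_fin _ _ _ _)).
have locF : locally_integrable setT F2.
  split => //; first exact: openT.
  move=> K _ cK.
  have mK : measurable K by exact: compact_measurable.
  by have /integrableP[] := iF2 mK (compact_finite_measure cK).
move=> /(_ locF); apply: aeS => s H /[!in_itv]/= /andP[s0 st].
have [|D1 D2] := H; first by rewrite /Order.lt /= ?lexx ?andbT ?andbF ?orbT //= ltW.
apply/hasdP; apply: DeriveDef; first exact: D1.
rewrite -derive1E D2 /F2 patchE ifT// inE/= in_itv/= !ltW//.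
Qed.
End Primitive.
End Calculus.

(** * Measurable selections *)

Section FiniteCover.

Lemma compact_seq_cover (X : topologicalType) (K : set X) (Q : X -> X -> Prop) :
  compact K -> (forall x, K x -> \forall y \near x, Q x y) ->
  exists s : seq X, forall y, K y -> exists2 x, x \in s & Q x y.
Proof.
move=> /compact_near_coveringP cK HQ.
(* A property holds along this filter when it holds for all lists containing a suitable finite list;
   near-covering compactness then provides one list for the whole of [K]. *)
pose F : set_system (seq X) :=
  [set B | exists s0 : seq X, forall s : seq X, {subset s0 <= s} -> B s].
have FF : Filter F.
  split; first by exists [::].
    move=> B C [s1 H1] [s2 H2]; exists (s1 ++ s2) => s ss; split.
      by apply: H1 => x xs; apply: ss; rewrite mem_cat xs.
    by apply: H2 => x xs; apply: ss; rewrite mem_cat xs orbT.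
  by move=> B C BC [s0 H]; exists s0 => s /H /BC.
have := cK _ F (fun s y => exists2 x, x \in s & Q x y) FF.
case=> [x Kx|s0 H0]; last by exists s0; exact: (H0 s0).
exists ([set y | Q x y], [set s : seq X | x \in s]) => /=.
  by split; [exact: HQ|exists [:: x] => s; apply; rewrite inE].
by move=> [y s] /= [Qxy xs]; exists x.
Qed.

End FiniteCover.

Section Selection.
Context {R : realType} (A : metricType R) (cA : compact [set: A]).
Implicit Types (S : set R) (f : R -> A -> R) (al : R -> A).

Definition bmeas al := forall U, open U -> measurable (al @^-1` U).

(** The Caratheodory condition. *)
Definition cara S f := (forall a, measurable_fun S (f ^~ a)) /\
  (forall s, S s -> continuous (f s)).

Lemma natSinv_lt (e : R) : 0 < e -> exists n : nat, n.+1%:R^-1 < e.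
Proof.
by move=> e0; have [n _ nP] := near_infty_natSinv_lt (PosNum e0); exists n; apply: nP => /=.
Qed.

Lemma mdist_continuous (a : A) : continuous (fun x => mdist x a).
Proof.
move=> x; apply/(@cvgrPdist_le R R) => e e0; near=> y.
have xy : mdist x y <= e.
  have : ball x e y by near: y; exact: nbhsx_ballx.
  by rewrite ballEmdist /= => /ltW.
have := metric_triangle x y a; have := metric_triangle y x a.
rewrite (metric_sym y x) => h1 h2; rewrite ler_norml; apply/andP; split; lra.
Unshelve. all: by end_near. Qed.

Lemma continuous_maxl (T : topologicalType) (f : T -> R) (c : R) :
  continuous f -> continuous (fun x => Num.max c (f x)).
Proof.
move=> cf; apply: (@max_fun_continuous _ T R (fun=> c) f) => // x; exact: cvg_cst.
Qed.

Lemma mdist_open (a : A) (r : R) : open [set x | mdist a x < r].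
Proof.
have -> : [set x | mdist a x < r] = (fun x => mdist x a) @^-1` [set y | y < r].
  by apply/seteqP; split => x /=; rewrite metric_sym.
by apply: open_comp => [x _|]; [exact: mdist_continuous|exact: open_lt].
Qed.

Lemma compact_dense_seq (a0 : A) : exists u : nat -> A,
  forall a (e : R), 0 < e -> exists k, mdist a (u k) < e.
Proof.
have /choice[s sP] : forall n : nat, exists s : seq A,
    forall y, exists2 x, x \in s & mdist y x < n.+1%:R^-1.
  move=> n.
  have [x _|s sP] := @compact_seq_cover A setT (fun x y => mdist y x < n.+1%:R^-1) cA.
    have : \forall y \near x, ball x n.+1%:R^-1 y by apply: nbhsx_ballx.
    by apply: filterS => y; rewrite ballEmdist /= metric_sym.
  by exists s => y; exact: sP.
exists (fun k => let p := odflt (0%N, 0%N) (@unpickle (nat * nat)%type k) in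
   nth a0 (s p.1) p.2).
move=> a e e0.
have [n ne] := natSinv_lt e0.
have [x xs xa] := sP n a.
exists (pickle (n, index x (s n))); rewrite pickleK /= nth_index//.
exact: lt_trans xa ne.
Qed.

Lemma compact_inf0 (h : A -> R) : continuous h ->
  (forall e : R, 0 < e -> exists a, `|h a| < e) -> exists a, h a = 0.
Proof.
move=> ch H; have [a0 _] := H 1 ltr01.
have ca : {within [set: A], continuous (fun a => `|h a|)}.
  by apply: continuous_subspaceT => x; apply: cvg_norm; exact: ch.
have [|c _ cmin] := compact_EVT_min _ cA ca; first by exists a0.
exists c; apply/eqP; apply: contraT => hc.
have [a] : exists a, `|h a| < `|h c| by apply: H; rewrite normr_gt0.
by rewrite ltNge cmin ?inE.
Qed.

Variables (a0 : A) (u : nat -> A).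
Hypothesis uP : forall a (e : R), 0 < e -> exists k, mdist a (u k) < e.

Lemma dense_approx (h : A -> R) a (e : R) : continuous h -> 0 < e -> forall r : R, 0 < r ->
  exists k, mdist a (u k) < r /\ `|h a - h (u k)| < e.
Proof.
move=> ch e0 r r0.
have /nbhs_ballP[d /= d0 dP] : \forall b \near a, `|h a - h b| < e.
  by move/(@cvgrPdist_lt R R) : (ch a) => /(_ e e0).
have [k kP] := uP a (e := Num.min d r) (ltac:(by rewrite lt_min d0)).
exists k; split; first by apply: (lt_le_trans kP); rewrite ge_min lexx orbT.
by apply: dP; rewrite ballEmdist /=; apply: (lt_le_trans kP); rewrite ge_min lexx.
Qed.

(** By compactness [f s] vanishes somewhere exactly when its values on the dense sequence [u] come
    arbitrarily close to 0, which involves countably many measurable conditions. *)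
Lemma measurable_zero S f : measurable S -> cara S f ->
  measurable [set s | S s /\ exists a, f s a = 0].
Proof.
move=> mS [mf cf].
rewrite (_ : [set s | _] = S `&` \bigcap_j \bigcup_k
    (S `&` (f ^~ (u k)) @^-1` [set y | `|y| < j.+1%:R^-1])).
  apply: measurableI => //; apply: bigcapT_measurable => j.
  apply: bigcupT_measurable => k; apply: mf => //; apply: open_measurable.
  have -> : [set y : R | `|y| < j.+1%:R^-1] = ball (0 : R) j.+1%:R^-1.
    by apply/seteqP; split => y; rewrite /ball /= sub0r normrN.
  exact: ball_open.
apply/seteqP; split => [s [Ss [a fa]]|s [Ss H]].
  split=> // j _.
  have j0 : (0 : R) < j.+1%:R^-1 by rewrite invr_gt0.
  have [k [_ kP]] := @dense_approx (f s) a _ (cf s Ss) j0 1 ltr01.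
  by exists k => //; split => //=; move: kP; rewrite fa sub0r normrN.
split=> //; apply: compact_inf0; first exact: cf.
move=> e /natSinv_lt[j je]; have [k _ [_ /= fk]] := H j I.
by exists (u k); exact: lt_trans fk je.
Qed.

(** The inequality [f s (al s) < c] is detected on the dense sequence: with some margin [m.+1%:R^-1]
    it holds at points [u k] arbitrarily close to [al s]. *)
Lemma cara_comp S f al : measurable S -> cara S f -> bmeas al ->
  measurable_fun S (fun s => f s (al s)).
Proof.
move=> mS [mf cf] mal.
apply: (measurability _ (RGenInftyO.measurableE R)) => _ [_ [c ->] <-].
rewrite (_ : _ `&` _ = \bigcup_m \bigcap_n \bigcup_k
   (al @^-1` [set x | mdist (u k) x < n.+1%:R^-1] `&`
    (S `&` (f ^~ (u k)) @^-1` `]-oo, c - m.+1%:R^-1[%classic))).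
  apply: bigcupT_measurable => m; apply: bigcapT_measurable => n.
  apply: bigcupT_measurable => k; apply: measurableI.
    exact: (mal _ (mdist_open (u k) n.+1%:R^-1)).
  by apply: mf => //; exact: measurable_itv.
apply/seteqP; split => [s [Ss /=]|s [m _ H]].
  rewrite in_itv /= => fc.
  have [|m mc] := @natSinv_lt ((c - f s (al s)) / 2); first by rewrite divr_gt0// subr_gt0.
  exists m => // n _.
  have n0 : (0 : R) < n.+1%:R^-1 by rewrite invr_gt0.
  have m0 : (0 : R) < m.+1%:R^-1 by rewrite invr_gt0.
  have [k [k1 k2]] := @dense_approx (f s) (al s) _ (cf s Ss) m0 _ n0.
  exists k => //; split; first by rewrite /= metric_sym.
  split => //=; rewrite in_itv /=.
  move: k2; rewrite ltr_norml => /andP[k2 _].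
  by move: (m.+1%:R^-1) mc k2 => r mc k2; lra.
have Ss : S s by have [k _ [_ []]] := H 0%N I.
split => //=; rewrite in_itv /= ltNge; apply/negP => cf'.
have m0 : (0 : R) < m.+1%:R^-1 by rewrite invr_gt0.
have /nbhs_ballP[d /= d0 dP] : \forall b \near al s, `|f s (al s) - f s b| < m.+1%:R^-1.
  by move/(@cvgrPdist_lt R R) : (cf s Ss (al s)) => /(_ _ m0).
have [n nd] := natSinv_lt d0.
have [k _ [/= k1 [_ /=]]] := H n I; rewrite in_itv /= => k2.
have := dP (u k); rewrite ballEmdist /= metric_sym => /(_ (lt_trans k1 nd)).
rewrite ltr_norml => /andP[_ k3].
by move: (m.+1%:R^-1) k2 k3 => r k2 k3; lra.
Qed.

Lemma cara_abs S f : cara S f -> cara S (fun s a => `|f s a|).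
Proof.
move=> [mf cf]; split=> [a|s Ss x].
  by apply: measurableT_comp; [exact: normr_measurable|exact: mf].
by apply: cvg_norm; exact: (cf s Ss x).
Qed.

Lemma caraD S f g : cara S f -> cara S g -> cara S (fun s a => f s a + g s a).
Proof.
move=> [mf cf] [mg cg]; split=> [a|s Ss x].
  by apply: measurable_funD; [exact: mf|exact: mg].
by apply: cvgD; [exact: (cf s Ss x)|exact: (cg s Ss x)].
Qed.

(* [argmin f k] vanishes where [f] does and the distance to [u k] is minimal;
   iterating over [k] shrinks the zero set to a point. *)
Let mind f k s := inf [set mdist a (u k) | a in [set a | f s a = 0]].

Let argmin f k s a := `|f s a| + `|mdist a (u k) - mind f k s|.

Let mind_attained S f k s : cara S f -> S s -> (exists a, f s a = 0) ->
  (exists2 a, f s a = 0 & mdist a (u k) = mind f k s) /\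
  forall a, f s a = 0 -> mind f k s <= mdist a (u k).
Proof.
move=> [_ cf] Ss [a fa].
have hi : has_inf [set mdist a (u k) | a in [set a | f s a = 0]].
  split; first by exists (mdist a (u k)); exists a.
  by exists 0 => _ [b _ <-]; exact: mdist_ge0.
have lb b : f s b = 0 -> mind f k s <= mdist b (u k).
  by move=> fb; apply: ge_inf; [exact: hi.2|exists b].
split => //.
pose h b := `|f s b| + Num.max 0 (mdist b (u k) - mind f k s).
have ch : continuous h.
  move=> x; apply: cvgD; first by apply: cvg_norm; exact: cf.
  apply: (@continuous_maxl _ (fun b => mdist b (u k) - mind f k s) 0) => y.
  by apply: cvgB; [exact: mdist_continuous|exact: cvg_cst].
have [|b] := compact_inf0 ch.
  move=> e e0; have [_ [b fb <-] be] := inf_adherent e0 hi.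
  exists b; rewrite /h fb normr0 add0r ger0_norm ?le_max ?lexx//.
  by rewrite gt_max e0 ltrBlDr addrC.
move=> /eqP; rewrite /h paddr_eq0 ?normr_ge0 ?le_max ?lexx// normr_eq0 => /andP[/eqP fb].
move=> mb; exists b => //; apply/eqP; rewrite eq_le lb// andbT -subr_le0.
by rewrite -(eqP mb) le_max lexx orbT.
Qed.

(** The distance exceeds [c] exactly when no zero of [f s] lies within [c] of [u k], and the
    existence of such a zero is again a question about zeros of a Caratheodory function. *)
Let measurable_mind S f k : measurable S -> cara S f ->
  (forall s, S s -> exists a, f s a = 0) -> measurable_fun S (mind f k).
Proof.
move=> mS Cf Hf.
apply: (measurability _ (RGenOInfty.measurableE R)) => _ [_ [c ->] <-].
pose g s a := `|f s a| + Num.max 0 (mdist a (u k) - c).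
have Cg : cara S g.
  apply: caraD; first exact: cara_abs.
  split=> [a|s Ss x]; first exact: measurable_cst.
  apply: (@continuous_maxl _ (fun b => mdist b (u k) - c) 0) => y.
  by apply: cvgB; [exact: mdist_continuous|exact: cvg_cst].
rewrite (_ : _ `&` _ = S `\` [set s | S s /\ exists a, g s a = 0]).
  by apply: measurableD => //; exact: measurable_zero.
apply/seteqP; split => s [Ss /=]; rewrite in_itv /= andbT => H; split => //.
  move=> [_ [a /eqP]]; rewrite /g paddr_eq0 ?normr_ge0 ?le_max ?lexx// normr_eq0.
  move=> /andP[/eqP fa /eqP ma].
  have [_ /(_ a fa) H1] := mind_attained k Cf Ss (Hf s Ss).
  have : mdist a (u k) - c <= 0 by rewrite -ma le_max lexx orbT.
  by rewrite subr_le0 leNgt (lt_le_trans H H1).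
rewrite ltNge; apply/negP => H'; apply: H; split => //.
have [[a fa ma] _] := mind_attained k Cf Ss (Hf s Ss).
exists a; rewrite /g fa normr0 add0r; apply/max_idPl; first by rewrite subr_le0 ma.
Qed.

Let cara_argmin S f k : measurable S -> cara S f ->
  (forall s, S s -> exists a, f s a = 0) -> cara S (argmin f k).
Proof.
move=> mS Cf Hf; apply: caraD; first exact: cara_abs.
apply: cara_abs; split=> [a|s Ss x].
  by apply: measurable_funB; [exact: measurable_cst|exact: measurable_mind].
by apply: cvgB; [exact: mdist_continuous|exact: cvg_cst].
Qed.

Let argmin_eq0 f k s a : argmin f k s a = 0 -> f s a = 0 /\ mdist a (u k) = mind f k s.
Proof.
move=> /eqP; rewrite /argmin paddr_eq0 ?normr_ge0// !normr_eq0 => /andP[/eqP ->].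
by rewrite subr_eq0 => /eqP ->.
Qed.

(** The zero sets of the [F k] are nested, nonempty and compact, so they share a point [al s]. Its
    distance to [u k] is [mind (F k) k s], which is measurable, and by density of [u] these
    distances determine the preimage of every open set. *)
Lemma measurable_selection_dense S f : measurable S -> cara S f ->
  (forall s, S s -> exists a, f s a = 0) ->
  exists al, bmeas al /\ forall s, S s -> f s (al s) = 0.
Proof.
move=> mS Cf Hf.
pose fix F k := if k is j.+1 then argmin (F j) j else f.
have FP k : cara S (F k) /\ forall s, S s -> exists a, F k s a = 0.
  elim: k => [//|k [Ck Hk]]; split; first exact: cara_argmin.
  move=> s Ss; have [[a fa ma] _] := mind_attained k Ck Ss (Hk s Ss).
  by exists a => /=; rewrite /argmin fa ma subrr !normr0 addr0.
have Fdec k j s a : F (k + j)%N s a = 0 -> F k s a = 0.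
  elim: j => [|j IH]; first by rewrite addn0.
  by rewrite addnS => /argmin_eq0[/IH].
have Hal s : exists a, S s -> forall k, F k s a = 0.
  have [Ss|nSs] := pselect (S s); last by exists a0.
  have /choice[c cP] : forall k, exists a, F k s a = 0.
    by move=> k; exact: (FP k).2.
  (* A cluster point of zeros of the successive [F k] is a zero of each, because the zero sets
     decrease and are closed. *)
  have [a [_ ca]] : [set: A] `&` cluster (c @ \oo) !=set0.
    by apply: cA; exact: filterT.
  exists a => _ k; apply/eqP; apply: contraT => Fka.
  have near0 : \forall b \near a, F k s b != 0.
    have := (FP k).1.2 s Ss a; move/cvgr_neq0; apply. exact: Fka.
  have ev : (c @ \oo) [set b | F k s b = 0].
    exists k => // j /= kj; apply: (@Fdec k (j - k)%N); rewrite subnKC//.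
  have [b [/= b0 /eqP]] := ca _ _ ev near0.
  by [].
have [al alP] := choice Hal.
exists (fun s => if pselect (S s) then al s else a0); split; last first.
  by move=> s Ss; case: pselect => [?|//] /=; exact: (alP s Ss 0%N).
move=> U oU.
rewrite (_ : _ @^-1` U = (S `&` al @^-1` U) `|` (~` S `&` [set s | U a0])).
  apply: measurableU.
    rewrite (_ : S `&` al @^-1` U = \bigcup_n \bigcup_(k in
       [set k | [set x | mdist x (u k) < n.+1%:R^-1] `<=` U])
       (S `&` (mind (F k) k) @^-1` `]-oo, n.+1%:R^-1[%classic)).
      apply: bigcupT_measurable => n; apply: bigcup_measurable => k _.
      have mm := measurable_mind k mS (FP k).1 (FP k).2.
      by apply: (mm mS); exact: measurable_itv.
    have E s k : S s -> mdist (al s) (u k) = mind (F k) k s.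
      by move=> Ss; exact: (argmin_eq0 (alP s Ss k.+1)).2.
    apply/seteqP; split => [s [Ss /= Us]|s [n _ [k kU [Ss /=]]]].
      have /nbhs_ballP[e /= e0 eU] : nbhs (al s) U by apply: open_nbhs_nbhs.
      have [n ne] := natSinv_lt (divr_gt0 e0 (ltr0Sn R 1)).
      have n0 : (0 : R) < n.+1%:R^-1 by rewrite invr_gt0.
      have [k kP] := uP (al s) n0.
      exists n => //; exists k; last by split => //=; rewrite in_itv /= -E.
      move=> x /= xk; apply: eU; rewrite ballEmdist /=.
      apply: (le_lt_trans (metric_triangle _ (u k) _)); rewrite (splitr e).
      by apply: ltrD; [exact: lt_trans kP ne|rewrite metric_sym; exact: lt_trans xk ne].
    by rewrite in_itv /= -E// => H; split => //; exact: kU.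
  have [Ua|nUa] := pselect (U a0).
    by apply: measurableI; [exact: measurableC|rewrite (_ : [set _ | _] = setT)//; apply/seteqP; split].
  by rewrite (_ : [set _ | _] = set0) ?setI0//; apply/seteqP; split.
apply/seteqP; split => s /=; case: pselect => Ss.
- by left.
- by right.
- by move=> [[]|[]].
- by move=> [[]|[]].
Qed.

End Selection.

Section MeasurableSelection.
Context {R : realType} (A : metricType R) (cA : compact [set: A]).
Implicit Types (S : set R) (f : R -> A -> R).

Lemma measurable_selection (a0 : A) S f : measurable S -> cara S f ->
  (forall s, S s -> exists a, f s a = 0) ->
  exists al : R -> A, bmeas al /\ forall s, S s -> f s (al s) = 0.
Proof.
have [u uP] := compact_dense_seq cA a0; exact: (measurable_selection_dense cA a0 uP).
Qed.

Lemma measurable_cara_comp S f (al : R -> A) : measurable S -> cara S f ->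
  bmeas al -> measurable_fun S (fun s => f s (al s)).
Proof.
have [u uP] := compact_dense_seq cA (al 0); exact: (cara_comp uP).
Qed.

End MeasurableSelection.

(** * Differential equations with measurable right-hand side *)

Lemma lip_continuous (R : realType) (V W : normedModType R) (f : V -> W) (C : R) :
  (forall x y, `|f x - f y| <= C * `|x - y|) -> continuous f.
Proof.
move=> fl x; apply/cvgrPdist_le => e e0; near=> y; apply: (le_trans (fl _ _)).
have C1 : 0 < `|C| + 1 by rewrite ltr_wpDl.
apply: (@le_trans _ _ ((`|C| + 1) * `|x - y|)).
  by rewrite ler_wpM2r// (le_trans (ler_norm C))// lerDl.
rewrite -ler_pdivlMl//; near: y.
have := @cvgr_dist_le R _ _ (nbhs x) _ id x; apply => //.
by rewrite mulr_gt0// invr_gt0.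
Unshelve. all: by end_near. Qed.

Section RowNorm.
Context {R : realType} (n : nat).
Implicit Types x y : 'rV[R]_n.

Lemma coord_le_norm x j : `|x ord0 j| <= `|x|.
Proof.
rewrite [leRHS]/Num.Def.normr/= mx_normrE.
exact: (le_bigmax 0 (fun i => `|x i.1 i.2|) (ord0, j)).
Qed.

Lemma norm_le_coord x (c : R) : 0 <= c -> (forall j, `|x ord0 j| <= c) -> `|x| <= c.
Proof.
move=> c0 H; rewrite [leLHS]/Num.Def.normr/= mx_normrE.
by apply: bigmax_le => // -[i j] _ /=; rewrite (ord1 i).
Qed.

End RowNorm.

Section Exponential.
Context {R : realType}.

Lemma expR_lip (m x y : R) : x <= m -> y <= m ->
  `|expR x - expR y| <= expR m * `|x - y|.
Proof.
wlog yx : x y / y <= x.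
  move=> H xm ym; have [yx|/ltW xy] := leP y x; first exact: H.
  by rewrite distrC (distrC x); exact: H.
move=> xm ym; rewrite !ger0_norm ?subr_ge0 ?ler_expR//.
have h : 1 + (y - x) <= expR (y - x) by exact: expR_ge1Dx.
have -> : expR x - expR y = expR x * (1 - expR (y - x)).
  by rewrite mulrBr mulr1 -expRD [x + _]addrC subrK.
apply: (@le_trans _ _ (expR x * (x - y))).
  by rewrite ler_pM2l ?expR_gt0//; lra.
by rewrite ler_wpM2r ?subr_ge0// ler_expR.
Qed.

Lemma hasd_scale (k s : R) : hasd (fun r : R => k * r) s k.
Proof.
move=> e e0; near=> h.
rewrite mulrDr [k * s + _]addrC addrK [h *: k]mulrC subrr normr0 mulr_ge0//; exact: ltW.
Unshelve. all: by end_near. Qed.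

Lemma hasd_expR (c k s : R) :
  hasd (fun r : R => c * expR (k * r)) s (c * k * expR (k * s)).
Proof.
have h1 : hasd expR (k * s) (expR (k * s)) by apply/hasdP; exact: is_derive_expR.
have h2 := hasd_comp (hasd_scale k s) h1.
have := hasd_comp h2 (hasd_scale c (expR (k * s))).
by rewrite [_ *: c](_ : _ = c * k * expR (k * s))// /GRing.scale /=; ring.
Qed.

End Exponential.

Section Picard.
Context {R : realType}.
Notation mu := (@lebesgue_measure R).

Lemma ae_forall_fin (I : finType) (P : I -> R -> Prop) :
  (forall i, {ae mu, forall s, P i s}) -> {ae mu, forall s, forall i, P i s}.
Proof. by move=> H; exact: (@filter_forall _ _ _ (almost_everywhere mu) (ae_filter_ringOfSetsType mu)). Qed.

Lemma ae_all (P : R -> Prop) : (forall s, P s) -> {ae mu, forall s, P s}.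
Proof. by move=> H; apply: (@aeS _ (fun=> True)) => //; exact: aeW. Qed.

Lemma expR_scale_lip (c k t s s' : R) : 0 <= c -> 0 <= k ->
  s \in `[0, t] -> s' \in `[0, t] ->
  `|c * expR (k * s) - c * expR (k * s')| <= c * k * expR (k * t) * `|s - s'|.
Proof.
rewrite !in_itv/= => c0 k0 /andP[s0 st] /andP[s'0 s't].
rewrite -mulrBr normrM ger0_norm// -!mulrA ler_wpM2l//.
apply: (le_trans (@expR_lip _ (k * t) _ _ _ _)); rewrite ?ler_wpM2l//.
by rewrite -mulrBr normrM (ger0_norm k0) mulrCA.
Qed.

(** The right-hand sides that Picard iteration accepts. Measurability is asked along continuous
    paths, a form that passes directly through sums, products and compositions. *)
Definition admissible (t : R) n (F : R -> 'rV[R]_n -> R) : Prop :=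
  (exists2 C : R, 0 <= C & forall s, s \in `[0, t] -> forall x,
     `|F s x| <= C /\ forall y, `|F s x - F s y| <= C * `|x - y|) /\
  (forall Z : R -> 'rV[R]_n, continuous Z -> measurable_fun setT (fun s => F s (Z s))).

(** The intervals of radius [c * 2 / 2 ^+ k] around [u k] are nested, and the supremum of their left
    ends lies in all of them. *)
Lemma geometric_limit (u : nat -> R) (c : R) : 0 <= c ->
  (forall k, `|u k.+1 - u k| <= c / 2 ^+ k) ->
  exists l, forall k, `|u k - l| <= c * 2 / 2 ^+ k.
Proof.
move=> c0 H.
pose d k := c * 2 / 2 ^+ k.
have dS k : d k - d k.+1 = c / 2 ^+ k.
  have k0 : (2 : R) ^+ k != 0 by rewrite expf_neq0.
  by rewrite /d exprS; field.
have d0 k : 0 <= d k by rewrite /d divr_ge0 ?exprn_ge0// mulr_ge0.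
have vS k : u k - d k <= u k.+1 - d k.+1.
  by have := H k; rewrite -dS ler_norml => /andP[? _]; lra.
have wS k : u k.+1 + d k.+1 <= u k + d k.
  by have := H k; rewrite -dS ler_norml => /andP[_ ?]; lra.
have vm k j : u k - d k <= u (k + j)%N - d (k + j)%N.
  by elim: j => [|j IH]; rewrite ?addn0// addnS; exact: le_trans (vS _).
have wm k j : u (k + j)%N + d (k + j)%N <= u k + d k.
  by elim: j => [|j IH]; rewrite ?addn0// addnS; exact: le_trans (wS _) IH.
have vw k j : u k - d k <= u j + d j.
  have := vm k j; have := wm j k; have := d0 (k + j)%N; rewrite (addnC j) => ? ? ?; lra.
pose E := range (fun k => u k - d k).
exists (sup E) => k.
have h1 : u k - d k <= sup E.
  by apply: ub_le_sup; [exists (u k + d k) => _ [j _ <-]|exists k].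
have h2 : sup E <= u k + d k.
  by apply: ge_sup; [exists (u 0%N - d 0%N); exists 0%N|move=> _ [j _ <-]].
rewrite ler_norml -/(d k); apply/andP; split; lra.
Qed.

Lemma max_lip (a b c d : R) : `|Num.max a b - Num.max c d| <= Num.max `|a - c| `|b - d|.
Proof.
have h1 := ler_norm (a - c); have h2 := ler_norm (c - a); rewrite distrC in h2.
have h3 := ler_norm (b - d); have h4 := ler_norm (d - b); rewrite distrC in h4.
rewrite le_max; apply/orP.
case: (leP a b) => ab; case: (leP c d) => cd.
- by right.
- case: (leP b c) => bc; last by right; rewrite ler_norml; apply/andP; split; lra.
  by left; rewrite ler_norml; apply/andP; split; lra.
- case: (leP a d) => ad; last by left; rewrite ler_norml; apply/andP; split; lra.
  by right; rewrite ler_norml; apply/andP; split; lra.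
- by left.
Qed.

Lemma min_lip (a b c d : R) : `|Num.min a b - Num.min c d| <= Num.max `|a - c| `|b - d|.
Proof.
have e (x y : R) : - x - - y = - (x - y) by ring.
by have := max_lip (- a) (- b) (- c) (- d); rewrite -!oppr_min !e !normrN.
Qed.

Definition clamp (t s : R) : R := Num.max 0 (Num.min s t).

Lemma clamp_id t s : s \in `[0, t] -> clamp t s = s.
Proof.
by rewrite in_itv/= /clamp => /andP[s0 st]; rewrite min_l// max_r.
Qed.

Lemma clamp_itv t s : 0 <= t -> clamp t s \in `[0, t].
Proof.
by move=> t0; rewrite in_itv/= /clamp le_max lexx/= ge_max t0 ge_min lexx orbT.
Qed.

Lemma clamp_lip t s s' : `|clamp t s - clamp t s'| <= `|s - s'|.
Proof.
rewrite (le_trans (max_lip _ _ _ _))// subrr normr0 ge_max normr_ge0.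
by rewrite (le_trans (min_lip _ _ _ _))// subrr normr0 ge_max lexx normr_ge0.
Qed.

Section Solution.
Variables (t : R) (n : nat) (F : 'I_n -> R -> 'rV[R]_n -> R) (z0 : 'rV[R]_n).
Hypothesis t0 : 0 <= t.
Variable C : R.
Hypothesis C0 : 0 < C.
Hypothesis FC : forall j s, s \in `[0, t] -> forall x, `|F j s x| <= C.
Hypothesis FL : forall j s, s \in `[0, t] -> forall x y,
  `|F j s x - F j s y| <= C * `|x - y|.
Hypothesis mF : forall j (Z : R -> 'rV[R]_n), continuous Z ->
  measurable_fun setT (fun s => F j s (Z s)).

Let step (Z : R -> 'rV[R]_n) (s : R) : 'rV[R]_n :=
  \row_j (z0 ord0 j + prim t (fun r => F j r (Z r)) s).

Let step_lip Z : continuous Z -> forall s s', `|step Z s - step Z s'| <= C * `|s - s'|.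
Proof.
move=> cZ s s'; apply: norm_le_coord => [|j]; first by rewrite mulr_ge0// ltW.
rewrite !mxE (_ : forall a b c : R, a + b - (a + c) = b - c); last by move=> *; ring.
by apply: prim_lip => [|//|r rt]; [exact: ltW|exact: mF|exact: FC].
Qed.

Let step_ae Z : continuous Z ->
  {ae mu, forall s, s \in `]0, t[ -> hasd (step Z) s (\row_j F j s (Z s))}.
Proof.
move=> cZ.
have H j : {ae mu, forall s, s \in `]0, t[ -> hasd (prim t (fun r => F j r (Z r))) s (F j s (Z s))}.
  by apply: (@prim_ae _ t C) => [|//|r rt]; [exact: ltW|exact: mF|exact: FC].
apply: aeS (ae_forall_fin H) => s Hs st; apply/hasd_coord => j.
rewrite mxE -[F j s _]add0r.
under [X in hasd X _ _]funext do rewrite mxE.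
by apply: hasdD; [exact: hasd_cst|exact: Hs].
Qed.

(** Integrating the weight [expR (2 * C * s)] divides it by [2 * C], so in the weighted distance the
    iteration is a contraction of ratio one half on all of [[0, t]] at once. *)
Let step_contract Z Z' (K : R) : 0 <= K -> continuous Z -> continuous Z' ->
  (forall s, s \in `[0, t] -> `|Z s - Z' s| <= K * expR (2 * C * s)) ->
  forall s, s \in `[0, t] -> `|step Z s - step Z' s| <= K / 2 * expR (2 * C * s).
Proof.
move=> K0 cZ cZ' H s st; have [s0 ts] : 0 <= s /\ s <= t by move: st; rewrite in_itv/= => /andP.
have sub r : r \in `[0, s] -> r \in `[0, t].
  by rewrite !in_itv/= => /andP[-> /le_trans]; exact.
have sub' r : r \in `]0, s[ -> r \in `]0, t[.
  by rewrite !in_itv/= => /andP[-> /lt_le_trans]; exact.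
have K20 : 0 <= K / 2 by rewrite divr_ge0.
have C20 : 0 <= 2 * C by rewrite mulr_ge0// ltW.
apply: norm_le_coord => [|j]; first by rewrite mulr_ge0 ?expR_ge0//.
rewrite !mxE (_ : forall a b c : R, a + b - (a + c) = b - c); last by move=> *; ring.
pose p Y r := prim t (fun r => F j r (Y r)) r.
have pl Y : continuous Y -> forall x y, `|p Y x - p Y y| <= C * `|x - y|.
  move=> cY x y; apply: prim_lip => [|//|r rt]; [exact: ltW|exact: mF|exact: FC].
have pa Y : continuous Y -> {ae mu, forall s, s \in `]0, t[ -> hasd (p Y) s (F j s (Y s))}.
  by move=> cY; apply: (@prim_ae _ t C) => [|//|r rt]; [exact: ltW|exact: mF|exact: FC].
have := @lip_ae_le R (fun r => p Z r - p Z' r) (fun r => K / 2 * expR (2 * C * r)) 0 s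
  (C + C) (K / 2 * (2 * C) * expR (2 * C * t)) (fun r => F j r (Z r) - F j r (Z' r))
  (fun r => K / 2 * (2 * C) * expR (2 * C * r)) s0.
rewrite /p !prim0 !subr0 => Q.
apply: (le_trans (Q _ _ _ _ _)).
- move=> x y _ _; rewrite -/(p Z x) -/(p Z y) -/(p Z' x) -/(p Z' y).
  rewrite (_ : _ - _ = (p Z x - p Z y) - (p Z' x - p Z' y)); last by ring.
  by rewrite (le_trans (ler_normB _ _))// mulrDl lerD ?pl.
- by move=> x y xs ys; apply: expR_scale_lip => //; exact: sub.
- apply: aeS2 (pa _ cZ) (pa _ cZ') => r h h' rs.
  by apply: hasdB; [apply: h|apply: h']; exact: sub'.
- by apply: ae_all => r _; exact: hasd_expR.
- apply: ae_all => r rs.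
  have rt : r \in `[0, t].
    by apply: sub; move: rs; rewrite !in_itv/= => /andP[/ltW -> /ltW ->].
  apply: (le_trans (FL _ rt _ _)).
  rewrite (_ : K / 2 * (2 * C) * _ = C * (K * expR (2 * C * r))); last by field.
  by rewrite ler_pM2l// H.
by rewrite mulr0 expR0 mulr1 lerBlDr lerDl.
Qed.

Lemma picard_solution : exists Z : R -> 'rV[R]_n,
  [/\ Z 0 = z0, forall s s', `|Z s - Z s'| <= C * `|s - s'|
    & {ae mu, forall s, s \in `]0, t[ -> hasd Z s (\row_j F j s (Z s))}].
Proof.
pose W k := iter k step (fun=> z0).
have cW k : continuous (W k).
  case: k => [|k]; first by move=> s; exact: cvg_cst.
  suff : continuous (step (W k)) by [].
  elim: k => [|k IH]; apply: lip_continuous (step_lip _) => //.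
  by move=> s; exact: cvg_cst.
pose K := C * t; have K0 : 0 <= K by rewrite mulr_ge0// ltW.
have exp1 s : s \in `[0, t] -> 1 <= expR (2 * C * s).
  by rewrite in_itv/= => /andP[s0 _]; rewrite -expR0 ler_expR !mulr_ge0// ltW.
have WS k s : s \in `[0, t] -> `|W k.+1 s - W k s| <= K / 2 ^+ k * expR (2 * C * s).
  elim: k s => [|k IH] s st.
    rewrite expr0 divr1 /=.
    have z0E : step (fun=> z0) 0 = z0 by apply/rowP => j; rewrite mxE prim0 addr0.
    have cz0 : continuous (fun _ : R => z0) by move=> r; exact: cvg_cst.
    have := step_lip cz0 s 0; rewrite z0E => /le_trans; apply.
    rewrite subr0 /K -mulrA ler_pM2l//.
    have := exp1 s st; move: st; rewrite in_itv/= => /andP[s0 st] e1.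
    rewrite ger0_norm// (le_trans st)// ler_peMr//.
  rewrite exprSr invfM mulrA.
  have K2 : 0 <= K / 2 ^+ k by rewrite divr_ge0// exprn_ge0.
  exact: (step_contract K2 (cW k.+1) (cW k) IH st).
clearbody K.
have KE s : 0 <= K * expR (2 * C * s) * 2 by rewrite !mulr_ge0 ?expR_ge0.
have /choice[lim0 lim0P] : forall s, exists l : 'rV[R]_n, s \in `[0, t] ->
    forall k, `|W k s - l| <= K * expR (2 * C * s) * 2 / 2 ^+ k.
  move=> s; have [st|_] := boolP (s \in `[0, t]); last by exists 0.
  have /choice[l lP] : forall j, exists l, forall k,
      `|W k s ord0 j - l| <= K * expR (2 * C * s) * 2 / 2 ^+ k.
    move=> j; apply: geometric_limit => [|k]; first by rewrite mulr_ge0 ?expR_ge0//.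
    rewrite mulrAC; apply: le_trans (WS k s st).
    by have := coord_le_norm (W k.+1 s - W k s) j; rewrite !mxE.
  exists (\row_j l j) => _ k; apply: norm_le_coord => [|j]; last by rewrite !mxE.
  by rewrite divr_ge0 ?exprn_ge0.
(* Freezing the limit outside [[0, t]] makes it Lipschitz on the whole line, so that [step] can be
   applied to it. *)
pose L s := lim0 (clamp t s).
have small (x c : R) : 0 <= c -> (forall k : nat, x <= c / 2 ^+ k) -> x <= 0.
  move=> c0 H; rewrite leNgt; apply/negP => x0.
  have [k kc] : exists k : nat, c < x * 2 ^+ k.
    have [k ck] : exists k : nat, c / x < k%:R.
      by exists (Num.bound (c / x)); apply: archi_boundP; rewrite divr_ge0// ltW.
    exists k; rewrite mulrC -ltr_pdivrMr//; apply: (lt_trans ck).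
    by rewrite -natrX ltr_nat ltn_expl.
  by have := H k; rewrite ler_pdivlMr ?exprn_gt0// leNgt kc.
have LW s k : s \in `[0, t] -> `|W k s - L s| <= K * expR (2 * C * s) * 2 / 2 ^+ k.
  by move=> st; rewrite /L clamp_id//; exact: lim0P.
have Llip s s' : `|L s - L s'| <= C * `|s - s'|.
  have cs := clamp_itv s t0; have cs' := clamp_itv s' t0.
  apply: (@le_trans _ _ (C * `|clamp t s - clamp t s'|)); last first.
    by rewrite ler_pM2l// clamp_lip.
  rewrite -subr_le0; pose cc r := K * expR (2 * C * r) * 2.
  have cc0 r : 0 <= cc r by rewrite !mulr_ge0 ?expR_ge0//.
  apply: (@small _ (cc (clamp t s) + cc (clamp t s'))); first by rewrite addr_ge0.
  move=> k; rewrite lerBlDr.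
  have h1 := @lim0P _ cs k; have h2 := @lim0P _ cs' k.
  have h3 : `|W k (clamp t s) - W k (clamp t s')| <= C * `|clamp t s - clamp t s'|.
    case: k {h1 h2} => [|k]; last by apply: step_lip.
    by rewrite subrr normr0 mulr_ge0// ltW.
  rewrite /L (_ : lim0 _ - lim0 _ = - (W k (clamp t s) - lim0 (clamp t s)) +
      (W k (clamp t s') - lim0 (clamp t s')) + (W k (clamp t s) - W k (clamp t s'))); last first.
    by apply/rowP => j; rewrite !mxE; ring.
  rewrite (le_trans (ler_normD _ _))// lerD// (le_trans (ler_normD _ _))//.
  by rewrite normrN mulrDl lerD.
have cL : continuous L by exact: lip_continuous Llip.
have LE s : s \in `[0, t] -> step L s = L s.
  move=> st; apply/eqP; rewrite -subr_eq0 -normr_le0.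
  apply: (@small _ (K * expR (2 * C * s) * 3)); first by rewrite !mulr_ge0 ?expR_ge0//.
  move=> k; rewrite (_ : step L s - L s = (W k.+1 s - L s) - (W k.+1 s - step L s)); last first.
    by apply/rowP => j; rewrite !mxE; ring.
  have h1 := LW s k.+1 st.
  have h2 : `|W k.+1 s - step L s| <= K * 2 / 2 ^+ k / 2 * expR (2 * C * s).
    apply: step_contract => // [|r rt]; first by rewrite divr_ge0 ?exprn_ge0// mulr_ge0.
    by rewrite (le_trans (LW r k rt))// le_eqVlt; apply/orP; left; apply/eqP; ring.
  rewrite (le_trans (ler_normB _ _))//.
  apply: le_trans (lerD h1 h2) _; rewrite exprS.
  set q := expR _; have q0 : 0 <= q by exact: expR_ge0.
  have k0 : (2 : R) ^+ k != 0 by rewrite expf_neq0.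
  have -> : K * q * 2 / (2 * 2 ^+ k) + K * 2 / 2 ^+ k / 2 * q = K * q * 2 / 2 ^+ k by field.
  rewrite ler_wpM2r ?invr_ge0 ?exprn_ge0//.
  by rewrite ler_wpM2l ?mulr_ge0//; lra.
(* [step L] agrees with [L] on [[0, t]] and, being a primitive, has the required derivative almost
   everywhere. *)
exists (step L); split.
- by apply/rowP => j; rewrite mxE prim0 addr0.
- exact: step_lip.
apply: aeS (step_ae cL) => s H st; rewrite LE; first exact: H.
by move: st; rewrite !in_itv/= => /andP[/ltW -> /ltW ->].
Qed.

End Solution.

Lemma picard (t : R) n (F : 'I_n -> R -> 'rV[R]_n -> R) (z0 : 'rV[R]_n) : 0 <= t ->
  (forall j, admissible t (F j)) ->
  exists Z : R -> 'rV[R]_n, [/\ Z 0 = z0,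
    exists M : R, forall s s', `|Z s - Z s'| <= M * `|s - s'|
  & {ae mu, forall s, s \in `]0, t[ -> hasd Z s (\row_j F j s (Z s))}].
Proof.
move=> t0 aF.
have /choice[C CP] : forall j, exists C : R, 0 <= C /\ forall s, s \in `[0, t] -> forall x,
     `|F j s x| <= C /\ forall y, `|F j s x - F j s y| <= C * `|x - y|.
  by move=> j; have [[C ? ?] _] := aF j; exists C.
pose M := 1 + \sum_j C j.
have CM j : C j <= M.
  rewrite /M (bigD1 j)//= addrCA lerDl addr_ge0//.
  by apply: sumr_ge0 => i _; case: (CP i).
have M0 : 0 < M by rewrite ltr_wpDr// sumr_ge0// => i _; case: (CP i).
have [|||Z [Z1 Z2 Z3]] := @picard_solution t n F z0 t0 M M0.
- by move=> j s st x; apply: le_trans (CM j); have [_ /(_ s st x)[]] := CP j.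
- move=> j s st x y; apply: (@le_trans _ _ (C j * `|x - y|)).
    by have [_ /(_ s st x)[_]] := CP j.
  by rewrite ler_wpM2r.
- by move=> j; have [_] := aF j.
by exists Z; split => //; exists M.
Qed.
End Picard.

(** * A global defining function for the interface *)

Section Dot.
Context {R : realType} (n : nat).
Implicit Types u v w : 'rV[R]_n.

Lemma dotC u v : dot u v = dot v u.
Proof. by apply: eq_bigr => i _; rewrite mulrC. Qed.

Lemma dotDl u v w : dot (u + v) w = dot u w + dot v w.
Proof. by rewrite /dot -big_split; apply: eq_bigr => i _; rewrite !mxE mulrDl. Qed.

Lemma dotDr u v w : dot w (u + v) = dot w u + dot w v.
Proof. by rewrite !(dotC w) dotDl. Qed.

Lemma dotZl (k : R) u w : dot (k *: u) w = k * dot u w.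
Proof. by rewrite /dot mulr_sumr; apply: eq_bigr => i _; rewrite !mxE mulrA. Qed.

Lemma dotZr (k : R) u w : dot w (k *: u) = k * dot w u.
Proof. by rewrite !(dotC w) dotZl. Qed.

Lemma dotNl u w : dot (- u) w = - dot u w.
Proof. by rewrite -scaleN1r dotZl mulN1r. Qed.

Lemma dotNr u w : dot w (- u) = - dot w u.
Proof. by rewrite !(dotC w) dotNl. Qed.

Lemma dotBl u v w : dot (u - v) w = dot u w - dot v w.
Proof. by rewrite dotDl dotNl. Qed.

Lemma dotBr u v w : dot w (u - v) = dot w u - dot w v.
Proof. by rewrite dotDr dotNr. Qed.

Lemma dot0l w : dot 0 w = 0.
Proof. by rewrite -(scale0r 0) dotZl mul0r. Qed.

Lemma dot_ge0 u : 0 <= dot u u.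
Proof. by apply: sumr_ge0 => i _; rewrite -expr2 sqr_ge0. Qed.

Lemma dot_eq0 u : (dot u u == 0) = (u == 0).
Proof.
apply/idP/eqP => [|->]; last by rewrite dot0l.
rewrite psumr_eq0 => [/allP H|i _]; last by rewrite -expr2 sqr_ge0.
apply/rowP => i; rewrite mxE; apply/eqP.
by have := H i (mem_index_enum i); rewrite /= -expr2 sqrf_eq0.
Qed.

Lemma dot_gt0 u : (0 < dot u u) = (u != 0).
Proof. by rewrite lt_neqAle dot_ge0 andbT eq_sym dot_eq0. Qed.

Lemma dot_norm u v : `|dot u v| <= n%:R * (`|u| * `|v|).
Proof.
apply: (le_trans (ler_norm_sum _ _ _)).
have -> : n%:R * (`|u| * `|v|) = \sum_(i < n) (`|u| * `|v|).
  by rewrite sumr_const card_ord mulr_natl.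
by apply: ler_sum => i _; rewrite normrM ler_pM// coord_le_norm.
Qed.

Lemma norm_le_enorm u : `|u| <= enorm u.
Proof.
apply: norm_le_coord => [|j]; first exact: sqrtr_ge0.
rewrite -sqrtr_sqr ler_sqrt ?dot_ge0// /dot (bigD1 j)//= -expr2 lerDl.
by apply: sumr_ge0 => i _; rewrite -expr2 sqr_ge0.
Qed.

Lemma enorm_le_norm u : enorm u <= n%:R * `|u|.
Proof.
rewrite -[leRHS]ger0_norm ?mulr_ge0// -sqrtr_sqr ler_sqrt ?sqr_ge0//.
apply: (le_trans (ler_norm _)); apply: (le_trans (dot_norm u u)).
rewrite exprMn -expr2 ler_wpM2r ?sqr_ge0// -natrX ler_nat -mulnn.
by case: (n) => // m; exact: leq_pmulr.
Qed.

Lemma enormZ (k : R) u : enorm (k *: u) = `|k| * enorm u.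
Proof.
by rewrite /enorm dotZl dotZr mulrA -expr2 sqrtrM ?sqr_ge0// sqrtr_sqr.
Qed.

Lemma enorm_gt0 u : (0 < enorm u) = (u != 0).
Proof. by rewrite sqrtr_gt0 dot_gt0. Qed.

(* [u0] is the component of [q] orthogonal to [p]: tilting it slightly
   against [p] enters the half-space, which forces [u0 = 0]. *)
Lemma half_space_normal (p q : 'rV[R]_n) : p != 0 -> q != 0 ->
  (forall u, dot u p < 0 -> dot u q <= 0) -> exists2 k : R, 0 < k & q = k *: p.
Proof.
move=> p0 q0 H.
have pp : 0 < dot p p by rewrite dot_gt0.
pose k := dot q p / dot p p; pose u0 := q - k *: p.
have u0p : dot u0 p = 0 by rewrite dotBl dotZl divfK ?subrr// gt_eqF.
have u0q : dot u0 q = dot u0 u0.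
  by rewrite [in RHS]/u0 dotBr dotZr u0p mulr0 subr0.
have u00 : u0 = 0.
  apply/eqP; rewrite -dot_eq0 eq_le dot_ge0 andbT; apply/ler_addgt0Pr => e e0.
  pose d := e / (`|dot p q| + 1).
  have d1 : 0 < `|dot p q| + 1 by rewrite ltr_wpDl.
  have d0 : 0 < d by rewrite divr_gt0.
  have := H (u0 - d *: p); rewrite dotBl dotZl u0p sub0r oppr_lt0 mulr_gt0// => /(_ isT).
  rewrite dotBl dotZl u0q subr_le0 => /le_trans; apply.
  rewrite add0r; apply: (@le_trans _ _ (d * (`|dot p q| + 1))).
    by rewrite ler_pM2l//; apply: (le_trans (ler_norm _)); rewrite lerDl.
  by rewrite divfK// gt_eqF.
have qk : q = k *: p by apply/eqP; rewrite -subr_eq0; apply/eqP.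
exists k => //.
have k_neq0 : k != 0 by apply: contraNneq q0 => k0; rewrite qk k0 scale0r.
rewrite lt_neqAle eq_sym k_neq0/= divr_ge0// ?dot_ge0//.
by have := H (- p); rewrite !dotNl oppr_lt0 pp oppr_le0 dotC => /(_ isT).
Qed.

End Dot.

(** * Calculus of C^{1,1} functions *)

Section C11.
Context {R : realType} (n : nat).
Implicit Types (S : set 'rV[R]_n) (f g : 'rV[R]_n -> R) (F G : 'rV[R]_n -> 'rV[R]_n).

(* The quantitative form of C^{1,1}: [F] is the gradient of [f]. *)
Definition C11on S f F (C : R) : Prop :=
  [/\ (forall z, S z -> `|f z| <= C /\ `|F z| <= C),
      (forall z z', S z -> S z' -> `|f z' - f z| <= C * `|z' - z|),
      (forall z z', S z -> S z' -> `|F z' - F z| <= C * `|z' - z|)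
    & forall z z', S z -> S z' ->
        `|f z' - f z - dot (F z) (z' - z)| <= C * `|z' - z| ^+ 2].

Lemma C11on_le S f F (C C' : R) : C <= C' -> C11on S f F C -> C11on S f F C'.
Proof.
move=> CC [H1 H2 H3 H4]; split.
- by move=> z /H1[h1 h2]; split; [exact: le_trans h1 _|exact: le_trans h2 _].
- by move=> z z' /H2 h /h /le_trans; apply; rewrite ler_wpM2r.
- by move=> z z' /H3 h /h /le_trans; apply; rewrite ler_wpM2r.
- by move=> z z' /H4 h /h /le_trans; apply; rewrite ler_wpM2r// sqr_ge0.
Qed.

Lemma C11on_sub S S' f F (C : R) : S' `<=` S -> C11on S f F C -> C11on S' f F C.
Proof.
move=> SS [H1 H2 H3 H4]; split=> [z /SS /H1//|z z' /SS a /SS b|z z' /SS a /SS b|z z' /SS a /SS b].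
- exact: H2.
- exact: H3.
- exact: H4.
Qed.

Lemma C11onD S f g F G (C C' : R) : C11on S f F C -> C11on S g G C' ->
  C11on S (fun z => f z + g z) (fun z => F z + G z) (C + C').
Proof.
move=> [f1 f2 f3 f4] [g1 g2 g3 g4]; split.
- move=> z Sz; have [a b] := f1 z Sz; have [c d] := g1 z Sz.
  by split; rewrite (le_trans (ler_normD _ _))// lerD.
- move=> z z' Sz Sz'; rewrite (_ : _ - _ = (f z' - f z) + (g z' - g z)); last by ring.
  by rewrite (le_trans (ler_normD _ _))// mulrDl lerD ?f2 ?g2.
- move=> z z' Sz Sz'; rewrite opprD addrACA.
  by rewrite (le_trans (ler_normD _ _))// mulrDl lerD ?f3 ?g3.
- move=> z z' Sz Sz'; rewrite dotDl (_ : _ - _ = (f z' - f z - dot (F z) (z' - z)) +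
    (g z' - g z - dot (G z) (z' - z))); last by ring.
  by rewrite (le_trans (ler_normD _ _))// mulrDl lerD ?f4 ?g4.
Qed.

Lemma C11onM S f g F G (C : R) : 0 <= C -> C11on S f F C -> C11on S g G C ->
  C11on S (fun z => f z * g z) (fun z => f z *: G z + g z *: F z) ((4 + n%:R) * C ^+ 2).
Proof.
move=> C0 [f1 f2 f3 f4] [g1 g2 g3 g4].
have n0 : (0 : R) <= n%:R by [].
have C2 : 0 <= C ^+ 2 by rewrite sqr_ge0.
have nC : 0 <= n%:R * C ^+ 2 by rewrite mulr_ge0.
split.
- move=> z Sz; have [a b] := f1 z Sz; have [c d] := g1 z Sz; split.
    rewrite normrM; apply: (@le_trans _ _ (C * C)); first exact: ler_pM.
    by rewrite -expr2 mulrDl; lra.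
  rewrite (le_trans (ler_normD _ _))// !normrZ.
  have h1 : `|f z| * `|G z| <= C * C by exact: ler_pM.
  have h2 : `|g z| * `|F z| <= C * C by exact: ler_pM.
  by apply: (le_trans (lerD h1 h2)); rewrite -expr2 mulrDl; lra.
- move=> z z' Sz Sz'; have [a b] := f1 z' Sz'; have [c d] := g1 z Sz.
  rewrite (_ : _ - _ = f z' * (g z' - g z) + (f z' - f z) * g z); last by ring.
  rewrite (le_trans (ler_normD _ _))// !normrM.
  have h1 : `|f z'| * `|g z' - g z| <= C * (C * `|z' - z|) by apply: ler_pM => //; exact: g2.
  have h2 : `|f z' - f z| * `|g z| <= (C * `|z' - z|) * C by apply: ler_pM => //; exact: f2.
  apply: (le_trans (lerD h1 h2)).
  have nz : 0 <= C ^+ 2 * `|z' - z| by rewrite mulr_ge0.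
  have nn : 0 <= n%:R * (C ^+ 2 * `|z' - z|) by rewrite mulr_ge0.
  have -> : C * (C * `|z' - z|) + C * `|z' - z| * C = 2 * (C ^+ 2 * `|z' - z|) by ring.
  by rewrite -mulrA mulrDl; move: (C ^+ 2 * _) nz nn => q nz nn; lra.
- move=> z z' Sz Sz'; have [a b] := f1 z' Sz'; have [c d] := g1 z' Sz'.
  have [a' b'] := f1 z Sz; have [c' d'] := g1 z Sz.
  rewrite (_ : _ - _ = f z' *: (G z' - G z) + (f z' - f z) *: G z +
    (g z' *: (F z' - F z) + (g z' - g z) *: F z)); last first.
    by apply/rowP => j; rewrite !mxE; ring.
  have h1 : `|f z'| * `|G z' - G z| <= C * (C * `|z' - z|) by apply: ler_pM => //; exact: g3.
  have h2 : `|f z' - f z| * `|G z| <= C * `|z' - z| * C by apply: ler_pM => //; exact: f2.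
  have h3 : `|g z'| * `|F z' - F z| <= C * (C * `|z' - z|) by apply: ler_pM => //; exact: f3.
  have h4 : `|g z' - g z| * `|F z| <= C * `|z' - z| * C by apply: ler_pM => //; exact: g2.
  apply: (le_trans (ler_normD _ _)).
  apply: (le_trans (lerD (ler_normD _ _) (ler_normD _ _))); rewrite !normrZ.
  apply: (le_trans (lerD (lerD h1 h2) (lerD h3 h4))).
  have nn : 0 <= n%:R * (C ^+ 2 * `|z' - z|) by rewrite !mulr_ge0.
  have -> : C * (C * `|z' - z|) + C * `|z' - z| * C + (C * (C * `|z' - z|) + C * `|z' - z| * C) =
    4 * (C ^+ 2 * `|z' - z|) by ring.
  rewrite -subr_ge0 (_ : _ - _ = n%:R * (C ^+ 2 * `|z' - z|)) //.
  by ring.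
- move=> z z' Sz Sz'; have [a b] := f1 z' Sz'; have [c d] := g1 z Sz.
  have [a' b'] := f1 z Sz; have [c' d'] := g1 z Sz.
  rewrite dotDl !dotZl (_ : _ - _ = f z' * (g z' - g z - dot (G z) (z' - z)) +
    (f z' - f z) * dot (G z) (z' - z) + g z * (f z' - f z - dot (F z) (z' - z))); last by ring.
  have h1 : `|f z'| * `|g z' - g z - dot (G z) (z' - z)| <= C * (C * `|z' - z| ^+ 2).
    by apply: ler_pM => //; exact: g4.
  have h2 : `|f z' - f z| * `|dot (G z) (z' - z)| <= (C * `|z' - z|) * (n%:R * (C * `|z' - z|)).
    apply: ler_pM => //; first exact: f2.
    by apply: (le_trans (dot_norm _ _)); rewrite ler_wpM2l// ler_wpM2r.
  have h3 : `|g z| * `|f z' - f z - dot (F z) (z' - z)| <= C * (C * `|z' - z| ^+ 2).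
    by apply: ler_pM => //; exact: f4.
  apply: (le_trans (ler_normD _ _)).
  apply: (le_trans (lerD (ler_normD _ _) (lexx _))); rewrite !normrM.
  apply: (le_trans (lerD (lerD h1 h2) h3)).
  have q0 : 0 <= C ^+ 2 * `|z' - z| ^+ 2 by rewrite mulr_ge0// sqr_ge0.
  rewrite -subr_ge0 (_ : _ - _ = 2 * (C ^+ 2 * `|z' - z| ^+ 2)); first by rewrite mulr_ge0.
  by ring.
Qed.

End C11.

(** * Localisation by bump functions *)

Section Bump.
Context {R : realType} (n : nat).
Implicit Types (f : 'rV[R]_n -> R) (F : 'rV[R]_n -> 'rV[R]_n).

(** Since [p z] is at most linear in the distance to the set where [p] is nonpositive, the bounds by
    [p z ^+ 2] and [p z] make the value vanish to second order and the gradient to first order at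
    the edge of the support. This is what an extension by zero within C^{1,1} requires. *)
Lemma C11on_extend (p f : 'rV[R]_n -> R) F (C C1 C3 m : R) :
  0 <= C -> 0 <= C1 -> 0 <= C3 -> 0 <= m ->
  C11on [set z | 0 < p z] f F C ->
  (forall z z', 0 < p z -> p z' <= 0 -> p z <= C1 * `|z' - z|) ->
  (forall z, 0 < p z -> [/\ p z <= m, `|f z| <= C3 * p z ^+ 2 & `|F z| <= C3 * p z]) ->
  exists2 K : R, 0 <= K &
    C11on setT (fun z => if 0 < p z then f z else 0) (fun z => if 0 < p z then F z else 0) K.
Proof.
move=> C0 C10 C30 m0 [H1 H2 H3 H4] pl pb.
pose K := C + C3 * C1 ^+ 2 + n%:R * (C3 * C1) + C3 * C1 + C3 * m * C1.
have t1 : 0 <= C3 * C1 ^+ 2 by rewrite mulr_ge0 ?sqr_ge0.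
have t2 : 0 <= n%:R * (C3 * C1) by rewrite !mulr_ge0.
have t3 : 0 <= C3 * C1 by rewrite mulr_ge0.
have t4 : 0 <= C3 * m * C1 by rewrite !mulr_ge0.
have CK : C <= K by rewrite /K; lra.
have K0 : 0 <= K by exact: le_trans CK.
have fp z z' : 0 < p z -> p z' <= 0 -> `|f z| <= C3 * C1 ^+ 2 * `|z' - z| ^+ 2.
  move=> pz pz'; have [_ h _] := pb z pz; apply: (le_trans h).
  rewrite -mulrA -exprMn ler_wpM2l// lerXn2r ?nnegrE ?mulr_ge0//; [exact: ltW|exact: pl].
have fl z z' : 0 < p z -> p z' <= 0 -> `|f z| <= C3 * m * C1 * `|z' - z|.
  move=> pz pz'; have [h1 h _] := pb z pz; apply: (le_trans h).
  rewrite expr2 -!mulrA ler_wpM2l//.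
  by apply: ler_pM; [exact: ltW|exact: ltW|exact: h1|exact: pl].
have Fp z z' : 0 < p z -> p z' <= 0 -> `|F z| <= C3 * C1 * `|z' - z|.
  by move=> pz pz'; have [_ _ h] := pb z pz; apply: (le_trans h); rewrite -mulrA ler_wpM2l//; exact: pl.
have le1 z z' : C3 * m * C1 * `|z' - z| <= K * `|z' - z :> 'rV[R]_n|.
  by rewrite ler_wpM2r// /K; lra.
have le2 z z' : C3 * C1 * `|z' - z| <= K * `|z' - z :> 'rV[R]_n|.
  by rewrite ler_wpM2r// /K; lra.
exists K => //; split.
- move=> z _; case: ifPn => [/H1[a b]|_]; last by rewrite !normr0.
  by split; [exact: le_trans a CK|exact: le_trans b CK].
- move=> z z' _ _; case: (ltP 0 (p z')) => pz'; case: (ltP 0 (p z)) => pz.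
  + by apply: (le_trans (H2 _ _ pz pz')); rewrite ler_wpM2r.
  + by rewrite subr0 distrC (le_trans (fl _ _ pz' pz))// .
  + by rewrite sub0r normrN (le_trans (fl _ _ pz pz')).
  + by rewrite subrr normr0 mulr_ge0.
- move=> z z' _ _; case: (ltP 0 (p z')) => pz'; case: (ltP 0 (p z)) => pz.
  + by apply: (le_trans (H3 _ _ pz pz')); rewrite ler_wpM2r.
  + by rewrite subr0 distrC (le_trans (Fp _ _ pz' pz)).
  + by rewrite sub0r normrN (le_trans (Fp _ _ pz pz')).
  + by rewrite subrr normr0 mulr_ge0.
- move=> z z' _ _; case: (ltP 0 (p z')) => pz'; case: (ltP 0 (p z)) => pz.
  + by apply: (le_trans (H4 _ _ pz pz')); rewrite ler_wpM2r// sqr_ge0.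
  + rewrite subr0 dot0l subr0 distrC (le_trans (fp _ _ pz' pz))//.
    by rewrite ler_wpM2r ?sqr_ge0// /K; lra.
  + rewrite sub0r -opprD normrN (le_trans (ler_normD _ _))//.
    have h1 := fp _ _ pz pz'.
    have h2 : `|dot (F z) (z' - z)| <= n%:R * (C3 * C1) * `|z' - z| ^+ 2.
      apply: (le_trans (dot_norm _ _)); rewrite -mulrA expr2 ler_wpM2l// mulrA.
      by rewrite ler_wpM2r// Fp.
    apply: (le_trans (lerD h1 h2)); rewrite -mulrDl ler_wpM2r ?sqr_ge0// /K; lra.
  + by rewrite subrr sub0r dot0l oppr0 normr0 mulr_ge0// sqr_ge0.
Qed.

Variables (zi : 'rV[R]_n) (rho : R).
Hypothesis rho0 : 0 < rho.

Let p z : R := rho ^+ 2 - dot (z - zi) (z - zi).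

Lemma bump_gt0_norm z : 0 < p z -> `|z - zi| < rho.
Proof.
rewrite subr_gt0 => h; apply: (le_lt_trans (norm_le_enorm _)).
by rewrite -(ger0_norm (ltW rho0)) -sqrtr_sqr /enorm ltr_sqrt// exprn_gt0.
Qed.

Lemma bump_C11 : exists2 C : R, 0 <= C & C11on [set z | 0 < p z] p (fun z => - 2 *: (z - zi)) C.
Proof.
have n0 : (0 : R) <= n%:R by [].
have r0 := ltW rho0; have r2 : 0 <= rho ^+ 2 by rewrite sqr_ge0.
have nr : 0 <= n%:R * rho by rewrite mulr_ge0.
pose C := rho ^+ 2 + 2 * rho + 2 * (n%:R * rho) + 2 + n%:R.
exists C; first by rewrite /C; lra.
split.
- move=> z /= pz; have wz := bump_gt0_norm pz; split.
    rewrite ger0_norm ?(ltW pz)// /p; have := dot_ge0 (z - zi); rewrite /C; lra.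
  by rewrite normrZ normrN ger0_norm// /C; lra.
- move=> z z' /= pz pz'; have wz := bump_gt0_norm pz; have wz' := bump_gt0_norm pz'.
  have -> : p z' - p z = - dot (z' - z) ((z' - zi) + (z - zi)).
    have -> : z' - z = (z' - zi) - (z - zi) by rewrite opprB addrA subrK.
    rewrite /p; move: (z - zi) (z' - zi) => w w'.
    by rewrite dotBl !dotDr (dotC w w'); ring.
  rewrite normrN (le_trans (dot_norm _ _))//.
  apply: (@le_trans _ _ (n%:R * (`|z' - z| * (rho + rho)))).
    by rewrite ler_wpM2l// ler_wpM2l// (le_trans (ler_normD _ _))// lerD// ltW.
  rewrite (_ : n%:R * _ = 2 * (n%:R * rho) * `|z' - z|); last by ring.
  by rewrite ler_wpM2r// /C; lra.
- move=> z z' /= pz pz'; rewrite -scalerBr opprB addrA subrK normrZ normrN ger0_norm//.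
  by rewrite ler_wpM2r// /C; lra.
- move=> z z' /= pz pz'.
  have -> : p z' - p z - dot (- 2 *: (z - zi)) (z' - z) = - dot (z' - z) (z' - z).
    have -> : z' - z = (z' - zi) - (z - zi) by rewrite opprB addrA subrK.
    rewrite /p; move: (z - zi) (z' - zi) => w w'.
    by rewrite dotZl !dotBl !dotBr (dotC w w'); ring.
  rewrite normrN (le_trans (dot_norm _ _))// -expr2 ler_wpM2r ?sqr_ge0// /C; lra.
Qed.

(** The estimate from the algebra is quadratic in the increment; it is made linear for increments at
    most 1, and larger ones are covered by [p z <= rho ^+ 2]. *)
Lemma bump_dist z z' : 0 < p z -> p z' <= 0 ->
  p z <= (2 * (n%:R * rho) + n%:R + rho ^+ 2) * `|z' - z|.
Proof.
move=> pz pz'; have wz := bump_gt0_norm pz.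
have n0 : (0 : R) <= n%:R by [].
have nr : 0 <= n%:R * rho by rewrite mulr_ge0// ltW.
have r2 : 0 <= rho ^+ 2 by rewrite sqr_ge0.
have pr : p z <= rho ^+ 2 by rewrite /p; have := dot_ge0 (z - zi); lra.
have [h1|h1] := leP `|z' - z| 1; last first.
  apply: (le_trans pr); apply: (@le_trans _ _ (rho ^+ 2 * `|z' - z|)).
    by rewrite ler_peMr// ltW.
  by rewrite ler_wpM2r//; lra.
have h : p z <= dot (z' - z) (2 *: (z - zi) + (z' - z)).
  apply: (@le_trans _ _ (p z - p z')); first by lra.
  have -> : z' - z = (z' - zi) - (z - zi) by rewrite opprB addrA subrK.
  rewrite /p; move: (z - zi) (z' - zi) => w w'.
  by rewrite !dotBl !dotDr !dotZr !dotNr (dotC w w'); lra.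
apply: (le_trans h); apply: (le_trans (ler_norm _)); apply: (le_trans (dot_norm _ _)).
apply: (@le_trans _ _ (n%:R * (`|z' - z| * (2 * rho + 1)))).
  rewrite ler_wpM2l// ler_wpM2l// (le_trans (ler_normD _ _))// lerD//.
  by rewrite normrZ ger0_norm// ler_wpM2l// ltW.
rewrite [leLHS](_ : _ = (2 * (n%:R * rho) + n%:R) * `|z' - z|); last by ring.
by rewrite ler_wpM2r//; lra.
Qed.

(* The square of the bump makes the product vanish to second order at the
   boundary of the support. *)
Lemma bump_extend f F (C : R) : 0 <= C -> C11on [set z | 0 < p z] f F C ->
  exists2 K : R, 0 <= K & exists2 G : 'rV[R]_n -> 'rV[R]_n,
    C11on setT (fun z => if 0 < p z then p z ^+ 2 * f z else 0) G K &
    (forall z, 0 < p z -> f z = 0 -> G z = p z ^+ 2 *: F z) /\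
    (forall z, p z <= 0 -> G z = 0).
Proof.
move=> C0 Hf; have [Cp Cp0 Hp] := bump_C11.
pose M := Num.max C Cp.
have CM : C <= M by rewrite le_max lexx.
have CpM : Cp <= M by rewrite le_max lexx orbT.
have M0 : 0 <= M by exact: le_trans CM.
pose dp z := - 2 *: (z - zi).
pose f1 z := p z * f z; pose F1 z := p z *: F z + f z *: dp z.
have Hf1 := C11onM M0 (C11on_le CpM Hp) (C11on_le CM Hf).
pose M1 := (4 + n%:R) * M ^+ 2; pose M2 := Num.max M M1.
have M10 : 0 <= M1 by rewrite /M1 mulr_ge0 ?sqr_ge0// addr_ge0.
have MM2 : M <= M2 by rewrite le_max lexx.
have M1M2 : M1 <= M2 by rewrite le_max lexx orbT.
have M20 : 0 <= M2 by exact: le_trans MM2.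
have Hf2 := C11onM M20 (C11on_le (le_trans CpM MM2) Hp) (C11on_le M1M2 Hf1).
pose G z := p z *: F1 z + f1 z *: dp z.
have n0 : (0 : R) <= n%:R by [].
have nr : 0 <= n%:R * rho by rewrite mulr_ge0// ltW.
have r2 : 0 <= rho ^+ 2 by rewrite sqr_ge0.
pose C3 := M + M1 + M * M.
have MM := mulr_ge0 M0 M0.
have C30 : 0 <= C3 by rewrite !addr_ge0.
have bnd z : 0 < p z -> [/\ p z <= rho ^+ 2, `|p z * f1 z| <= C3 * p z ^+ 2
    & `|G z| <= C3 * p z].
  move=> pz; have p0 := ltW pz.
  have [fz0 Fz0] : `|f z| <= C /\ `|F z| <= C by case: Hf => /(_ z pz).
  have [_ dz0] : `|p z| <= Cp /\ `|dp z| <= Cp by case: Hp => /(_ z pz).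
  have fz := le_trans fz0 CM; have dz := le_trans dz0 CpM.
  have [f1z F1z] : `|f1 z| <= M1 /\ `|F1 z| <= M1 by case: Hf1 => /(_ z pz).
  split.
  - by rewrite /p; have := dot_ge0 (z - zi); lra.
  - rewrite !normrM (ger0_norm p0) mulrA -expr2 [leRHS]mulrC ler_wpM2l ?sqr_ge0//.
    by rewrite /C3; lra.
  - rewrite (le_trans (ler_normD _ _))// !normrZ /f1 (ger0_norm p0) -(normrZ (- 2)) -/(dp z).
    rewrite -mulrA -mulrDr [leRHS]mulrC ler_wpM2l//.
    have := ler_pM (normr_ge0 _) (normr_ge0 _) fz dz; rewrite /C3; lra.
have q0 : 0 <= (4 + n%:R) * M2 ^+ 2 by rewrite mulr_ge0 ?sqr_ge0// addr_ge0.
have q1 : 0 <= 2 * (n%:R * rho) + n%:R + rho ^+ 2 by lra.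
have [K K0 HK] := C11on_extend q0 q1 C30 r2 Hf2 bump_dist bnd.
exists K => //; exists (fun z => if 0 < p z then G z else 0).
  have e : (fun z => if 0 < p z then p z ^+ 2 * f z else 0) =
           (fun z => if 0 < p z then p z * f1 z else 0).
    by apply/funext => z; rewrite expr2 -mulrA.
  by rewrite e.
split=> z; last by rewrite leNgt => /negbTE ->.
by move=> pz fz; rewrite pz /G /F1 /f1 fz mulr0 !scale0r !addr0 scalerA -expr2.
Qed.

End Bump.

Section Gradient.
Context {R : realType} (n : nat).
Implicit Types (phi : 'rV[R]_n -> R) (z h u : 'rV[R]_n).

Lemma diff_gradient phi z h : differentiable phi z ->
  'd phi z h = dot (gradient phi z) h.
Proof.
move=> dz; rewrite {1}[h]row_sum_delta linear_sum /dot.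
by apply: eq_bigr => i _; rewrite linearZ /= mxE deriveE// mulrC.
Qed.

Lemma hasd_line phi z h (s : R) : differentiable phi (z + s *: h) ->
  hasd (fun r : R => phi (z + r *: h)) s (dot (gradient phi (z + s *: h)) h).
Proof.
move=> df; apply/hasdP.
have dh := diff_derivable (v := h) df.
have vE := deriveE h df; rewrite diff_gradient// in vE.
have e : (fun k : R => k^-1 *: (((fun r : R => phi (z + r *: h)) \o shift s) (k *: (1 : R)) - phi (z + s *: h))) =
  (fun k : R => k^-1 *: ((phi \o shift (z + s *: h)) (k *: h) - phi (z + s *: h))).
  apply/funext => k /=; congr (_ *: (phi _ - _)).
  by rewrite [k *: 1]mulr1 scalerDl addrCA.
apply: DeriveDef; first by rewrite /derivable e.
by rewrite /derive e.
Qed.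

Lemma hasd_continuous_within (f : R -> R) (df : R -> R) (a b : R) :
  (forall s, s \in `[a, b] -> hasd f s (df s)) -> {within `[a, b], continuous f}.
Proof.
move=> H; apply: derivable_within_continuous => s /H /hasdP []; done.
Qed.

(** Segments between points of the ball stay inside it, so the mean value theorem along them gives
    both the Lipschitz bound and, by comparing gradients, the quadratic remainder. *)
Lemma C11on_of_gradient phi z0 (rho k : R) : 0 < rho ->
  (forall z, ball z0 rho z -> differentiable phi z) ->
  (forall z z', ball z0 rho z -> ball z0 rho z' ->
     `|gradient phi z' - gradient phi z| <= k * `|z' - z|) ->
  exists2 C : R, 0 <= C & C11on (ball z0 rho) phi (gradient phi) C.
Proof.
move=> rho0 df gk.
have bE z : ball z0 rho z = (`|z - z0| < rho) :> Prop.
  by rewrite -ball_normE /= /ball_ distrC.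
pose k1 := `|k|; have k10 : 0 <= k1 by exact: normr_ge0.
have gk1 z z' : ball z0 rho z -> ball z0 rho z' ->
    `|gradient phi z' - gradient phi z| <= k1 * `|z' - z|.
  by move=> bz bz'; rewrite (le_trans (gk _ _ bz bz'))// ler_wpM2r// ler_norm.
have n0 : (0 : R) <= n%:R by [].
have bz0 : ball z0 rho z0 by exact: ballxx.
pose M := `|gradient phi z0| + k1 * rho.
have M0 : 0 <= M by rewrite /M addr_ge0// mulr_ge0// ltW.
have gM z : ball z0 rho z -> `|gradient phi z| <= M.
  move=> bz; rewrite -[gradient phi z](subrK (gradient phi z0)) addrC.
  rewrite (le_trans (ler_normD _ _))// lerD2l (le_trans (gk1 _ _ bz0 bz))//.
  by rewrite ler_wpM2l//; move: bz; rewrite bE => /ltW.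
have mvt z z' : ball z0 rho z -> ball z0 rho z' -> exists2 w, ball z0 rho w &
    `|w - z| <= `|z' - z| /\ phi z' - phi z = dot (gradient phi w) (z' - z).
  move=> bz bz'; pose f (r : R) := phi (z + r *: (z' - z)).
  have seg (r : R) : r \in `[0, 1] -> ball z0 rho (z + r *: (z' - z)).
    rewrite in_itv/= => /andP[r0 r1]; move: bz bz'; rewrite !bE => bz bz'.
    have -> : z + r *: (z' - z) - z0 = (1 - r) *: (z - z0) + r *: (z' - z0).
      by apply/rowP => j; rewrite !mxE; ring.
    rewrite (le_lt_trans (ler_normD _ _))// !normrZ !ger0_norm ?subr_ge0//.
    have [r0'|r0'] := eqVneq r 0; first by rewrite r0' subr0 mul1r mul0r addr0.
    have rp : 0 < r by rewrite lt_neqAle eq_sym r0'.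
    apply: (@lt_le_trans _ _ ((1 - r) * rho + r * rho)); last by rewrite -mulrDl subrK mul1r.
    rewrite ler_ltD//; first by rewrite ler_wpM2l ?subr_ge0// ltW.
    by rewrite ltr_pM2l.
  have Hd (s : R) : s \in `[0, 1] -> hasd f s (dot (gradient phi (z + s *: (z' - z))) (z' - z)).
    by move=> sI; apply: hasd_line; exact/df/seg.
  have [|c c01] := @MVT R f (fun s => dot (gradient phi (z + s *: (z' - z))) (z' - z)) 0 1 ltr01 _
    (hasd_continuous_within Hd).
    move=> s /[!in_itv]/= /andP[s0 s1]; apply/hasdP; apply: Hd.
    by rewrite in_itv/= !ltW.
  rewrite subr0 mulr1 /f scale1r scale0r addr0 addrCA subrr addr0 => e.
  have cI : c \in `[0, 1] by move: c01; rewrite !in_itv/= => /andP[/ltW -> /ltW ->].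
  exists (z + c *: (z' - z)); first exact: seg.
  split=> //; rewrite addrC addrA addNr add0r normrZ.
  by move: cI; rewrite in_itv/= => /andP[c0 c1]; rewrite ger0_norm// ler_piMl.
pose C := `|phi z0| + n%:R * (M * rho) + M + n%:R * M + k1 + n%:R * k1.
have h1 : 0 <= n%:R * (M * rho) by rewrite !mulr_ge0// ltW.
have h2 : 0 <= n%:R * M by rewrite mulr_ge0.
have h3 : 0 <= n%:R * k1 by rewrite mulr_ge0.
have h4 : 0 <= `|phi z0| by exact: normr_ge0.
have philip z z' : ball z0 rho z -> ball z0 rho z' -> `|phi z' - phi z| <= n%:R * (M * `|z' - z|).
  move=> bz bz'; have [w bw [_ ->]] := mvt _ _ bz bz'.
  by rewrite (le_trans (dot_norm _ _))// ler_wpM2l// ler_wpM2r// gM.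
exists C; first by rewrite /C; lra.
split.
- move=> z bz; split; last by rewrite (le_trans (gM _ bz))// /C; lra.
  rewrite -[phi z](subrK (phi z0)) (le_trans (ler_normD _ _))//.
  have := philip _ _ bz0 bz; have : n%:R * (M * `|z - z0|) <= n%:R * (M * rho).
    by rewrite ler_wpM2l// ler_wpM2l//; move: bz; rewrite bE => /ltW.
  rewrite /C; lra.
- move=> z z' bz bz'; rewrite (le_trans (philip _ _ bz bz'))// mulrA ler_wpM2r// /C; lra.
- move=> z z' bz bz'; rewrite (le_trans (gk1 _ _ bz bz'))// ler_wpM2r// /C; lra.
- move=> z z' bz bz'; have [w bw [wz ->]] := mvt _ _ bz bz'.
  rewrite -dotBl (le_trans (dot_norm _ _))//.
  apply: (@le_trans _ _ (n%:R * k1 * `|z' - z| ^+ 2)).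
    rewrite -mulrA ler_wpM2l// expr2 mulrA ler_wpM2r//.
    by rewrite (le_trans (gk1 _ _ bz bw))// ler_wpM2l.
  by rewrite ler_wpM2r ?sqr_ge0// /C; lra.
Qed.

End Gradient.

(** * Local charts and normals *)

Section Charts.
Context {R : realType} (n : nat).
Variables (Om1 Om2 H : set 'rV[R]_n) (n1 n2 : 'rV[R]_n -> 'rV[R]_n).
Hypothesis HO : H_Omega Om1 Om2 H.
Hypothesis Hn1 : forall z, H z -> outward_unit_normal Om1 z (n1 z).
Hypothesis Hn2 : forall z, H z -> outward_unit_normal Om2 z (n2 z).

Definition chart (Om V : set 'rV[R]_n) (phi : 'rV[R]_n -> R) : Prop :=
  [/\ open V, W2oo_submersion V phi & Om `&` V = [set y | phi y < 0] `&` V].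

Lemma chartE Om V phi z : chart Om V phi -> V z -> Om z <-> phi z < 0.
Proof.
move=> [_ _ E] Vz; split => h.
  by have [] : ([set y | phi y < 0] `&` V) z by rewrite -E.
by have [] : (Om `&` V) z by rewrite E.
Qed.

(** A boundary point is outside the open set, so [phi z] is not negative; were it positive, it would
    be so on a neighbourhood, which would then miss [Om]. *)
Lemma chart_boundary Om V phi z : open Om -> chart Om V phi -> V z -> boundary Om z -> phi z = 0.
Proof.
move=> oOm ch Vz [clz ncl]; have [oV [df _ _] _] := ch.
have nOz : ~ Om z by move=> Oz; apply: ncl; apply: open_nbhs_nbhs.
apply/eqP; rewrite eq_le; apply/andP; split; last first.
  by rewrite leNgt; apply/negP => /(chartE ch Vz).2.
rewrite leNgt; apply/negP => p0.
have cphi : {for z, continuous phi} by exact/differentiable_continuous/df.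
have n1z : \forall y \near z, 0 < phi y /\ V y.
  near=> y; split.
    by near: y; move/cvgr_gt : cphi; apply.
  by near: y; apply: open_nbhs_nbhs.
have [y [Oy [py Vy]]] := clz _ n1z.
by move/(chartE ch Vy).1 : Oy; rewrite ltNge (ltW py).
Unshelve. all: by end_near. Qed.

Lemma gradient_sign (phi : 'rV[R]_n -> R) z u : differentiable phi z -> phi z = 0 ->
  dot u (gradient phi z) < 0 ->
  exists2 d : R, 0 < d & forall h : R, 0 < h -> h < d -> phi (z + h *: u) < 0.
Proof.
move=> df pz up.
have h0 : hasd (fun r : R => phi (z + r *: u)) 0 (dot u (gradient phi z)).
  have := @hasd_line _ _ phi z u 0; rewrite scale0r addr0 dotC; exact.
have e0 : 0 < - dot u (gradient phi z) / 2 by rewrite divr_gt0// oppr_gt0.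
have /nbhs_normP[d /= d0 dP] := h0 _ e0.
exists d => // h hp hd; have := dP h; rewrite /ball_/= sub0r normrN (gtr0_norm hp) => /(_ hd).
rewrite add0r scale0r addr0 pz subr0 => /(le_trans (ler_norm _)).
set a := dot _ _ in up e0 *.
have ha : h *: a = h * a by [].
have : h * a < 0 by rewrite pmulr_rlt0.
by rewrite ha; lra.
Qed.

(** A direction that strictly decreases [phi] enters [Om], hence cannot strictly increase [psi], and
    [half_space_normal] applies. This relates the chart used near a fixed point to the unrelated
    charts behind the values of [n1]. *)
Lemma normals_agree Om V phi V' psi z : open Om -> boundary Om z ->
  chart Om V phi -> V z -> chart Om V' psi -> V' z ->
  exists2 k : R, 0 < k & gradient psi z = k *: gradient phi z.
Proof.
move=> oOm bz ch Vz ch' Vz'.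
have pz := chart_boundary oOm ch Vz bz; have qz := chart_boundary oOm ch' Vz' bz.
have [oV [df _ g0] _] := ch; have [oV' [df' _ g0'] _] := ch'.
apply: half_space_normal; [exact: g0|exact: g0'|] => u up.
rewrite leNgt; apply/negP => uq.
have [d d0 dP] := gradient_sign (df _ Vz) pz up.
have [d' d'0 dP'] : exists2 d : R, 0 < d & forall h : R, 0 < h -> h < d -> 0 < psi (z + h *: u).
  have h0 : hasd (fun r : R => psi (z + r *: u)) 0 (dot u (gradient psi z)).
    have := @hasd_line _ _ psi z u 0; rewrite scale0r addr0 dotC; apply; exact: df'.
  have e0 : 0 < dot u (gradient psi z) / 2 by rewrite divr_gt0.
  have /nbhs_normP[d' /= d'0 d'P] := h0 _ e0.
  exists d' => // h hp hd; have := d'P h; rewrite /ball_/= sub0r normrN (gtr0_norm hp) => /(_ hd).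
  rewrite add0r scale0r addr0 qz subr0 distrC => /(le_trans (ler_norm _)).
  set a := dot _ _ in uq e0 *.
  have ha : h *: a = h * a by [].
  have : 0 < h * a by rewrite mulr_gt0.
  by rewrite ha; lra.
have Vn : \forall h \near (0 : R), V (z + h *: u) /\ V' (z + h *: u).
  have cz : {for 0, continuous (fun h : R => z + h *: u)}.
    apply: (@lip_continuous _ _ _ _ `|u|) => r r'.
    by rewrite opprD addrACA subrr add0r -scalerBl normrZ mulrC.
  have /cz : nbhs (z + (0 : R) *: u) (V `&` V').
    by rewrite scale0r addr0; apply: open_nbhs_nbhs; split; [exact: openI|split].
  by [].
have /nbhs_normP[d'' /= d''0 d''P] := Vn.
pose h := Num.min d (Num.min d' d'') / 2.
have m0 : 0 < Num.min d (Num.min d' d'') by rewrite !lt_min d0 d'0.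
have h0 : 0 < h by rewrite divr_gt0.
have hm : h < Num.min d (Num.min d' d'') by rewrite /h ltr_pdivrMr// ltr_pMr// ltr1n.
move: hm; rewrite !lt_min => /and3P[hd hd' hd''].
have [Vh Vh'] : V (z + h *: u) /\ V' (z + h *: u).
  by apply: d''P; rewrite /ball_/= sub0r normrN gtr0_norm.
have := dP h h0 hd; have := dP' h h0 hd'.
move=> q0 /(chartE ch Vh).2 /(chartE ch' Vh').1.
by rewrite ltNge (ltW q0).
Qed.

End Charts.

(** * Gluing local defining functions *)

Section DefiningFunction.
Context {R : realType} (n : nat).
Variables (Om1 Om2 H : set 'rV[R]_n) (n1 n2 : 'rV[R]_n -> 'rV[R]_n).
Hypothesis HO : H_Omega Om1 Om2 H.
Hypothesis Hn1 : forall z, H z -> outward_unit_normal Om1 z (n1 z).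
Hypothesis Hn2 : forall z, H z -> outward_unit_normal Om2 z (n2 z).
Implicit Types (Phi : 'rV[R]_n -> R) (G : 'rV[R]_n -> 'rV[R]_n) (z : 'rV[R]_n).

Lemma Omega_cover z : [\/ Om1 z, Om2 z | H z].
Proof.
have [_ _ _ U _] := HO; have : [set: 'rV[R]_n] z by [].
by rewrite -U => -[[]|]; [exact: Or31|exact: Or32|exact: Or33].
Qed.

Lemma Omega_disjoint z : Om1 z -> ~ Om2 z.
Proof.
have [_ _ E _ _] := HO => h1 h2; have : (Om1 `&` Om2) z by split.
by rewrite E.
Qed.

Lemma H_disjoint z : H z -> ~ Om1 z /\ ~ Om2 z.
Proof.
have [ op1 op2 _ _ [E1 E2 _]] := HO => Hz; split => Oz.
  by move: Hz; rewrite E1 => -[_]; apply; apply: open_nbhs_nbhs.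
by move: Hz; rewrite E2 => -[_]; apply; apply: open_nbhs_nbhs.
Qed.

Lemma H_closure z : H z -> closure Om1 z /\ closure Om2 z.
Proof.
have [_ _ _ _ [E1 E2 _]] := HO => Hz; split.
  by move: Hz; rewrite E1 => -[].
by move: Hz; rewrite E2 => -[].
Qed.

(** A chart speaks of [Om1] only. A point of [Om2] with [phi z = 0] would have points of [Om1] next
    to it, against the gradient, although [Om2] is open and disjoint from [Om1]. *)
Lemma chart_Omega2 V phi z : chart Om1 V phi -> V z -> Om2 z -> 0 < phi z.
Proof.
move=> ch Vz Oz; have [oV [df _ g0] _] := ch.
rewrite ltNge le_eqVlt; apply/negP => /predU1P[pz|/(chartE ch Vz).2 /Omega_disjoint] //.
have up : dot (- gradient phi z) (gradient phi z) < 0.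
  by rewrite dotNl oppr_lt0 dot_gt0 g0.
have [d d0 dP] := gradient_sign (df _ Vz) pz up.
have cz : {for 0, continuous (fun h : R => z + h *: (- gradient phi z))}.
  apply: (@lip_continuous _ _ _ _ `|gradient phi z|) => r r'.
  by rewrite opprD addrACA subrr add0r -scalerBl normrZ normrN mulrC.
have Vn : \forall h \near (0 : R), (V `&` Om2) (z + h *: (- gradient phi z)).
  have : nbhs (z + (0 : R) *: (- gradient phi z)) (V `&` Om2).
    rewrite scale0r addr0; apply: open_nbhs_nbhs; split => //; apply: openI => //.
    by have [] := HO.
  by move=> /cz.
have /nbhs_normP[d' /= d'0 d'P] := Vn.
pose h := Num.min d d' / 2.
have m0 : 0 < Num.min d d' by rewrite lt_min d0.
have h0 : 0 < h by rewrite divr_gt0.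
have hm : h < Num.min d d' by rewrite /h ltr_pdivrMr// ltr_pMr// ltr1n.
move: hm; rewrite lt_min => /andP[hd hd'].
have [Vh Oh] : (V `&` Om2) (z + h *: (- gradient phi z)).
  by apply: d'P; rewrite /ball_/= sub0r normrN gtr0_norm.
by have /(chartE ch Vh).2 /Omega_disjoint := dP h h0 hd.
Qed.

(** A direction decreasing both local defining functions would enter both phases at once; hence the
    gradients are negative multiples of each other. *)
Lemma normal_opposite z : H z -> n2 z = - n1 z.
Proof.
move=> Hz; have [V [phi [oV Vz W E ->]]] := Hn1 Hz.
have [V' [psi [oV' Vz' W' E' ->]]] := Hn2 Hz.
have ch : chart Om1 V phi by split.
have ch' : chart Om2 V' psi by split.
have [ op1 op2 _ _ [E1 E2 _]] := HO.
have pz : phi z = 0 by apply: (chart_boundary op1 ch) => //; rewrite -E1.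
have qz : psi z = 0 by apply: (chart_boundary op2 ch') => //; rewrite -E2.
have [df _ g0] := W; have [df' _ g0'] := W'.
have [k k0 e] : exists2 k : R, 0 < k & - gradient psi z = k *: gradient phi z.
  apply: half_space_normal; [exact: g0|by rewrite oppr_eq0 g0'|] => u up.
  rewrite dotNr oppr_le0 leNgt; apply/negP => uq.
  have [d d0 dP] := gradient_sign (df _ Vz) pz up.
  have [d' d'0 dP'] := gradient_sign (df' _ Vz') qz uq.
  have cz : {for 0, continuous (fun h : R => z + h *: u)}.
    apply: (@lip_continuous _ _ _ _ `|u|) => r r'.
    by rewrite opprD addrACA subrr add0r -scalerBl normrZ mulrC.
  have Vn : \forall h \near (0 : R), (V `&` V') (z + h *: u).
    have : nbhs (z + (0 : R) *: u) (V `&` V').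
      by rewrite scale0r addr0; apply: open_nbhs_nbhs; split => //; apply: openI.
    by move=> /cz.
  have /nbhs_normP[d'' /= d''0 d''P] := Vn.
  pose h := Num.min d (Num.min d' d'') / 2.
  have m0 : 0 < Num.min d (Num.min d' d'') by rewrite !lt_min d0 d'0.
  have h0 : 0 < h by rewrite divr_gt0.
  have hm : h < Num.min d (Num.min d' d'') by rewrite /h ltr_pdivrMr// ltr_pMr// ltr1n.
  move: hm; rewrite !lt_min => /and3P[hd hd' hd''].
  have [Vh Vh'] : (V `&` V') (z + h *: u).
    by apply: d''P; rewrite /ball_/= sub0r normrN gtr0_norm.
  have /(chartE ch Vh).2 O1 := dP h h0 hd; have /(chartE ch' Vh').2 := dP' h h0 hd'.
  exact: Omega_disjoint.
have -> : gradient psi z = - k *: gradient phi z by rewrite scaleNr -e opprK.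
rewrite enormZ normrN (gtr0_norm k0) scalerA invfM mulrN mulrAC mulVf ?gt_eqF//.
by rewrite mul1r scaleNr.
Qed.

(** The inequalities are weak so that the class is closed under sums: local pieces are simply added,
    without a partition of unity, and strictness of one piece at a point survives in the sum. *)
Definition weak_defining Phi G : Prop :=
  (exists2 C : R, 0 <= C & C11on setT Phi G C) /\
  forall z, [/\ Om1 z -> Phi z <= 0, Om2 z -> 0 <= Phi z
    & H z -> Phi z = 0 /\ exists2 k : R, 0 <= k & G z = k *: n1 z].

Definition strict_at Phi G z : Prop :=
  [/\ Om1 z -> Phi z < 0, Om2 z -> 0 < Phi z
    & H z -> exists2 k : R, 0 < k & G z = k *: n1 z].

Lemma weak_definingD Phi G Phi' G' : weak_defining Phi G -> weak_defining Phi' G' ->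
  let P z := Phi z + Phi' z in let Q z := G z + G' z in
  weak_defining P Q /\
  forall z, strict_at Phi G z \/ strict_at Phi' G' z -> strict_at P Q z.
Proof.
move=> [[C C0 HC] W] [[C' C'0 HC'] W'] P Q; split; first split.
- by exists (C + C'); [exact: addr_ge0|exact: C11onD].
- move=> z; have [a b c] := W z; have [a' b' c'] := W' z; split.
  + by move=> O1; have := a O1; have := a' O1; rewrite /P; lra.
  + by move=> O2; have := b O2; have := b' O2; rewrite /P; lra.
  + move=> Hz; have [e [k k0 Gk]] := c Hz; have [e' [k' k'0 Gk']] := c' Hz.
    split; first by rewrite /P e e' addr0.
    by exists (k + k'); [exact: addr_ge0|rewrite /Q Gk Gk' scalerDl].
- move=> z; have [a b c] := W z; have [a' b' c'] := W' z => -[] [s1 s2 s3]; split.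
  + by move=> O1; have := s1 O1; have := a' O1; rewrite /P; lra.
  + by move=> O2; have := s2 O2; have := b' O2; rewrite /P; lra.
  + move=> Hz; have [k k0 Gk] := s3 Hz; have [e' [k' k'0 Gk']] := c' Hz.
    by exists (k + k'); [exact: ltr_wpDr|rewrite /Q Gk Gk' scalerDl].
  + by move=> O1; have := s1 O1; have := a O1; rewrite /P; lra.
  + by move=> O2; have := s2 O2; have := b O2; rewrite /P; lra.
  + move=> Hz; have [k k0 Gk] := s3 Hz; have [e' [k' k'0 Gk']] := c Hz.
    by exists (k' + k); [exact: ltr_wpDl|rewrite /Q Gk Gk' scalerDl].
Qed.

Lemma weak_defining0 : weak_defining (fun=> 0) (fun=> 0).
Proof.
split=> [|z]; last by split => // _; split => //; exists 0; rewrite ?scale0r.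
exists 0 => //; split => // *; rewrite ?subrr ?dot0l ?subr0 ?normr0 ?mulr_ge0 ?sqr_ge0//.
Qed.

(** Multiplication by the squared bump keeps all signs, and on [H], where [phi] vanishes, it only
    multiplies the gradient by a nonnegative number, positive inside the support. *)
Lemma local_defining_of z0 (rho C : R) phi F : 0 < rho -> 0 <= C ->
  C11on (ball z0 rho) phi F C ->
  (forall z, ball z0 rho z -> [/\ Om1 z -> phi z < 0, Om2 z -> 0 < phi z
     & H z -> phi z = 0 /\ exists2 k : R, 0 < k & F z = k *: n1 z]) ->
  exists Phi G, weak_defining Phi G /\ \forall z \near z0, strict_at Phi G z.
Proof.
move=> rho0 C0 HC HS.
pose p z : R := rho ^+ 2 - dot (z - z0) (z - z0).
have pb z : 0 < p z -> ball z0 rho z.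
  by move=> pz; rewrite -ball_normE /= /ball_ distrC; exact: bump_gt0_norm.
have HC' : C11on [set z | 0 < p z] phi F C by apply: C11on_sub HC => z; exact: pb.
have [K K0 [G HG [G1 G2]]] := bump_extend rho0 C0 HC'.
have p2 z : 0 < p z -> 0 < p z ^+ 2 by move=> pz; rewrite exprn_gt0.
exists (fun z => if 0 < p z then p z ^+ 2 * phi z else 0), G; split; first split.
- by exists K.
- move=> z; case: (ltP 0 (p z)) => pz; last first.
    by split => // _; split => //; exists 0 => //; rewrite G2// scale0r.
  have [a b c] := HS z (pb z pz); split.
  + by move=> /a/ltW h; rewrite mulr_ge0_le0// ltW// p2.
  + by move=> /b/ltW h; rewrite mulr_ge0// ltW// p2.
  + move=> /c[e [k k0 Fk]]; split; first by rewrite e mulr0.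
    exists (p z ^+ 2 * k); first by rewrite mulr_ge0// ltW// p2.
    by rewrite G1// Fk scalerA.
- have np : \forall z \near z0, 0 < p z.
    (* The factor [n + 1] pays for the Euclidean square being up to [n] times the square of the sup
       norm. *)
    pose r := rho / (n%:R + 1); have n0 : (0 : R) < n%:R + 1 by rewrite ltr_wpDl.
    have r0 : 0 < r by rewrite divr_gt0.
    have rE : rho = r * (n%:R + 1) by rewrite divfK// gt_eqF.
    clearbody r.
    have : \forall z \near z0, ball z0 r z by exact: nbhsx_ballx.
    apply: filterS => z; rewrite -ball_normE /= /ball_ distrC => zr.
    rewrite /p subr_gt0 (le_lt_trans (ler_norm _))// (le_lt_trans (dot_norm _ _))//.
    apply: (@le_lt_trans _ _ (n%:R * (r * r))).
      by rewrite ler_wpM2l// ler_pM// ltW.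
    rewrite rE [ltLHS](_ : _ = r ^+ 2 * n%:R); last by ring.
    rewrite exprMn ltr_pM2l ?exprn_gt0//.
    have : (0 : R) <= n%:R by []. have : (0 : R) <= n%:R ^+ 2 by rewrite sqr_ge0.
    rewrite sqrrD; lra.
  apply: filterS np => z pz; rewrite /strict_at pz; have [a b c] := HS z (pb z pz); split.
  + by move=> /a h; rewrite pmulr_rlt0// p2.
  + by move=> /b h; rewrite mulr_gt0// p2.
  + move=> /c[e [k k0 Fk]]; exists (p z ^+ 2 * k); first by rewrite mulr_gt0// p2.
    by rewrite G1// Fk scalerA.
Qed.

(** Inside a phase a constant of the right sign suffices; at a point of [H] the chart of [Om1] is
    used. *)
Lemma local_defining z0 :
  exists Phi G, weak_defining Phi G /\ \forall z \near z0, strict_at Phi G z.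
Proof.
have [ op1 op2 _ _ [E1 E2 _]] := HO.
have cstC (c : R) S : `|c| = 1 -> C11on S (fun=> c) (fun=> 0 : 'rV[R]_n) 1.
  move=> c1; split => *; rewrite ?c1 ?normr0 ?subrr ?normr0 ?dot0l ?subr0 ?normr0 ?mul1r ?sqr_ge0//.
have [Oz|Oz|Hz] := Omega_cover z0.
- have /nbhs_ballP[rho rho0 rhoO] : nbhs z0 Om1 by apply: open_nbhs_nbhs.
  have C := cstC (-1) (ball z0 rho) (ltac:(by rewrite normrN normr1)).
  apply: (local_defining_of rho0 ler01 C) => z /rhoO O1; split.
  + by move=> _; rewrite oppr_lt0.
  + by move=> O2; case: (Omega_disjoint O1).
  + by move=> /H_disjoint[? ?].
- have /nbhs_ballP[rho rho0 rhoO] : nbhs z0 Om2 by apply: open_nbhs_nbhs.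
  have C := cstC 1 (ball z0 rho) (normr1 R).
  apply: (local_defining_of rho0 ler01 C) => z /rhoO O2; split.
  + by move=> O1; case: (Omega_disjoint O1).
  + by [].
  + by move=> /H_disjoint[? ?].
have [V [phi [oV Vz W E e1]]] := Hn1 Hz.
have ch : chart Om1 V phi by split.
have [df [k gk] g0] := W.
have /nbhs_ballP[rho rho0 rhoV] : nbhs z0 V by apply: open_nbhs_nbhs.
have [|z z' bz bz'|C C0 HC] := @C11on_of_gradient _ _ phi z0 rho (`|k| * n%:R) rho0.
- by move=> z bz; apply: df; exact: rhoV.
- rewrite (le_trans (norm_le_enorm _))// (le_trans (gk _ _ (rhoV _ bz') (rhoV _ bz)))//.
  rewrite -mulrA; apply: (@le_trans _ _ (`|k| * enorm (z' - z))).
    by rewrite ler_wpM2r ?sqrtr_ge0// ler_norm.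
  by rewrite ler_wpM2l// enorm_le_norm.
apply: (local_defining_of rho0 C0 HC) => z /rhoV Vz'; split.
- by move=> /(chartE ch Vz').1.
- exact: (chart_Omega2 ch Vz').
- move=> Hz'; have bz' : boundary Om1 z by rewrite -E1.
  split; first exact: (chart_boundary op1 ch).
  have [V' [psi [oV' Vz'' W' E' ->]]] := Hn1 Hz'.
  have ch' : chart Om1 V' psi by split.
  have [a a0 ea] := normals_agree op1 bz' ch' Vz'' ch Vz'.
  have [_ _ g0'] := W'.
  have e0 : 0 < enorm (gradient psi z) by rewrite enorm_gt0 g0'.
  exists (a * enorm (gradient psi z)); first by rewrite mulr_gt0.
  by rewrite ea scalerA -mulrA mulfV ?mulr1// gt_eqF.
Qed.

Lemma defining_function K : compact K ->
  exists Phi G, weak_defining Phi G /\ forall z, K z -> strict_at Phi G z.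
Proof.
move=> cK.
have /choice[PG PGP] : forall z0, exists PG : ('rV[R]_n -> R) * ('rV[R]_n -> 'rV[R]_n),
    weak_defining PG.1 PG.2 /\ \forall z \near z0, strict_at PG.1 PG.2 z.
  by move=> z0; have [P [Q HP]] := local_defining z0; exists (P, Q).
have [|s sP] := @compact_seq_cover _ K (fun x y => strict_at (PG x).1 (PG x).2 y) cK.
  by move=> x _; case: (PGP x).
have [Phi [G [W S]]] : exists Phi G, weak_defining Phi G /\
    forall y x, x \in s -> strict_at (PG x).1 (PG x).2 y -> strict_at Phi G y.
  elim: {sP} s => [|x s [Phi [G [W S]]]].
    by exists (fun=> 0), (fun=> 0); split => //; exact: weak_defining0.
  have [W' S'] := weak_definingD (PGP x).1 W.
  exists (fun z => (PG x).1 z + Phi z), (fun z => (PG x).2 z + G z); split => //.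
  move=> y x'; rewrite inE => /predU1P[->|x's] h; apply: S'; first by left.
  by right; exact: S h.
by exists Phi, G; split => // z /sP[x xs h]; exact: S h.
Qed.

End DefiningFunction.

(** * Tracking a slowed-down trajectory *)

Section Admissible.
Context {R : realType} (t : R) (n : nat).
Implicit Types F G : R -> 'rV[R]_n -> R.

Lemma adm_time (f : R -> R) (C : R) : measurable_fun setT f ->
  (forall s, s \in `[0, t] -> `|f s| <= C) -> admissible t (fun s (_ : 'rV[R]_n) => f s).
Proof.
move=> mf fC; split; last by [].
exists `|C| => // s st x; split; first by apply: le_trans (fC s st) (ler_norm _).
by move=> y; rewrite subrr normr0 mulr_ge0.
Qed.

Lemma admD F G : admissible t F -> admissible t G -> admissible t (fun s x => F s x + G s x).
Proof.
move=> [[C C0 HC] mF] [[C' C'0 HC'] mG]; split.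
  exists (C + C'); first exact: addr_ge0.
  move=> s st x; have [a b] := HC s st x; have [a' b'] := HC' s st x; split.
    by rewrite (le_trans (ler_normD _ _))// lerD.
  move=> y; rewrite opprD addrACA (le_trans (ler_normD _ _))// mulrDl.
  by rewrite lerD ?b ?b'.
by move=> Z cZ; apply: measurable_funD; [exact: mF|exact: mG].
Qed.

Lemma admM F G : admissible t F -> admissible t G -> admissible t (fun s x => F s x * G s x).
Proof.
move=> [[C C0 HC] mF] [[C' C'0 HC'] mG]; split.
  exists (C * C' + C * C'); first by rewrite addr_ge0 ?mulr_ge0.
  move=> s st x; have [a b] := HC s st x; have [a' b'] := HC' s st x; split.
    by rewrite normrM (le_trans (ler_pM _ _ a a'))// lerDl mulr_ge0.
  move=> y; have [c _] := HC s st y; have [c' _] := HC' s st y.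
  rewrite (_ : _ - _ = F s x * (G s x - G s y) + (F s x - F s y) * G s y); last by ring.
  rewrite (le_trans (ler_normD _ _))// !normrM mulrDl; apply: lerD.
    by rewrite -mulrA ler_pM// b'.
  by rewrite mulrAC ler_pM// b.
by move=> Z cZ; apply: measurable_funM; [exact: mF|exact: mG].
Qed.

Lemma adm_cst (c : R) : admissible t (fun _ (_ : 'rV[R]_n) => c).
Proof. by apply: (@adm_time (fun=> c) `|c|) => //; exact: measurable_cst. Qed.

Lemma admN F : admissible t F -> admissible t (fun s x => - F s x).
Proof.
move=> HF; have := admM (adm_cst (-1)) HF; congr admissible.
by apply/funext => s; apply/funext => x; rewrite mulN1r.
Qed.

Lemma admB F G : admissible t F -> admissible t G -> admissible t (fun s x => F s x - G s x).
Proof. by move=> HF HG; apply: admD => //; exact: admN. Qed.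

Lemma adm_max F G : admissible t F -> admissible t G ->
  admissible t (fun s x => Num.max (F s x) (G s x)).
Proof.
move=> [[C C0 HC] mF] [[C' C'0 HC'] mG]; split.
  exists (Num.max C C'); first by rewrite le_max C0.
  move=> s st x; have [a b] := HC s st x; have [a' b'] := HC' s st x; split.
    by case: (leP (F s x) (G s x)) => _; rewrite le_max ?a ?a' ?orbT.
  move=> y; rewrite (le_trans (max_lip _ _ _ _))// ge_max; apply/andP; split.
    by rewrite (le_trans (b y))// ler_wpM2r// le_max lexx.
  by rewrite (le_trans (b' y))// ler_wpM2r// le_max lexx orbT.
by move=> Z cZ; apply: measurable_maxr; [exact: mF|exact: mG].
Qed.

Lemma adm_min F G : admissible t F -> admissible t G ->
  admissible t (fun s x => Num.min (F s x) (G s x)).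
Proof.
move=> HF HG; have := admN (adm_max (admN HF) (admN HG)); congr admissible.
by apply/funext => s; apply/funext => x; rewrite oppr_max !opprK.
Qed.

Lemma inv_max_lip (c a b : R) : 0 < c ->
  `|(Num.max c a)^-1 - (Num.max c b)^-1| <= c^-1 ^+ 2 * `|a - b|.
Proof.
move=> c0; set x := Num.max c a; set y := Num.max c b.
have cx : c <= x by rewrite le_max lexx.
have cy : c <= y by rewrite le_max lexx.
have x0 : 0 < x by exact: lt_le_trans cx.
have y0 : 0 < y by exact: lt_le_trans cy.
have -> : x^-1 - y^-1 = x^-1 * y^-1 * (y - x) by field; rewrite !gt_eqF.
have xy : `|y - x| <= `|a - b|.
  rewrite distrC /x /y (le_trans (max_lip _ _ _ _))// ge_max lexx subrr normr0 andbT.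
  exact: normr_ge0.
rewrite !normrM !normfV (gtr0_norm x0) (gtr0_norm y0) expr2.
by rewrite ler_pM ?mulr_ge0 ?invr_ge0 ?(ltW x0) ?(ltW y0)// ler_pM ?invr_ge0 ?(ltW x0) ?(ltW y0)// lef_pV2.
Qed.

Lemma adm_inv F (c : R) : 0 < c -> admissible t F ->
  admissible t (fun s x => (Num.max c (F s x))^-1).
Proof.
move=> c0 [[C C0 HC] mF]; split.
  exists (c^-1 + c^-1 ^+ 2 * C); first by rewrite addr_ge0 ?mulr_ge0 ?sqr_ge0 ?invr_ge0// ltW.
  move=> s st x; have [a b] := HC s st x; split.
    rewrite normfV gtr0_norm; last by rewrite lt_max c0.
    apply: (@le_trans _ _ c^-1); last by rewrite lerDl mulr_ge0 ?sqr_ge0.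
    by rewrite lef_pV2 ?posrE ?lt_max ?c0// le_max lexx.
  move=> y; apply: (le_trans (inv_max_lip _ _ c0)).
  apply: (@le_trans _ _ (c^-1 ^+ 2 * (C * `|x - y|))).
    by rewrite ler_wpM2l ?sqr_ge0// b.
  by rewrite mulrA ler_wpM2r// lerDr invr_ge0 ltW.
move=> Z cZ.
apply: (@measurableT_comp _ _ _ _ _ _ (fun a : R => (Num.max c a)^-1)); last exact: mF.
apply: continuous_measurable_fun => a; apply/cvgrPdist_le => e e0.
have c2 : 0 < c^-1 ^+ 2 by rewrite exprn_gt0// invr_gt0.
near=> b; apply: (le_trans (inv_max_lip _ _ c0)).
rewrite -ler_pdivlMl//; near: b.
have := @cvgr_dist_le R R R (nbhs a) _ id a; apply => //.
by rewrite mulr_gt0// invr_gt0.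
Unshelve. all: by end_near. Qed.

Lemma adm_if (b : R -> bool) F G : measurable_fun setT b ->
  admissible t F -> admissible t G -> admissible t (fun s x => if b s then F s x else G s x).
Proof.
move=> mb [[C C0 HC] mF] [[C' C'0 HC'] mG]; split.
  exists (Num.max C C'); first by rewrite le_max C0.
  move=> s st x; have [a h] := HC s st x; have [a' h'] := HC' s st x.
  case: (b s); split.
  - by rewrite le_max a.
  - by move=> y; rewrite (le_trans (h y))// ler_wpM2r// le_max lexx.
  - by rewrite le_max a' orbT.
  - by move=> y; rewrite (le_trans (h' y))// ler_wpM2r// le_max lexx orbT.
by move=> Z cZ; apply: measurable_fun_ifT; [|exact: mF|exact: mG].
Qed.

Lemma adm_sum (I : Type) (r : seq I) (F : I -> R -> 'rV[R]_n -> R) :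
  (forall i, admissible t (F i)) -> admissible t (fun s x => \sum_(i <- r) F i s x).
Proof.
move=> HF; elim: r => [|i r IH].
  have := adm_cst 0; congr admissible.
  by apply/funext => s; apply/funext => x; rewrite big_nil.
have := admD (HF i) IH; congr admissible.
by apply/funext => s; apply/funext => x; rewrite big_cons.
Qed.

Lemma adm_dot m (U V : R -> 'rV[R]_n -> 'rV[R]_m) :
  (forall j, admissible t (fun s x => U s x ord0 j)) ->
  (forall j, admissible t (fun s x => V s x ord0 j)) ->
  admissible t (fun s x => dot (U s x) (V s x)).
Proof. by move=> HU HV; apply: adm_sum => j; exact: admM. Qed.

Lemma adm_comp m (pi : 'rV[R]_n -> 'rV[R]_m) (F : R -> 'rV[R]_m -> R) :
  (forall x y, `|pi x - pi y| <= `|x - y|) ->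
  admissible t F -> admissible t (fun s x => F s (pi x)).
Proof.
move=> Hpi [[C C0 HC] mF]; split.
  exists C => // s st x; have [a b] := HC s st (pi x); split => // y.
  by rewrite (le_trans (b _))// ler_wpM2l.
move=> Z cZ; apply: (mF (fun s => pi (Z s))) => s.
apply: continuous_comp; first exact: cZ.
by apply: (@lip_continuous _ _ _ pi 1) => x y; rewrite mul1r.
Qed.

Lemma adm_lip (f : 'rV[R]_n -> R) (C : R) :
  (forall x, `|f x| <= C) -> (forall x y, `|f x - f y| <= C * `|x - y|) ->
  admissible t (fun _ x => f x).
Proof.
move=> fC fl; have C0 : 0 <= C := le_trans (normr_ge0 _) (fC 0).
split; first by exists C.
move=> Z cZ; apply: continuous_measurable_fun => s.
apply: (@continuous_comp _ _ _ Z f); first exact: cZ.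
exact: (lip_continuous fl).
Qed.

End Admissible.

(** * Comparison with an exponential weight *)

Section WeightedComparison.
Context {R : realType}.
Notation mu := (@lebesgue_measure R).

Lemma hasdM (f g : R -> R) (s a b : R) : hasd f s a -> hasd g s b ->
  hasd (fun r => f r * g r) s (f s * b + g s * a).
Proof. by move=> /hasdP Hf /hasdP Hg; apply/hasdP; exact: is_deriveM. Qed.

Lemma hasd_C11 n (Phi : 'rV[R]_n -> R) G (C : R) (Z : R -> 'rV[R]_n) (s : R) v :
  0 <= C -> C11on setT Phi G C -> hasd Z s v -> hasd (fun r => Phi (Z r)) s (dot (G (Z s)) v).
Proof.
move=> C0 [_ _ _ H4] HZ e e0.
pose g := n%:R * `|G (Z s)|; have g0 : 0 <= g by rewrite mulr_ge0.
pose V := `|v| + 1; have V0 : 0 < V by rewrite ltr_wpDl.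
have e1 : 0 < e / 2 / (g + 1) by rewrite !divr_gt0// ltr_wpDl.
have e2 : 0 < e / 2 / (C * V ^+ 2 + 1) by rewrite !divr_gt0// ltr_wpDl// mulr_ge0// sqr_ge0.
near=> h.
have h1 : `|Z (s + h) - Z s - h *: v| <= e / 2 / (g + 1) * `|h| by near: h; exact: HZ.
have h2 : `|Z (s + h) - Z s| <= V * `|h| by near: h; exact: (hasd_lin HZ ltr01).
have h3 : `|h| <= e / 2 / (C * V ^+ 2 + 1) by near: h; exact: near0_norm_le.
have -> : Phi (Z (s + h)) - Phi (Z s) - h *: dot (G (Z s)) v =
  (Phi (Z (s + h)) - Phi (Z s) - dot (G (Z s)) (Z (s + h) - Z s)) +
  dot (G (Z s)) (Z (s + h) - Z s - h *: v).
  by rewrite [dot _ (_ - h *: v)]dotBr dotZr /GRing.scale /=; ring.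
apply: (le_trans (ler_normD _ _)); rewrite (splitr e) mulrDl; apply: lerD.
  apply: (le_trans (H4 _ _ I I)).
  apply: (@le_trans _ _ (C * (V * `|h|) ^+ 2)).
    by rewrite ler_wpM2l// lerXn2r ?nnegrE// mulr_ge0// ltW.
  rewrite (_ : C * _ = C * V ^+ 2 * `|h| * `|h|); last by ring.
  rewrite ler_wpM2r//; apply: (@le_trans _ _ ((C * V ^+ 2 + 1) * `|h|)).
    by rewrite ler_wpM2r// lerDl.
  have p0 : 0 < C * V ^+ 2 + 1 by rewrite ltr_wpDl// mulr_ge0// sqr_ge0.
  by rewrite -ler_pdivlMl// [leRHS]mulrC.
apply: (le_trans (dot_norm _ _)); rewrite mulrA -/g.
apply: (@le_trans _ _ ((g + 1) * (e / 2 / (g + 1) * `|h|))).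
  by rewrite ler_pM// lerDl.
by rewrite mulrA [(g + 1) * _]mulrC divfK// gt_eqF// ltr_wpDl.
Unshelve. all: by end_near. Qed.

Section Weight.
Variables (t K lam0 : R).
Hypotheses (K0 : 0 < K) (lam00 : 0 < lam0).
Let lam s := lam0 * expR (K * s).

(** The primitive of [lam] is [lam / K] up to a constant, so an error [c * lam] in velocity costs
    only [c / K * lam] in position. *)
Lemma weight_bound (f v : R -> R) (c C : R) : 0 <= c ->
  f 0 = 0 -> (forall x y, x \in `[0, t] -> y \in `[0, t] -> `|f x - f y| <= C * `|x - y|) ->
  {ae mu, forall s, s \in `]0, t[ -> hasd f s (v s)} ->
  {ae mu, forall s, s \in `]0, t[ -> `|v s| <= c * lam s} ->
  forall s, s \in `[0, t] -> `|f s| <= c / K * lam s.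
Proof.
move=> c0 f0 fC Hf Hv s st.
have [s0 ts] : 0 <= s /\ s <= t by move: st; rewrite in_itv/= => /andP.
have sub r : r \in `[0, s] -> r \in `[0, t].
  by rewrite !in_itv/= => /andP[-> /le_trans]; exact.
have sub' r : r \in `]0, s[ -> r \in `]0, t[.
  by rewrite !in_itv/= => /andP[-> /lt_le_trans]; exact.
have cK : 0 <= c / K * lam0 by rewrite mulr_ge0 ?divr_ge0// ltW.
have := @lip_ae_le _ f (fun r => c / K * lam0 * expR (K * r)) 0 s C
  (c / K * lam0 * K * expR (K * t)) v (fun r => c / K * lam0 * K * expR (K * r)) s0.
rewrite f0 subr0 => H; apply: (le_trans (H _ _ _ _ _)).
- by move=> x y xs ys; apply: fC; exact: sub.
- by move=> x y xs ys; apply: expR_scale_lip => //; [exact: ltW|exact: sub|exact: sub].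
- by apply: aeS Hf => r h rs; apply: h; exact: sub'.
- by apply: ae_all => r _; exact: hasd_expR.
- apply: aeS Hv => r h rs; apply: (le_trans (h (sub' _ rs))); rewrite /lam le_eqVlt.
  by apply/orP; left; apply/eqP; field; rewrite gt_eqF.
by rewrite mulr0 expR0 mulr1 /lam mulrA lerBlDr lerDl.
Qed.

(* Absorbs the Gronwall term by taking the best constant [m] in
   [xi <= m * lam], instead of integrating a differential inequality. *)
Lemma weight_gronwall (xi : R -> R) (A b B : R) : 0 <= t -> 0 <= A -> 0 <= b -> 2 * A <= K ->
  (forall s, s \in `[0, t] -> 0 <= xi s <= B) ->
  (forall m, 0 <= m -> (forall s, s \in `[0, t] -> xi s <= m * lam s) ->
     forall s, s \in `[0, t] -> xi s <= (A * m + b) / K * lam s) ->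
  forall s, s \in `[0, t] -> xi s <= 2 * b / K * lam s.
Proof.
move=> t0 A0 b0 AK xiB H.
have lam_gt0 s : 0 < lam s by rewrite mulr_gt0// expR_gt0.
have lam_ge s : s \in `[0, t] -> lam0 <= lam s.
  rewrite in_itv/= => /andP[s0 _]; rewrite /lam ler_peMr ?(ltW lam00)//.
  by rewrite -expR0 ler_expR mulr_ge0// ltW.
pose E := [set xi s / lam s | s in `[0, t]%classic].
have t00 : 0 \in `[0, t] by rewrite in_itv/= lexx.
have B0 : 0 <= B by have /andP[] := xiB _ t00; exact: le_trans.
have supE : has_sup E.
  split; first by exists (xi 0 / lam 0); exists 0.
  exists (B / lam0) => _ [s st <-]; have /andP[x0 xB] := xiB s st.
  by rewrite ler_pM// ?invr_ge0 ?(ltW (lam_gt0 _))// lef_pV2 ?lam_ge// posrE.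
pose m := sup E.
have mP s : s \in `[0, t] -> xi s <= m * lam s.
  move=> st; rewrite -ler_pdivrMr//; apply: ub_le_sup; first exact: supE.2.
  by exists s.
have m0 : 0 <= m.
  apply: (@le_trans _ _ (xi 0 / lam 0)); last first.
    by apply: ub_le_sup; [exact: supE.2|exists 0].
  by rewrite divr_ge0 ?(ltW (lam_gt0 _))//; have /andP[] := xiB _ t00.
have mle : m <= (A * m + b) / K.
  apply: ge_sup; first exact: supE.1.
  by move=> _ [s st <-]; rewrite ler_pdivrMr//; exact: H.
have m2 : m <= 2 * b / K.
  have : m * K <= A * m + b by rewrite -ler_pdivlMr.
  have : 2 * A * m <= K * m by rewrite ler_wpM2r.
  rewrite ler_pdivlMr//; lra.
move=> s st; apply: (le_trans (mP s st)); rewrite ler_wpM2r// ltW//.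
Qed.

End Weight.
End WeightedComparison.

(** Each vector is bounded only when its weight is nonzero, because the estimates on one side of the
    interface are available only where that side is active. *)
Lemma convex_norm (R : realType) n (a b c : R) (x y : 'rV[R]_n) :
  0 <= a -> 0 <= b -> a + b = 1 -> (a != 0 -> `|x| <= c) -> (b != 0 -> `|y| <= c) ->
  `|a *: x + b *: y| <= c.
Proof.
move=> a0 b0 ab xc yc; apply: (le_trans (ler_normD _ _)); rewrite !normrZ !ger0_norm//.
rewrite -[leRHS]mul1r -ab mulrDl; apply: lerD.
  by have [->|/xc h] := eqVneq a 0; rewrite ?mul0r// ler_wpM2l.
by have [->|/yc h] := eqVneq b 0; rewrite ?mul0r// ler_wpM2l.
Qed.

(** * The tracking system *)

Section Tracking.
Context {R : realType} (N : nat).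
Notation mu := (@lebesgue_measure R).
Variables (t K lam0 M L Cg r c0 a : R) (Phi : 'rV[R]_N -> R) (G : 'rV[R]_N -> 'rV[R]_N).
Variables (u p m : bool -> R -> 'rV[R]_N -> 'rV[R]_N) (f : bool -> R -> 'rV[R]_N).
Variables (w : bool -> R -> R) (Y : R -> 'rV[R]_N) (MY : R) (act : bool -> R -> Prop).
Let lam (s : R) : R := lam0 * expR (K * s).
Let kx := 2 * (1 + M) / K.
Let nN : R := N%:R.
Let kq := 2 * (nN * Cg * (2 * M + L + 1) / r) / K.
Hypotheses (t0 : 0 <= t) (lam00 : 0 < lam0) (K0 : 0 < K) (M0 : 0 <= M) (L0 : 0 <= L)
  (Cg0 : 0 <= Cg) (r0 : 0 < r) (c00 : 0 < c0) (a0 : 0 <= a) (a1 : a <= 1).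
Hypothesis lam_half : lam t <= 2^-1.
Hypothesis HPhi : C11on setT Phi G Cg.
Hypotheses (adm_u : forall i j, admissible t (fun s z => u i s z ord0 j))
  (adm_p : forall i j, admissible t (fun s z => p i s z ord0 j))
  (adm_m : forall i j, admissible t (fun s z => m i s z ord0 j)).
Hypotheses (uM : forall i s z, s \in `[0, t] -> `|u i s z| <= M)
  (pM : forall i s z, s \in `[0, t] -> `|p i s z| <= M)
  (mM : forall i s z, s \in `[0, t] -> `|m i s z| <= M)
  (fM : forall i s, s \in `[0, t] -> `|f i s| <= M).
Hypotheses (uL : forall i s z z', s \in `[0, t] -> `|u i s z - u i s z'| <= L * `|z - z'|)
  (pL : forall i s z z', s \in `[0, t] -> `|p i s z - p i s z'| <= L * `|z - z'|)
  (mL : forall i s z z', s \in `[0, t] -> `|m i s z - m i s z'| <= L * `|z - z'|).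
Hypothesis mf : forall i j, measurable_fun setT (fun s => f i s ord0 j).
Hypotheses (mw : forall i, measurable_fun setT (w i))
  (w0 : forall i s, s \in `[0, t] -> 0 <= w i s)
  (w1 : forall s, s \in `[0, t] -> w true s + w false s = 1).
Hypothesis YL : forall s s', `|Y s - Y s'| <= MY * `|s - s'|.
Hypothesis Yder : {ae mu, forall s, s \in `]0, t[ ->
  hasd Y s ((1 - lam s) *: (w true s *: f true s + w false s *: f false s))}.
Hypothesis wact : forall i s, s \in `[0, t] -> w i s != 0 -> act i s.
Hypothesis uf : forall i s, s \in `[0, t] -> act i s -> `|u i s (Y s) - f i s| <= a * lam s.
Hypothesis ctrl : forall i s, s \in `[0, t] -> act i s -> `|Phi (Y s)| < r ->
  c0 <= dot (G (Y s)) (p i s (Y s)) /\ dot (G (Y s)) (m i s (Y s)) <= - c0.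
(** [HK1] and [HK2] close the Gronwall estimates for [Z - Y] and for [q]; [HK3] keeps the correction
    asked of the freed share below half of what controllability offers. *)
Hypotheses (HK1 : 2 * L <= K) (HK1' : kx <= 1)
  (HK2 : 2 * (nN * Cg * (2 * M + L + 1) / r) <= K) 
  (HK3 : nN * Cg * (M * kq + (M + L) * kx + a) <= c0 / 2).


Let near s := `|Phi (Y s)| < r.
(* The state [x] is the pair [(Z, q)], and [qd] drives [q] so that
   [Phi Z = Phi Y * (1 + q)]: with [`|q| < 1], [Z] stays in the phase of [Y]. *)
Let z_ (x : 'rV[R]_(N + 1)) : 'rV[R]_N := lsubmx x.
Let q_ (x : 'rV[R]_(N + 1)) : R := Num.max (- 2^-1) (Num.min (rsubmx x ord0 ord0) 2^-1).
Let ilam s : R := lam0^-1 * expR (- K * s).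
(** The normal speed that the freed share has to produce: the solution of [(1 - lam s) * dot (G z) u
    + lam s * D = (1 - lam s) * (1 + q) * dot (G Y) f]. *)
Let D i s x := (1 - lam s) * ((1 + q_ x) * dot (G (Y s)) (f i s) -
  dot (G (z_ x)) (u i s (z_ x))) * ilam s.
(** The weight [om] solves the affine equation saying that the mixture of [p] and [m] has normal
    speed [D]. The floor [c0] on the denominator and the clipping make [om] bounded and Lipschitz at
    every state, including those the solution never visits. *)
Let den i s x := Num.max c0 (dot (G (z_ x)) (p i s (z_ x)) - dot (G (z_ x)) (m i s (z_ x))).
Let om i s x := Num.max 0 (Num.min (D i s x - dot (G (z_ x)) (m i s (z_ x))) (den i s x)) *
  (den i s x)^-1.
Let Bx i s x : 'rV[R]_N := (1 - lam s) *: u i s (z_ x) +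
  lam s *: (om i s x *: p i s (z_ x) + (1 - om i s x) *: m i s (z_ x)).
(** The side weights [w] are read off [Y] and not off the state, which makes the right-hand side
    Lipschitz in the state. That they are also the weights of [Z] follows later from the relation
    between [Phi (Z s)] and [Phi (Y s)]. *)
Let xd s x : 'rV[R]_N := w true s *: Bx true s x + w false s *: Bx false s x.
Let wf s : 'rV[R]_N := w true s *: f true s + w false s *: f false s.
(** A bounded version of the inverse of [Phi (Y s)], set to 0 near the interface so that [q] is
    frozen there. *)
Let iy s : R := if near s then 0 else Phi (Y s) * (Num.max (r ^+ 2) (Phi (Y s) ^+ 2))^-1.
Let qd s x : R := iy s * (dot (G (z_ x)) (xd s x) -
  (1 + q_ x) * (1 - lam s) * dot (G (Y s)) (wf s)).
Let F j s x : R := row_mx (xd s x) (const_mx (qd s x) : 'rV_1) ord0 j.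

Let cY : continuous Y. Proof. exact: lip_continuous YL. Qed.
Let cPhi : continuous Phi.
Proof.
have [_ H _ _] := HPhi; apply: (@lip_continuous _ _ _ Phi Cg) => x y.
by rewrite distrC (distrC x); exact: H.
Qed.
Let cG : continuous G.
Proof.
have [_ _ H _] := HPhi; apply: (@lip_continuous _ _ _ G Cg) => x y.
by rewrite distrC (distrC x); exact: H.
Qed.
Let GC z : `|G z| <= Cg. Proof. by have [/(_ z I)[]] := HPhi. Qed.
Let PhiC z : `|Phi z| <= Cg. Proof. by have [/(_ z I)[]] := HPhi. Qed.
Let GL z z' : `|G z - G z'| <= Cg * `|z - z'|.
Proof. by have [_ _ H _] := HPhi; rewrite distrC (distrC z); exact: H. Qed.

Let lam_gt0 s : 0 < lam s. Proof. by rewrite mulr_gt0// expR_gt0. Qed.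
Let lam_le s : s \in `[0, t] -> lam s <= 2^-1.
Proof.
rewrite in_itv/= => /andP[_ st]; apply: le_trans lam_half.
by rewrite /lam ler_pM2l// ler_expR ler_pM2l.
Qed.
Let ilamK s : lam s * ilam s = 1.
Proof.
rewrite /lam /ilam mulrACA mulfV ?gt_eqF// mul1r -expRD mulNr addrN.
exact: expR0.
Qed.
Let w_le1 i s : s \in `[0, t] -> w i s <= 1.
Proof. by move=> st; have := w1 st; have := w0 true st; have := w0 false st; case: i; lra. Qed.

Let adm_lam : admissible t (fun s (_ : 'rV[R]_(N + 1)) => lam s).
Proof.
apply: (@adm_time _ _ _ lam 2^-1) => [|s st]; last by rewrite gtr0_norm// lam_le.
apply: measurable_funM; first exact: measurable_cst.
apply: measurableT_comp; first exact: measurable_expR.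
by apply: measurable_funM; [exact: measurable_cst|exact: measurable_id].
Qed.

Let adm_ilam : admissible t (fun s (_ : 'rV[R]_(N + 1)) => ilam s).
Proof.
apply: (@adm_time _ _ _ ilam lam0^-1) => [|s].
  apply: measurable_funM; first exact: measurable_cst.
  apply: measurableT_comp; first exact: measurable_expR.
  by apply: measurable_funM; [exact: measurable_cst|exact: measurable_id].
rewrite in_itv/= => /andP[s0 st].
rewrite ger0_norm ?mulr_ge0 ?invr_ge0 ?expR_ge0 ?(ltW lam00)// ler_piMr ?invr_ge0 ?(ltW lam00)//.
by rewrite -expR0 ler_expR mulNr oppr_le0 mulr_ge0// ltW.
Qed.

Let z_lip x y : `|z_ x - z_ y| <= `|x - y|.
Proof.
apply: norm_le_coord => // j; have := coord_le_norm (x - y) (lshift 1 j).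
by rewrite !mxE.
Qed.

Let adm_z (h : R -> 'rV[R]_N -> R) : admissible t h -> admissible t (fun s x => h s (z_ x)).
Proof. by move=> ah; exact: (adm_comp z_lip ah). Qed.

Let adm_uz i j : admissible t (fun s x => u i s (z_ x) ord0 j).
Proof. exact: (@adm_z (fun s z => u i s z ord0 j)). Qed.

Let adm_pz i j : admissible t (fun s x => p i s (z_ x) ord0 j).
Proof. exact: (@adm_z (fun s z => p i s z ord0 j)). Qed.

Let adm_mz i j : admissible t (fun s x => m i s (z_ x) ord0 j).
Proof. exact: (@adm_z (fun s z => m i s z ord0 j)). Qed.

Let adm_Gz j : admissible t (fun s x => G (z_ x) ord0 j).
Proof.
apply: (@adm_z (fun _ z => G z ord0 j)).
apply: (@adm_lip _ _ _ (fun z => G z ord0 j) Cg) => [z|z z'].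
  exact: le_trans (coord_le_norm _ _) (GC z).
by apply: le_trans (GL z z'); have := coord_le_norm (G z - G z') j; rewrite !mxE.
Qed.

Let adm_q : admissible t (fun _ x => q_ x).
Proof.
apply: (@adm_lip _ _ _ q_ 1) => [x|x y].
  have h : (2^-1 : R) <= 1 by rewrite invf_le1// ler1n.
  have h0 : (0 : R) <= 2^-1 by rewrite invr_ge0.
  rewrite /q_ ler_norml le_max ge_max ge_min h orbT andbT lerN2 h/=.
  by apply: (@le_trans _ _ 0) => //; rewrite oppr_le0.
rewrite mul1r /q_; apply: (le_trans (max_lip _ _ _ _)).
rewrite subrr normr0 ge_max normr_ge0/=; apply: (le_trans (min_lip _ _ _ _)).
rewrite subrr normr0 ge_max normr_ge0 andbT; have := coord_le_norm (x - y) (rshift N ord0).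
by rewrite !mxE.
Qed.

Let adm_Y (h : 'rV[R]_N -> R) (C : R) : continuous h -> (forall z, `|h z| <= C) ->
  admissible t (fun s (_ : 'rV[R]_(N + 1)) => h (Y s)).
Proof.
move=> ch hC; apply: (@adm_time _ _ _ (fun s => h (Y s)) C) => [|s _]; last exact: hC.
by apply: continuous_measurable_fun => s; apply: continuous_comp; [exact: cY|exact: ch].
Qed.

Let adm_GY j : admissible t (fun s (_ : 'rV[R]_(N + 1)) => G (Y s) ord0 j).
Proof.
apply: (@adm_Y (fun z => G z ord0 j) Cg) => z; last exact: le_trans (coord_le_norm _ _) (GC z).
apply: (@lip_continuous _ _ _ (fun z => G z ord0 j) Cg) => x y.
by apply: le_trans (GL x y); have := coord_le_norm (G x - G y) j; rewrite !mxE.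
Qed.

Let adm_f i j : admissible t (fun s (_ : 'rV[R]_(N + 1)) => f i s ord0 j).
Proof.
apply: (@adm_time _ _ _ (fun s => f i s ord0 j) M) => [//|s st].
exact: le_trans (coord_le_norm _ _) (fM i st).
Qed.

Let adm_w i : admissible t (fun s (_ : 'rV[R]_(N + 1)) => w i s).
Proof.
apply: (@adm_time _ _ _ (w i) 1) => [//|s st].
by rewrite ger0_norm ?w0// w_le1.
Qed.

Let adm_1 := @adm_cst _ t (N + 1) 1.

Let adm_den i : admissible t (fun s x => den i s x).
Proof.
apply: adm_max; first exact: adm_cst.
by apply: admB; apply: adm_dot => j.
Qed.

Let adm_om i : admissible t (fun s x => om i s x).
Proof.
apply: admM.
  apply: adm_max; first exact: adm_cst.
  apply: adm_min; last exact: adm_den.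
  apply: admB; last by apply: adm_dot => j.
  apply: admM => //; apply: admM; first by apply: admB.
  apply: admB; last by apply: adm_dot => j.
  apply: admM; first exact: admD.
  by apply: adm_dot => j.
by apply: adm_inv => //; apply: admB; apply: adm_dot => j.
Qed.

Let adm_Bx i j : admissible t (fun s x => Bx i s x ord0 j).
Proof.
have -> : (fun s x => Bx i s x ord0 j) = (fun s x => (1 - lam s) * u i s (z_ x) ord0 j +
    lam s * (om i s x * p i s (z_ x) ord0 j + (1 - om i s x) * m i s (z_ x) ord0 j)).
  by apply/funext => s; apply/funext => x; rewrite !mxE.
apply: admD; first by apply: admM; [exact: admB|exact: adm_uz].
apply: admM; first exact: adm_lam.
by apply: admD; apply: admM; [exact: adm_om|exact: adm_pz|exact: admB|exact: adm_mz].
Qed.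

Let adm_xd j : admissible t (fun s x => xd s x ord0 j).
Proof.
have -> : (fun s x => xd s x ord0 j) =
    (fun s x => w true s * Bx true s x ord0 j + w false s * Bx false s x ord0 j).
  by apply/funext => s; apply/funext => x; rewrite !mxE.
by apply: admD; apply: admM.
Qed.

Let measurable_near : measurable_fun setT near.
Proof.
apply: measurable_fun_ltr; last exact: measurable_cst.
apply: measurableT_comp; first exact: normr_measurable.
by apply: continuous_measurable_fun => s; apply: continuous_comp; [exact: cY|exact: cPhi].
Qed.

Let adm_iy : admissible t (fun s (_ : 'rV[R]_(N + 1)) => iy s).
Proof.
have aP := adm_Y cPhi PhiC.
apply: adm_if; [exact: measurable_near|exact: adm_cst|].
apply: admM => //; apply: adm_inv; first by rewrite exprn_gt0.
by have := admM aP aP; congr admissible; apply/funext => s; apply/funext => x; rewrite expr2.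
Qed.

Let adm_wf j : admissible t (fun s (_ : 'rV[R]_(N + 1)) => wf s ord0 j).
Proof.
have -> : (fun s (x : 'rV[R]_(N + 1)) => wf s ord0 j) =
    (fun s x => w true s * f true s ord0 j + w false s * f false s ord0 j).
  by apply/funext => s; apply/funext => x; rewrite !mxE.
by apply: admD; apply: admM.
Qed.

Let adm_qd : admissible t (fun s x => qd s x).
Proof.
apply: admM; first exact: adm_iy.
apply: admB; first by apply: adm_dot => j; [exact: adm_Gz|exact: adm_xd].
apply: admM; first by apply: admM; [exact: admD|exact: admB].
by apply: adm_dot => j; [exact: adm_GY|exact: adm_wf].
Qed.

Let adm_F j : admissible t (F j).
Proof.
have : admissible t (fun s x => match fintype.split j with inl j' => xd s x ord0 j' | inr _ => qd s x end).
  by case: (fintype.split j) => [j'|_]; [exact: adm_xd|exact: adm_qd].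
congr admissible; apply/funext => s; apply/funext => x; rewrite /F mxE.
by case: (fintype.split j) => // j'; rewrite mxE.
Qed.

Let om_itv i s x : 0 <= om i s x <= 1.
Proof.
have d0 : 0 < den i s x by rewrite lt_max c00.
rewrite /om; set d := den i s x in d0 *; apply/andP; split.
  by rewrite mulr_ge0 ?invr_ge0 ?(ltW d0)// le_max lexx.
rewrite ler_pdivrMr// mul1r.
by rewrite ge_max (ltW d0)/= ge_min lexx orbT.
Qed.

Let mixM i s x : s \in `[0, t] ->
  `|om i s x *: p i s (z_ x) + (1 - om i s x) *: m i s (z_ x)| <= M.
Proof.
move=> st; have /andP[h0 h1] := om_itv i s x.
apply: convex_norm => //; rewrite ?subr_ge0//; first by rewrite addrC subrK.
  by move=> _; exact: pM.
by move=> _; exact: mM.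
Qed.

Let lam_le1 s : s \in `[0, t] -> lam s <= 1.
Proof. by move=> st; apply: (le_trans (lam_le st)); rewrite invf_le1// ler1n. Qed.

Let BM i s x : s \in `[0, t] -> `|Bx i s x| <= M.
Proof.
move=> st; apply: convex_norm.
- by rewrite subr_ge0 lam_le1.
- exact: ltW.
- by rewrite subrK.
- by move=> _; exact: uM.
- by move=> _; exact: mixM.
Qed.

Let xdM s x : s \in `[0, t] -> `|xd s x| <= M.
Proof.
move=> st; apply: convex_norm; [exact: w0|exact: w0|exact: w1| |] => _; exact: BM.
Qed.

Let wfM s : s \in `[0, t] -> `|wf s| <= M.
Proof.
move=> st; apply: convex_norm; [exact: w0|exact: w0|exact: w1| |] => _; exact: fM.
Qed.

(** Three errors add up on an active side: the Lipschitz drift, the mismatch [a * lam s] with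
    [a <= 1], and the freed share of size [M * lam s]. *)
Let Bx_close i s x : s \in `[0, t] -> act i s ->
  `|Bx i s x - (1 - lam s) *: f i s| <= L * `|z_ x - Y s| + (1 + M) * lam s.
Proof.
move=> st ai; have l0 := ltW (lam_gt0 s); have l1 := lam_le1 st.
have h1 := uL i (z_ x) (Y s) st; have h2 := uf st ai; have h3 := mixM i x st.
rewrite /Bx; move: (om i s x *: _ + _) h3 => mix h3.
move: (lam s) l0 l1 h2 => l l0 l1 h2.
have -> : (1 - l) *: u i s (z_ x) + l *: mix - (1 - l) *: f i s =
   (1 - l) *: ((u i s (z_ x) - u i s (Y s)) + (u i s (Y s) - f i s)) + l *: mix.
  by apply/rowP => j; rewrite !mxE; ring.
apply: (le_trans (ler_normD _ _)); rewrite !normrZ (ger0_norm l0) ger0_norm ?subr_ge0//.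
have h4 : l * `|mix| <= l * M by rewrite ler_wpM2l.
have h5 : a * l <= l by rewrite ler_piMl.
have h6 : (1 - l) * `|u i s (z_ x) - u i s (Y s) + (u i s (Y s) - f i s)| <=
    `|u i s (z_ x) - u i s (Y s)| + `|u i s (Y s) - f i s|.
  by rewrite (le_trans _ (ler_normD _ _))// ler_piMl//; lra.
by lra.
Qed.

Let xd_close s x : s \in `[0, t] ->
  `|xd s x - (1 - lam s) *: wf s| <= L * `|z_ x - Y s| + (1 + M) * lam s.
Proof.
move=> st.
have -> : xd s x - (1 - lam s) *: wf s =
    w true s *: (Bx true s x - (1 - lam s) *: f true s) +
    w false s *: (Bx false s x - (1 - lam s) *: f false s).
  by apply/rowP => j; rewrite !mxE; ring.
apply: convex_norm; [exact: w0|exact: w0|exact: w1| |] => wi; apply: Bx_close => //.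
  exact: wact.
exact: wact.
Qed.

Section Solution.
Variables (X : R -> 'rV[R]_(N + 1)) (MX : R).
Hypothesis X0 : X 0 = row_mx (Y 0) 0.
Hypothesis XL : forall s s', `|X s - X s'| <= MX * `|s - s'|.
Hypothesis Xder : {ae mu, forall s, s \in `]0, t[ -> hasd X s (\row_j F j s (X s))}.

Let Z s := z_ (X s).
Let q s : R := rsubmx (X s) ord0 ord0.

Let Z0 : Z 0 = Y 0. Proof. by rewrite /Z /z_ X0 row_mxKl. Qed.
Let q0 : q 0 = 0. Proof. by rewrite /q X0 row_mxKr mxE. Qed.

Let ZL s s' : `|Z s - Z s'| <= MX * `|s - s'|.
Proof. exact: le_trans (z_lip _ _) (XL _ _). Qed.

Let qL s s' : `|q s - q s'| <= MX * `|s - s'|.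
Proof.
apply: le_trans (XL s s'); have := coord_le_norm (X s - X s') (rshift N ord0).
by rewrite /q !mxE.
Qed.

Let Zder : {ae mu, forall s, s \in `]0, t[ -> hasd Z s (xd s (X s))}.
Proof.
apply: aeS Xder => s H st; apply/hasd_coord => j.
have := (hasd_coord _ _ _).1 (H st) (lshift 1 j); rewrite mxE /F row_mxEl.
by congr hasd; apply/funext => r'; rewrite mxE.
Qed.

Let qder : {ae mu, forall s, s \in `]0, t[ -> hasd q s (qd s (X s))}.
Proof.
apply: aeS Xder => s H st.
have := (hasd_coord _ _ _).1 (H st) (rshift N ord0); rewrite mxE /F row_mxEr mxE.
by congr hasd; apply/funext => r'; rewrite /q mxE.
Qed.

Let sub_oc s : s \in `]0, t[ -> s \in `[0, t].
Proof. by rewrite !in_itv/= => /andP[/ltW -> /ltW ->]. Qed.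

Let st_le s : s \in `[0, t] -> `|s - 0| <= t.
Proof. by rewrite in_itv/= subr0 => /andP[s0 st]; rewrite ger0_norm. Qed.

(** Gronwall with rate [L] and source [(1 + M) * lam], which is where [kx] comes from. *)
Let ZY_close s : s \in `[0, t] -> `|Z s - Y s| <= kx * lam s.
Proof.
pose B := (`|MX| + `|MY|) * t.
have ZYL x y : `|(Z x - Y x) - (Z y - Y y)| <= (`|MX| + `|MY|) * `|x - y|.
  have -> : Z x - Y x - (Z y - Y y) = (Z x - Z y) - (Y x - Y y).
    by apply/rowP => k; rewrite !mxE; ring.
  rewrite (le_trans (ler_normB _ _))// mulrDl.
  apply: lerD.
    by apply: (le_trans (ZL _ _)); rewrite ler_wpM2r// ler_norm.
  by apply: (le_trans (YL _ _)); rewrite ler_wpM2r// ler_norm.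
move=> st; apply: (@weight_gronwall _ t K lam0 K0 lam00 (fun s => `|Z s - Y s|) L (1 + M) B) => //.
- by rewrite addr_ge0.
- move=> s' s't; rewrite normr_ge0/=.
  have := ZYL s' 0; rewrite Z0 subrr subr0 => /le_trans; apply.
  by rewrite ler_wpM2l ?addr_ge0// st_le.
move=> m' m'0 Hm s' s't; apply: norm_le_coord => [|j].
  apply: mulr_ge0; last exact/ltW/lam_gt0.
  apply: divr_ge0; last exact: ltW.
  by apply: addr_ge0; [exact: mulr_ge0|exact: addr_ge0].
apply: (@weight_bound _ t K lam0 K0 lam00 (fun s => (Z s - Y s) ord0 j)
  (fun s => (xd s (X s) - (1 - lam s) *: wf s) ord0 j) _ (`|MX| + `|MY|)) => //.
- by apply: addr_ge0; [exact: mulr_ge0|exact: addr_ge0].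
- by rewrite Z0 subrr mxE.
- move=> x y _ _; apply: le_trans (ZYL x y).
  by have := coord_le_norm ((Z x - Y x) - (Z y - Y y)) j; rewrite !mxE.
- apply: aeS2 Zder Yder => r' h1 h2 rt.
  exact: (hasd_coord _ _ _).1 (hasdB (h1 rt) (h2 rt)) j.
- apply: ae_all => r' rt; have rt' := sub_oc rt.
  apply: (le_trans (coord_le_norm _ _)); apply: (le_trans (xd_close _ rt')).
  rewrite [leRHS]mulrDl; apply: lerD => //.
  by rewrite -mulrA; apply: ler_wpM2l => //; exact: Hm.
Qed.

Let NCg : 0 <= nN * Cg. Proof. by rewrite mulr_ge0. Qed.

Let dotG z v (c : R) : `|v| <= c -> `|dot (G z) v| <= nN * Cg * c.
Proof.
move=> vc; apply: (le_trans (dot_norm _ _)); rewrite -mulrA ler_wpM2l//.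
exact: ler_pM.
Qed.

Let dotGB z z' v (c : R) : `|v| <= c -> `|dot (G z) v - dot (G z') v| <= nN * Cg * (c * `|z - z'|).
Proof.
move=> vc; rewrite -dotBl (le_trans (dot_norm _ _))//.
rewrite (_ : nN * Cg * _ = nN * ((Cg * `|z - z'|) * c)); last by ring.
by apply: ler_wpM2l => //; apply: ler_pM.
Qed.

Let q_le s : `|q_ (X s)| <= `|q s|.
Proof.
rewrite /q_ -/(q s); have h : (0 : R) <= 2^-1 by rewrite invr_ge0.
have e : Num.max (- 2^-1) (Num.min 0 2^-1) = 0 :> R.
  by rewrite min_l// max_r// oppr_le0.
have := max_lip (- 2^-1) (Num.min (q s) 2^-1) (- 2^-1) (Num.min 0 2^-1).
rewrite e subr0 subrr normr0 => /le_trans; apply; rewrite ge_max normr_ge0/=.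
have := min_lip (q s) 2^-1 0 2^-1; rewrite subr0 subrr normr0 => /le_trans; apply.
by rewrite ge_max lexx normr_ge0.
Qed.

Let iy_le s : `|iy s| <= r^-1.
Proof.
rewrite /iy /near; case: ltP => yr; first by rewrite normr0 invr_ge0 ltW.
have y0 : 0 < `|Phi (Y s)| by exact: lt_le_trans yr.
have yy : Phi (Y s) ^+ 2 = `|Phi (Y s)| ^+ 2 by rewrite real_normK ?num_real.
rewrite max_r; last by rewrite yy lerXn2r ?nnegrE// ltW.
rewrite normrM normfV yy normrX normr_id expr2 invfM mulrA mulfV ?gt_eqF// mul1r.
by rewrite lef_pV2.
Qed.

Let iyK s : ~~ near s -> iy s * Phi (Y s) = 1.
Proof.
rewrite /iy /near; case: ltP => // yr _.
have y0 : 0 < `|Phi (Y s)| by exact: lt_le_trans yr.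
have yy : Phi (Y s) ^+ 2 = `|Phi (Y s)| ^+ 2 by rewrite real_normK ?num_real.
rewrite max_r; last by rewrite yy lerXn2r ?nnegrE// ltW.
rewrite mulrAC -expr2 mulfV// yy expf_neq0// normr_eq0 -normr_gt0//.
Qed.

(** Moving the base point of [G] contributes [M * lam s], the difference of velocities
    [(M + L + 1) * lam s], and the factor [1 + q] a term [M] times the size of [q]; all are divided
    by [r] through [iy]. *)
Let qd_le s : s \in `[0, t] -> `|qd s (X s)| <= nN * Cg * (2 * M + L + 1) / r * (lam s + `|q s|).
Proof.
move=> st; have l0 := ltW (lam_gt0 s); have l1 := lam_le1 st.
have zy := ZY_close st; have qq := q_le s.
have zy' : `|Z s - Y s| <= lam s by apply: (le_trans zy); rewrite ler_piMl.
rewrite /qd normrM.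
set A := dot _ _ - _.
have -> : nN * Cg * (2 * M + L + 1) / r * (lam s + `|q s|) =
  r^-1 * (nN * Cg * (2 * M + L + 1) * (lam s + `|q s|)) by ring.
apply: ler_pM => //.
have -> : A = (dot (G (Z s)) (xd s (X s)) - dot (G (Y s)) (xd s (X s))) +
    dot (G (Y s)) (xd s (X s) - (1 - lam s) *: wf s) -
    q_ (X s) * ((1 - lam s) * dot (G (Y s)) (wf s)).
  by rewrite /A [dot _ (_ - _ *: _)]dotBr dotZr; ring.
have h1 := dotGB (Z s) (Y s) (xdM (X s) st).
have h2 := dotG (Y s) (xd_close (X s) st).
have h3 : `|q_ (X s) * ((1 - lam s) * dot (G (Y s)) (wf s))| <= nN * Cg * (M * `|q s|).
  rewrite normrM mulrA mulrC; apply: ler_pM => //.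
  rewrite normrM (ger0_norm (_ : 0 <= 1 - lam s)) ?subr_ge0//.
  apply: le_trans (dotG (Y s) (wfM st)); rewrite ler_piMl//; lra.
apply: (le_trans (ler_normB _ _)); apply: (le_trans (lerD (le_trans (ler_normD _ _) (lerD h1 h2)) h3)).
rewrite -!mulrDr -!mulrA; apply: ler_wpM2l => //.
rewrite ler_wpM2l//.
have e1 : M * `|Z s - Y s| <= M * lam s by rewrite ler_wpM2l.
have e2 : L * `|Z s - Y s| <= L * lam s by rewrite ler_wpM2l.
have e3 : 0 <= (M + L + 1) * `|q s| by rewrite mulr_ge0// !addr_ge0.
rewrite -/(Z s); lra.
Qed.

Let q_close s : s \in `[0, t] -> `|q s| <= kq * lam s.
Proof.
set c := nN * Cg * (2 * M + L + 1) / r.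
have cc : 0 <= c.
  by rewrite /c; apply: divr_ge0; [apply: mulr_ge0 => //; rewrite !addr_ge0// mulr_ge0|exact: ltW].
move=> st; apply: (@weight_gronwall _ t K lam0 K0 lam00 (fun s => `|q s|) c c (`|MX| * t)) => //.
- move=> s' s't; rewrite normr_ge0/=.
  have := qL s' 0; rewrite q0 subr0 => /le_trans; apply.
  apply: (@le_trans _ _ (`|MX| * `|s' - 0|)); first by rewrite ler_wpM2r// ler_norm.
  by rewrite ler_wpM2l// st_le.
move=> m' m'0 Hm s' s't.
apply: (@weight_bound _ t K lam0 K0 lam00 q (fun s => qd s (X s)) _ MX) => //.
- by apply: addr_ge0 => //; exact: mulr_ge0.
- apply: ae_all => r' rt; have rt' := sub_oc rt.
  apply: (le_trans (qd_le rt')); rewrite -/c.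
  have -> : (c * m' + c) * (lam0 * expR (K * r')) = c * (lam r' + m' * lam r') by rewrite /lam; ring.
  by apply: ler_wpM2l => //; rewrite lerD2l; exact: Hm.
Qed.

(** [HK2] gives [kq <= 1]. Consequently the truncation in [q_] is never reached, and [1 + q s] stays
    positive. *)
Let q_half s : s \in `[0, t] -> `|q s| <= 2^-1.
Proof.
move=> st; apply: (le_trans (q_close st)); apply: le_trans (lam_le st).
rewrite ler_piMl ?(ltW (lam_gt0 s))// /kq ler_pdivrMr// mul1r; exact: HK2.
Qed.

Let q_id s : s \in `[0, t] -> q_ (X s) = q s.
Proof.
move=> /q_half; rewrite ler_norml => /andP[h1 h2].
by rewrite /q_ -/(q s) min_l// max_r.
Qed.

(* Near the interface the clipping in [om] is inactive, so that the normal
   velocity is the prescribed one. *)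
Let normal_speed i s : s \in `[0, t] -> act i s -> near s ->
  dot (G (Z s)) (Bx i s (X s)) = (1 - lam s) * (1 + q s) * dot (G (Y s)) (f i s).
Proof.
move=> st ai ns; have [cp cm] := ctrl st ai ns.
have l0 := lam_gt0 s; have l1 := lam_le1 st; have l2 := lam_le st.
set ga := dot (G (Z s)) (u i s (Z s)); set gp := dot (G (Z s)) (p i s (Z s)).
set gm := dot (G (Z s)) (m i s (Z s)); set gf := dot (G (Y s)) (f i s).
have zy := ZY_close st; have qc := q_close st.
have NC := NCg.
have kq0 : 0 <= kq * lam s by exact: le_trans qc.
have kx0 : 0 <= kx * lam s by exact: le_trans zy.
have var v (c : R) : (forall z z', `|v z - v z'| <= L * `|z - z'|) -> `|v (Y s)| <= M ->
    `|dot (G (Z s)) (v (Z s)) - dot (G (Y s)) (v (Y s))| <= nN * Cg * ((M + L) * (kx * lam s)).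
  move=> vL vM.
  have -> : dot (G (Z s)) (v (Z s)) - dot (G (Y s)) (v (Y s)) =
    dot (G (Z s)) (v (Z s) - v (Y s)) + (dot (G (Z s)) (v (Y s)) - dot (G (Y s)) (v (Y s))).
    by rewrite dotBr; ring.
  have h1 := dotG (Z s) (vL (Z s) (Y s)); have h2 := dotGB (Z s) (Y s) vM.
  apply: (le_trans (ler_normD _ _)); apply: (le_trans (lerD h1 h2)).
  rewrite -mulrDr; apply: ler_wpM2l => //.
  have e1 : L * `|Z s - Y s| <= L * (kx * lam s) by rewrite ler_wpM2l.
  have e2 : M * `|Z s - Y s| <= M * (kx * lam s) by rewrite ler_wpM2l.
  lra.
have bnd : nN * Cg * ((M * kq + (M + L) * kx + a) * lam s) <= c0 / 2 * lam s.
  by rewrite mulrA ler_wpM2r// ltW.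
have aL : 0 <= nN * Cg * (M * (kq * lam s)) by exact: mulr_ge0 NC (mulr_ge0 M0 kq0).
have bL : 0 <= nN * Cg * ((M + L) * (kx * lam s)).
  exact: mulr_ge0 NC (mulr_ge0 (addr_ge0 M0 L0) kx0).
have cL : 0 <= nN * Cg * (a * lam s) by exact: mulr_ge0 NC (mulr_ge0 a0 (ltW l0)).
have bndE : nN * Cg * ((M * kq + (M + L) * kx + a) * lam s) =
  nN * Cg * (M * (kq * lam s)) + nN * Cg * ((M + L) * (kx * lam s)) + nN * Cg * (a * lam s) by ring.
have c0l : c0 / 2 * lam s <= c0 / 2 by rewrite ler_piMr// divr_ge0// ltW.
have hp := var (p i s) 0 (fun z z' => pL i z z' st) (pM i (Y s) st).
have hm := var (m i s) 0 (fun z z' => mL i z z' st) (mM i (Y s) st).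
have hu := var (u i s) 0 (fun z z' => uL i z z' st) (uM i (Y s) st).
rewrite -/gp ler_norml in hp; move/andP: hp => [hp1 hp2].
rewrite -/gm ler_norml in hm; move/andP: hm => [hm1 hm2].
have gp_ge : c0 / 2 <= gp by lra.
have gm_le : gm <= - (c0 / 2) by lra.
(* The bound is proportional to [lam s]; divided by [lam s] it puts [D] between [- (c0 / 2)] and
   [c0 / 2], while [p] and [m] still push by at least [c0 / 2] at [Z s]. *)
have hX : `|(1 + q s) * gf - ga| <= c0 / 2 * lam s.
  have -> : (1 + q s) * gf - ga = q s * gf +
     (- (ga - dot (G (Y s)) (u i s (Y s))) - dot (G (Y s)) (u i s (Y s) - f i s)).
    by rewrite dotBr /gf; ring.
  have h1 : `|q s * gf| <= nN * Cg * (M * (kq * lam s)).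
    rewrite normrM mulrC mulrA; apply: ler_pM => //; exact: dotG (fM i st).
  have h2 := dotG (Y s) (uf st ai).
  have h3 : `|- (ga - dot (G (Y s)) (u i s (Y s))) - dot (G (Y s)) (u i s (Y s) - f i s)| <=
      nN * Cg * ((M + L) * (kx * lam s)) + nN * Cg * (a * lam s).
    apply: (le_trans (ler_normB _ _)); rewrite normrN; apply: lerD; [exact: hu|exact: h2].
  apply: (le_trans (ler_normD _ _)); apply: (le_trans (lerD h1 h3)); lra.
have Dd : D i s (X s) = (1 - lam s) * ((1 + q s) * gf - ga) * ilam s.
  by rewrite /D q_id.
have lD : lam s * D i s (X s) = (1 - lam s) * ((1 + q s) * gf - ga).
  by rewrite Dd mulrCA ilamK mulr1.
have D_le : `|D i s (X s)| <= c0 / 2.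
  have e : lam s * `|D i s (X s)| = `|(1 - lam s) * ((1 + q s) * gf - ga)|.
    by rewrite -lD (normrM (lam s)) (gtr0_norm l0).
  rewrite -(ler_pM2l l0) e [leRHS]mulrC normrM.
  have l3 : 0 <= 1 - lam s by lra.
  by rewrite (ger0_norm l3); apply: le_trans hX; rewrite ler_piMl//; lra.
move: D_le; rewrite ler_norml => /andP[D1 D2].
have gpm : c0 <= gp - gm by lra.
have den_id : den i s (X s) = gp - gm by apply: max_r.
have omE : om i s (X s) * (gp - gm) = D i s (X s) - gm.
  rewrite /om den_id -/(Z s) -/gm min_l; last by lra.
  rewrite max_r; last by lra.
  by rewrite divfK// gt_eqF//; exact: lt_le_trans gpm.
rewrite /Bx dotDr !dotZr dotDr !dotZr -/(Z s) -/ga -/gp -/gm.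
have -> : om i s (X s) * gp + (1 - om i s (X s)) * gm = D i s (X s).
  have -> : om i s (X s) * gp + (1 - om i s (X s)) * gm = om i s (X s) * (gp - gm) + gm by ring.
  by rewrite omE subrK.
by rewrite lD; ring.
Qed.

(** Near the interface [q] is frozen and the normal speeds are proportional; elsewhere [qd] is
    defined as the solution of this equation. The summand [0] is the derivative of the constant in
    [1 + q]. *)
Let rate s : s \in `[0, t] ->
  dot (G (Z s)) (xd s (X s)) - (Phi (Y s) * (0 + qd s (X s)) +
     (1 + q s) * dot (G (Y s)) ((1 - lam s) *: wf s)) = 0.
Proof.
move=> st; rewrite add0r dotZr.
have [ns|fs] := boolP (near s).
  rewrite /qd /iy ns mul0r mulr0 add0r /xd /wf !dotDr !dotZr.
  have key i : w i s * dot (G (Z s)) (Bx i s (X s)) =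
      (1 - lam s) * (1 + q s) * (w i s * dot (G (Y s)) (f i s)).
    have [->|wi] := eqVneq (w i s) 0; first by rewrite !mul0r mulr0.
    by rewrite (normal_speed st (wact st wi) ns); ring.
  by rewrite !key; ring.
by rewrite /qd mulrA [Phi _ * _]mulrC iyK// mul1r q_id//; ring.
Qed.

Let invariant s : s \in `[0, t] -> Phi (Z s) = Phi (Y s) * (1 + q s).
Proof.
move=> st; have [s0 ts] : 0 <= s /\ s <= t by move: st; rewrite in_itv/= => /andP.
have sub r' : r' \in `[0, s] -> r' \in `[0, t].
  by rewrite !in_itv/= => /andP[-> /le_trans]; exact.
have sub' r' : r' \in `]0, s[ -> r' \in `]0, t[.
  by rewrite !in_itv/= => /andP[-> /lt_le_trans]; exact.
have [_ PL _ _] := HPhi.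
pose C := Cg * MX + (Cg * MX + 2 * (Cg * MY)).
have := @lip_ae_le _ (fun r => Phi (Z r) - Phi (Y r) * (1 + q r)) (fun=> 0) 0 s C 0
  (fun s => dot (G (Z s)) (xd s (X s)) - (Phi (Y s) * (0 + qd s (X s)) +
     (1 + q s) * dot (G (Y s)) ((1 - lam s) *: wf s))) (fun=> 0) s0.
rewrite Z0 q0 addr0 mulr1 !subrr subr0 => H.
apply/eqP; rewrite -subr_eq0 -normr_le0; apply: (le_trans (H _ _ _ _ _)) => //.
- move=> x y /sub xt /sub yt.
  have -> : Phi (Z x) - Phi (Y x) * (1 + q x) - (Phi (Z y) - Phi (Y y) * (1 + q y)) =
    (Phi (Z x) - Phi (Z y)) - (Phi (Y x) * (q x - q y) + (1 + q y) * (Phi (Y x) - Phi (Y y))) by ring.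
  have h1 : `|Phi (Z x) - Phi (Z y)| <= Cg * MX * `|x - y|.
    by apply: (le_trans (PL _ _ I I)); rewrite -mulrA ler_wpM2l// ZL.
  have h2 : `|Phi (Y x) * (q x - q y)| <= Cg * MX * `|x - y|.
    by rewrite normrM -mulrA; apply: ler_pM => //; exact: qL.
  have h3 : `|(1 + q y) * (Phi (Y x) - Phi (Y y))| <= 2 * (Cg * MY) * `|x - y|.
    rewrite normrM -mulrA; apply: ler_pM => //.
      rewrite (le_trans (ler_normD _ _))// normr1; have := q_half yt.
      have : (2^-1 : R) <= 1 by rewrite invf_le1// ler1n.
      lra.
    by apply: (le_trans (PL _ _ I I)); rewrite -mulrA ler_wpM2l// YL.
  have h4 : `|Phi (Y x) * (q x - q y) + (1 + q y) * (Phi (Y x) - Phi (Y y))| <=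
     Cg * MX * `|x - y| + 2 * (Cg * MY) * `|x - y|.
    by apply: (le_trans (ler_normD _ _)); exact: lerD.
  apply: (le_trans (ler_normB _ _)); apply: (le_trans (lerD h1 h4)).
  by rewrite /C -!mulrDl.
- by move=> x y _ _; rewrite normr0 mul0r.
- apply: aeS3 Zder qder Yder => x hz hq hy xs; have xt := sub' _ xs.
  apply: hasdB; first exact: hasd_C11 Cg0 HPhi (hz xt).
  apply: hasdM; first exact: hasd_C11 Cg0 HPhi (hy xt).
  by apply: hasdD; [exact: hasd_cst|exact: hq].
- by apply: ae_all => x _; exact: hasd_cst.
- by apply: ae_all => x xs; rewrite rate ?normr0//; apply: sub_oc; exact: sub'.
Qed.

Let measurable_om i : measurable_fun setT (fun s => om i s (X s)).
Proof. by have [_] := adm_om i; apply; exact: lip_continuous XL. Qed.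

Lemma tracking_of_solution : exists (Z' : R -> 'rV[R]_N) (q' : R -> R)
    (B : bool -> R -> 'rV[R]_N) (th : bool -> R -> R),
  [/\ Z' 0 = Y 0, exists MZ, forall s s', `|Z' s - Z' s'| <= MZ * `|s - s'|,
      {ae mu, forall s, s \in `]0, t[ ->
         hasd Z' s (w true s *: B true s + w false s *: B false s)},
      forall i s, s \in `[0, t] -> 0 <= th i s <= 1 /\ B i s = (1 - lam s) *: u i s (Z' s) +
         lam s *: (th i s *: p i s (Z' s) + (1 - th i s) *: m i s (Z' s))
    & [/\ (forall i, measurable_fun setT (th i)),
       (forall s, s \in `[0, t] -> [/\ `|Z' s - Y s| <= kx * lam s, `|q' s| <= 2^-1
          & Phi (Z' s) = Phi (Y s) * (1 + q' s)])
     & forall i s, s \in `[0, t] -> act i s -> `|Phi (Y s)| < r ->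
         dot (G (Z' s)) (B i s) = (1 - lam s) * (1 + q' s) * dot (G (Y s)) (f i s)]].
Proof.
exists Z, q, (fun i s => Bx i s (X s)), (fun i s => om i s (X s)); split.
- exact: Z0.
- by exists MX; exact: ZL.
- exact: Zder.
- by move=> i s st; split; [exact: om_itv|].
split; first exact: measurable_om.
  by move=> s st; split; [exact: ZY_close|exact: q_half|exact: invariant].
exact: normal_speed.
Qed.

End Solution.

Lemma tracking : exists (Z : R -> 'rV[R]_N) (q : R -> R)
    (B : bool -> R -> 'rV[R]_N) (th : bool -> R -> R),
  [/\ Z 0 = Y 0, exists MZ, forall s s', `|Z s - Z s'| <= MZ * `|s - s'|,
      {ae mu, forall s, s \in `]0, t[ ->
         hasd Z s (w true s *: B true s + w false s *: B false s)},
      forall i s, s \in `[0, t] -> 0 <= th i s <= 1 /\ B i s = (1 - lam s) *: u i s (Z s) +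
         lam s *: (th i s *: p i s (Z s) + (1 - th i s) *: m i s (Z s))
    & [/\ (forall i, measurable_fun setT (th i)),
       (forall s, s \in `[0, t] -> [/\ `|Z s - Y s| <= kx * lam s, `|q s| <= 2^-1
          & Phi (Z s) = Phi (Y s) * (1 + q s)])
     & forall i s, s \in `[0, t] -> act i s -> `|Phi (Y s)| < r ->
         dot (G (Z s)) (B i s) = (1 - lam s) * (1 + q s) * dot (G (Y s)) (f i s)]].
Proof.
have [X [X0 [MX XL] Xder]] := picard (row_mx (Y 0) 0) t0 adm_F.
exact: (tracking_of_solution X0 XL Xder).
Qed.

End Tracking.

(** * Extension and selection for one-sided data *)

Section Side.
Context {R : realType} (N : nat) (A : metricType R).
Implicit Types (Om : set 'rV[R]_N) (b : 'rV[R]_N -> R -> A -> 'rV[R]_N)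
  (l : 'rV[R]_N -> R -> A -> R) (z : 'rV[R]_N).

(* (C1)-(C3) in the sup norm; the closedness in (C3) is dropped since it follows
   from the compactness of the control set. *)
Definition side_ok Om (T M L Ml : R) (ml : R -> R) b l : Prop :=
  [/\ (forall z s al, closure Om z -> s \in `[0, T] -> `|b z s al| <= M /\ `|l z s al| <= Ml),
      (forall z z' s s' al, closure Om z -> closure Om z' -> s \in `[0, T] -> s' \in `[0, T] ->
         `|b z s al - b z' s' al| <= L * (`|z - z'| + `|s - s'|)),
      (forall z z' s s' al, closure Om z -> closure Om z' -> s \in `[0, T] -> s' \in `[0, T] ->
         `|l z s al - l z' s' al| <= ml (N%:R * (`|z - z'| + `|s - s'|))),
      (forall z s, closure Om z -> s \in `[0, T] -> continuous (b z s) /\ continuous (l z s))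
    & forall z s al al' (th : R), closure Om z -> s \in `[0, T] -> 0 <= th <= 1 ->
        exists al'', b z s al'' = th *: b z s al + (1 - th) *: b z s al' /\
                     l z s al'' = th * l z s al + (1 - th) * l z s al'].

(** Passing from the Euclidean to the sup norm costs a factor [N], which the monotone modulus takes
    inside its argument. Absolute values are used since the signs of the constants are not
    prescribed. *)
Lemma side_ok_of_cond Om (T Mb Lb Ml : R) (ml : R -> R) b l : (0 < N)%N -> modulus ml ->
  condC1 Om T Mb Lb b -> condC2 Om T Ml ml l -> condC3 Om T b l ->
  side_ok Om T `|Mb| (`|Lb| * N%:R) `|Ml| ml b l.
Proof.
move=> N0 [_ mlm _] [cA cb bM bL] [ul lM lL] C3.
have N1 : (1 : R) <= N%:R by rewrite ler1n.
have dist z z' (s s' : R) : enorm (z - z') + `|s - s'| <= N%:R * (`|z - z'| + `|s - s'|).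
  rewrite mulrDr; apply: lerD; first exact: enorm_le_norm.
  by rewrite ler_peMl.
have dist0 z z' (s s' : R) : 0 <= enorm (z - z') + `|s - s'|.
  by rewrite addr_ge0// sqrtr_ge0.
split.
- move=> z s al cz st; split; last by apply: (le_trans (lM _ _ _ cz st)); rewrite ler_norm.
  by apply: (le_trans (norm_le_enorm _)); apply: (le_trans (bM _ _ _ cz st)); rewrite ler_norm.
- move=> z z' s s' al cz cz' st st'; apply: (le_trans (norm_le_enorm _)).
  apply: (le_trans (bL _ _ _ _ _ cz cz' st st')).
  apply: (@le_trans _ _ (`|Lb| * (enorm (z - z') + `|s - s'|))).
    by rewrite ler_wpM2r// ler_norm.
  by rewrite -mulrA ler_wpM2l.
- move=> z z' s s' al cz cz' st st'.
  by apply: (le_trans (lL _ _ _ _ _ cz cz' st st')); apply: mlm.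
- move=> z s cz st; split => al.
    have Dx a : ((closure Om `*` `[0, T]%classic) `*` [set: A]) (z, s, a) by [].
    move=> U HU; have := cb (z, s, al) U HU.
    rewrite /nbhs/= -(nbhs_subspace_in (Dx al)).
    move=> [[P1 P2] /= [n1 n2] sub].
    apply: filterS n2 => a Pa; apply: (sub ((z, s), a)) => //; split => //=.
    exact: nbhs_singleton n1.
  apply/cvgrPdist_lt => e e0; have [d d0 dP] := ul e e0.
  have : \forall x \near al, ball al d x by exact: nbhsx_ballx.
  apply: filterS => x; rewrite ballEmdist /= => xd.
  apply: dP => //; rewrite subrr ?normr0// /enorm dot0l sqrtr0//.
- move=> z s al al' th cz st /andP[th0 th1].
  have [_ cv] := C3 z s cz st.
  have mem a : (b z s a, l z s a) \in BL b l z s by rewrite inE; exists a.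
  have th01 : (0 <= th <= 1) by rewrite th0.
  have := cv _ _ (Itv01 th0 th1) (mem al) (mem al').
  rewrite inE => -[a _ [e1 e2]]; exists a; split; [exact: e1|exact: e2].
Qed.

End Side.

Section Caratheodory.
Context {R : realType} (A : metricType R).
Implicit Types (S : set R) (f g : R -> A -> R).

Lemma cara_fun S (h : R -> R) : measurable_fun S h -> cara S (fun s (_ : A) => h s).
Proof. by move=> mh; split => // s _ x; exact: cvg_cst. Qed.

Lemma cara_cst S (c : R) : cara S (fun _ (_ : A) => c).
Proof. by apply: (@cara_fun S (fun=> c)); exact: measurable_cst. Qed.

Lemma caraM S f g : cara S f -> cara S g -> cara S (fun s a => f s a * g s a).
Proof.
move=> [mf cf] [mg cg]; split=> [a|s Ss x].
  by apply: measurable_funM; [exact: mf|exact: mg].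
by apply: cvgM; [exact: (cf s Ss x)|exact: (cg s Ss x)].
Qed.

Lemma caraB S f g : cara S f -> cara S g -> cara S (fun s a => f s a - g s a).
Proof.
move=> Cf Cg; have C1 : cara S (fun _ (_ : A) => -1) by exact: cara_cst.
have := caraD Cf (caraM C1 Cg).
congr cara; apply/funext => s; apply/funext => a; rewrite mulN1r//.
Qed.

Lemma cara_max0 S f : cara S f -> cara S (fun s a => Num.max 0 (f s a)).
Proof.
move=> [mf cf]; split=> [a|s Ss].
  by apply: measurable_maxr; [exact: measurable_cst|exact: mf].
exact: (@continuous_maxl R A (f s) 0 (cf s Ss)).
Qed.

Lemma cara_sum S (I : Type) (r : seq I) (F : I -> R -> A -> R) :
  (forall i, cara S (F i)) -> cara S (fun s a => \sum_(i <- r) F i s a).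
Proof.
move=> HF; elim: r => [|i r IH].
  have : cara S (fun _ (_ : A) => 0) by exact: cara_cst.
  congr cara.
  by apply/funext => s; apply/funext => a; rewrite big_nil.
have := caraD (HF i) IH; congr cara.
by apply/funext => s; apply/funext => a; rewrite big_cons.
Qed.

Lemma measurable_of_modulus S (f : R -> R) : measurable S ->
  (forall s, S s -> forall e : R, 0 < e -> exists2 d : R, 0 < d &
     forall s', S s' -> `|s - s'| < d -> `|f s - f s'| < e) -> measurable_fun S f.
Proof.
move=> mS H; apply: subspace_continuous_measurable_fun => //.
apply/subspace_continuousP => s Ss; apply/cvgrPdist_lt => e e0.
have [d d0 dP] := H s Ss e e0.
have : \forall s' \near s, `|s - s'| < d.
  by have := @cvgr_dist_lt R R R (nbhs s) _ id s; apply.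
by apply: filterS => s' h Ss'; exact: dP.
Qed.

Lemma bmeas_comp (al : R -> A) (sg : R -> R) : continuous sg -> bmeas al -> bmeas (al \o sg).
Proof.
move=> csg mal U oU; rewrite comp_preimage.
have := @continuous_measurable_fun R sg csg measurableT _ (mal U oU).
by rewrite setTI.
Qed.

End Caratheodory.

(** Each rational point, at each scale, is replaced by a nearby point of [S] whenever there is one.
    The sequence has to stay in [S], because the data are constrained only there. *)
Lemma dense_seq (R : realType) (N : nat) (S : set 'rV[R]_N) (z0 : 'rV[R]_N) : S z0 ->
  exists d : nat -> 'rV[R]_N, (forall k, S (d k)) /\
    forall z (e : R), S z -> 0 < e -> exists k, `|z - d k| < e.
Proof.
move=> Sz0.
pose q (x : 'rV[rat]_N) : 'rV[R]_N := map_mx ratr x.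
have /choice[c cP] : forall xn : 'rV[rat]_N * nat, exists z, S z /\
    forall z', S z' -> `|z' - q xn.1| < xn.2.+1%:R^-1 -> `|z - q xn.1| < xn.2.+1%:R^-1.
  move=> [x n].
  have [[z [Sz zx]]|no] := pselect (exists z, S z /\ `|z - q x| < n.+1%:R^-1).
    by exists z.
  by exists z0; split => // z' Sz' zx; case: no; exists z'.
exists (fun k => c (odflt (0, 0%N) (@unpickle ('rV[rat]_N * nat)%type k))).
split=> [k|z e Sz e0]; first by case: (cP (odflt (0, 0%N) (unpickle k))).
have [n ne] := natSinv_lt (divr_gt0 e0 (ltr0Sn R 1)).
have n0 : (0 : R) < n.+1%:R^-1 by rewrite invr_gt0.
have /choice[y yP] : forall j, exists y : rat,
    ratr y \in `]z ord0 j - n.+1%:R^-1 / 2, z ord0 j + n.+1%:R^-1 / 2[.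
  by move=> j; apply: rat_in_itvoo; rewrite ltrD2l gtrN// divr_gt0.
have zq : `|z - q (\row_j y j)| < n.+1%:R^-1.
  apply: (@le_lt_trans _ _ (n.+1%:R^-1 / 2)); last first.
    by rewrite ltr_pdivrMr// ltr_pMr// ltr1n.
  apply: norm_le_coord; first by rewrite divr_ge0// ltW.
  move=> j; have := yP j; rewrite !mxE in_itv/= => /andP[h1 h2].
  rewrite ler_norml; move: (n.+1%:R^-1) h1 h2 => e1 h1 h2.
  by apply/andP; split; lra.
exists (pickle (\row_j y j, n)); rewrite pickleK/=.
have [_ /(_ z Sz zq)/= cq] := cP (\row_j y j, n).
rewrite (splitr e) -(subrKA (q (\row_j y j))).
apply: (le_lt_trans (ler_normD _ _)); rewrite (distrC (q _)).
by apply: ltrD; [exact: lt_trans zq ne|exact: lt_trans cq ne].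
Qed.

Lemma modulus_small (R : realType) (ml : R -> R) (c : R) : modulus ml -> 0 < c ->
  exists2 d : R, 0 < d & forall v, 0 <= v -> v < d -> ml v < c.
Proof.
move=> [ml0 _ mlc] c0.
have : \forall r \near (0 : R)^'+, `|0 - ml r| < c by move/cvgrPdist_lt : mlc => /(_ c c0).
rewrite near_withinE => /nbhs_ballP[d /= d0 dP]; exists d => // v.
rewrite le_eqVlt => /predU1P[<- _|v0 vd]; first by rewrite ml0.
have := dP v; rewrite /ball/= sub0r normrN (gtr0_norm v0) => /(_ vd v0).
by rewrite sub0r normrN; exact: le_lt_trans (ler_norm _).
Qed.

(** * Filippov selection and McShane extension of one-sided fields *)

Section Fields.
Context {R : realType} (N : nat) (A : metricType R).
Variables (Om : set 'rV[R]_N) (T M L Ml : R) (ml : R -> R)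
  (b : 'rV[R]_N -> R -> A -> 'rV[R]_N) (l : 'rV[R]_N -> R -> A -> R).
Hypotheses (cA : compact [set: A]) (M0 : 0 <= M) (L0 : 0 <= L) (mlm : modulus ml).
Hypothesis side : side_ok Om T M L Ml ml b l.
Variable tau : R -> R.
Hypotheses (tauT : forall s, tau s \in `[0, T])
  (tauL : forall s s', `|tau s - tau s'| <= `|s - s'|).

Lemma side_cara (S : set R) (Y : R -> 'rV[R]_N) (MY : R) : measurable S -> 
  (forall s s', `|Y s - Y s'| <= MY * `|s - s'|) -> (forall s, S s -> closure Om (Y s)) ->
  (forall j, cara S (fun s a => b (Y s) (tau s) a ord0 j)) /\
  cara S (fun s a => l (Y s) (tau s) a).
Proof.
move=> mS YL YS; have [bM bL lL cb cv] := side.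
have dist s s' : `|Y s - Y s'| + `|tau s - tau s'| <= (`|MY| + 1) * `|s - s'|.
  rewrite mulrDl mul1r; apply: lerD => //.
  by apply: (le_trans (YL s s')); rewrite ler_wpM2r// ler_norm.
have C0 : 0 < `|MY| + 1 by rewrite ltr_wpDl.
split=> [j|]; split=> [a|s Ss]; last 1 first.
- exact: (cb _ _ (YS s Ss) (tauT s)).2.
- apply: measurable_of_modulus => // s Ss e e0.
  have L1 : 0 < L * (`|MY| + 1) + 1 by rewrite ltr_wpDl// mulr_ge0// ltW.
  exists (e / (L * (`|MY| + 1) + 1)); first by rewrite divr_gt0.
  move=> s' Ss'; rewrite ltr_pdivlMr// => h.
  have -> : b (Y s) (tau s) a ord0 j - b (Y s') (tau s') a ord0 j =
      (b (Y s) (tau s) a - b (Y s') (tau s') a) ord0 j by rewrite !mxE.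
  apply: (le_lt_trans (coord_le_norm _ _)).
  apply: (le_lt_trans (bL _ _ _ _ _ (YS s Ss) (YS s' Ss') (tauT s) (tauT s'))).
  apply: le_lt_trans h; rewrite mulrC.
  apply: (@le_trans _ _ (((`|MY| + 1) * `|s - s'|) * L)); first by rewrite ler_wpM2r.
  by rewrite [leLHS]mulrC [leRHS]mulrC mulrA ler_wpM2r// lerDl.
- move=> x; have := (cb _ _ (YS s Ss) (tauT s)).1 x.
  move=> /cvgrPdist_le H; apply/cvgrPdist_le => e e0.
  have := H e e0; apply: filterS => y; apply: le_trans.
  have -> : b (Y s) (tau s) x ord0 j - b (Y s) (tau s) y ord0 j =
     (b (Y s) (tau s) x - b (Y s) (tau s) y) ord0 j by rewrite !mxE.
  exact: coord_le_norm.
apply: measurable_of_modulus => // s Ss e e0.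
have [d d0 mle] := modulus_small mlm e0.
have N1 : 0 < N%:R * (`|MY| + 1) + 1 :> R by rewrite ltr_wpDl// mulr_ge0// ltW.
exists (d / (N%:R * (`|MY| + 1) + 1)); first by rewrite divr_gt0.
move=> s' Ss'; rewrite ltr_pdivlMr// => h.
apply: (le_lt_trans (lL _ _ _ _ _ (YS s Ss) (YS s' Ss') (tauT s) (tauT s'))).
apply: mle; first by rewrite mulr_ge0// addr_ge0.
apply: le_lt_trans h; rewrite mulrC.
apply: (@le_trans _ _ (((`|MY| + 1) * `|s - s'|) * N%:R)); first by rewrite ler_wpM2r.
by rewrite [leLHS]mulrC [leRHS]mulrC mulrA ler_wpM2r// lerDl.
Qed.

(** Filippov's lemma: the equations for velocity and cost are merged into one zero of a Caratheodory
    function, so a single measurable control realises both. *)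
Lemma side_select (S : set R) (Y : R -> 'rV[R]_N) (MY : R) (V : R -> 'rV[R]_N) (v : R -> R)
    (a0 : A) : measurable S ->
  (forall s s', `|Y s - Y s'| <= MY * `|s - s'|) -> (forall s, S s -> closure Om (Y s)) ->
  (forall j, measurable_fun S (fun s => V s ord0 j)) -> measurable_fun S v ->
  (forall s, S s -> exists a, b (Y s) (tau s) a = V s /\ l (Y s) (tau s) a = v s) ->
  exists al : R -> A, bmeas al /\
    forall s, S s -> b (Y s) (tau s) (al s) = V s /\ l (Y s) (tau s) (al s) = v s.
Proof.
move=> mS YL YS mV mv ex; have [Cb Cl] := side_cara mS YL YS.
pose f s a := \sum_j `|b (Y s) (tau s) a ord0 j - V s ord0 j| + `|l (Y s) (tau s) a - v s|.
have sge0 s a : 0 <= \sum_j `|b (Y s) (tau s) a ord0 j - V s ord0 j|.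
  by apply: sumr_ge0 => j _.
have f0 s a : f s a = 0 <-> b (Y s) (tau s) a = V s /\ l (Y s) (tau s) a = v s.
  split=> [/eqP|[e1 e2]]; last first.
    by rewrite /f e1 e2 subrr normr0 addr0 big1// => j _; rewrite subrr normr0.
  rewrite /f paddr_eq0// normr_eq0 subr_eq0 => /andP[]; rewrite psumr_eq0//.
  move=> /allP H /eqP ->; split => //; apply/matrixP => i j; rewrite ord1.
  by have /eqP := H j (mem_index_enum j); move/normr0_eq0/eqP; rewrite subr_eq0 => /eqP.
have [||al [mal alP]] := @measurable_selection _ _ cA a0 S f mS.
- apply: caraD; last by apply: cara_abs; apply: caraB => //; exact: cara_fun.
  by apply: cara_sum => j; apply: cara_abs; apply: caraB => //; exact: cara_fun.
- by move=> s Ss; have [a aP] := ex s Ss; exists a; apply/f0.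
by exists al; split => // s Ss; apply/f0; exact: alP.
Qed.

(** The inequality becomes an equation once its defect is truncated at 0. *)
Lemma side_select_dot (S : set R) (Y : R -> 'rV[R]_N) (MY c : R) (g : R -> 'rV[R]_N)
    (a0 : A) : measurable S ->
  (forall s s', `|Y s - Y s'| <= MY * `|s - s'|) -> (forall s, S s -> closure Om (Y s)) ->
  (forall j, measurable_fun S (fun s => g s ord0 j)) ->
  (forall s, S s -> exists a, c <= dot (g s) (b (Y s) (tau s) a)) ->
  exists al : R -> A, bmeas al /\ forall s, S s -> c <= dot (g s) (b (Y s) (tau s) (al s)).
Proof.
move=> mS YL YS mg ex; have [Cb _] := side_cara mS YL YS.
pose f s a := Num.max 0 (c - dot (g s) (b (Y s) (tau s) a)).
have f0 s a : f s a = 0 <-> c <= dot (g s) (b (Y s) (tau s) a).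
  by rewrite -subr_le0 /f; split=> [/max_idPl|/max_idPl].
have [||al [mal alP]] := @measurable_selection _ _ cA a0 S f mS.
- apply: cara_max0; apply: caraB; first exact: cara_cst.
  by apply: cara_sum => j; apply: caraM => //; exact: cara_fun.
- by move=> s Ss; have [a aP] := ex s Ss; exists a; apply/f0.
by exists al; split => // s Ss; apply/f0; exact: alP.
Qed.

(** McShane's extension, coordinate by coordinate. The infimum runs over a dense sequence, which
    keeps it measurable in time; truncation at [M] restores the upper bound, and the lower one
    survives the infimum. *)
Lemma ext_field (t : R) (al : R -> A) : bmeas al -> exists U : R -> 'rV[R]_N -> 'rV[R]_N,
  [/\ (forall j, admissible t (fun s z => U s z ord0 j)), (forall s z, `|U s z| <= M),
      (forall s z z', `|U s z - U s z'| <= L * `|z - z'|)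
    & forall s z, closure Om z -> U s z = b z (tau s) (al s)].
Proof.
move=> mal; have [bM bL _ _ _] := side.
have [[z0 cz0]|no] := pselect (exists z, closure Om z); last first.
  exists (fun _ _ => 0); split => //.
  - move=> j; apply: (@adm_time _ t N (fun=> (0 : 'rV[R]_N) ord0 j) 0); first exact: measurable_cst.
    by move=> s _; rewrite mxE normr0.
  - by move=> s z; rewrite normr0.
  - by move=> s z z'; rewrite subrr normr0 mulr_ge0.
  - by move=> s z cz; case: no; exists z.
have [d [dO dD]] := dense_seq cz0.
pose v j s k := b (d k) (tau s) (al s) ord0 j.
have vM j s k : `|v j s k| <= M.
  by apply: (le_trans (coord_le_norm _ _)); case: (bM _ _ (al s) (dO k) (tauT s)).
pose h j s z (k : nat) := v j s k + L * `|z - d k|.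
have hlb j s z : has_lbound (range (h j s z)).
  exists (- M) => _ [k _ <-]; have := vM j s k; rewrite ler_norml => /andP[h1 _].
  by rewrite /h ler_wpDr// mulr_ge0.
have hne j s z : range (h j s z) !=set0 by exists (h j s z 0%N); exists 0%N.
pose I j s z := inf (range (h j s z)).
have Ilb j s z : - M <= I j s z.
  apply: lb_le_inf => // _ [k _ <-]; have := vM j s k; rewrite ler_norml => /andP[h1 _].
  by rewrite /h ler_wpDr// mulr_ge0.
have Ile j s z k : I j s z <= h j s z k by apply: ge_inf => //; exists k.
have IL' j s z z' : I j s z - I j s z' <= L * `|z - z'|.
  rewrite lerBlDl -lerBlDr; apply: lb_le_inf => // _ [k _ <-].
  have := Ile j s z k; rewrite /h => e1.
  have : L * `|z - d k| <= L * `|z - z'| + L * `|z' - d k|.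
    by rewrite -mulrDr ler_wpM2l// -(subrKA z') ler_normD.
  lra.
have IL j s z z' : `|I j s z - I j s z'| <= L * `|z - z'|.
  by rewrite ler_norml lerNl opprB IL' distrC IL'.
have Ib j s z : closure Om z -> I j s z = b z (tau s) (al s) ord0 j.
  move=> cz.
  have vb k : `|b z (tau s) (al s) ord0 j - v j s k| <= L * `|z - d k|.
    have -> : b z (tau s) (al s) ord0 j - v j s k =
       (b z (tau s) (al s) - b (d k) (tau s) (al s)) ord0 j by rewrite !mxE.
    apply: (le_trans (coord_le_norm _ _)).
    have := bL z (d k) (tau s) (tau s) (al s) cz (dO k) (tauT s) (tauT s).
    by rewrite subrr normr0 addr0.
  apply/eqP; rewrite eq_le; apply/andP; split; last first.
    apply: lb_le_inf => // _ [k _ <-]; have := vb k; rewrite ler_norml /h => /andP[_].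
    by rewrite lerBlDl.
  apply/ler_addgt0Pr => e e0.
  have L1 : 0 < 2 * L + 1 by rewrite ltr_wpDl// mulr_ge0.
  have [k kP] := dD z (e / (2 * L + 1)) cz (divr_gt0 e0 L1).
  move: kP; rewrite ltr_pdivlMr// => kP.
  have := Ile j s z k; have := vb k; rewrite ler_norml /h => /andP[h1 _] h2.
  have := normr_ge0 (z - d k); move: kP h1 h2; move: (`|z - d k|) => y kP h1 h2 y0.
  have e1 : y * (2 * L + 1) = 2 * (L * y) + y by ring.
  by move: kP; rewrite e1 => kP; move: h1 h2 kP; move: (L * y) => Ly; lra.
pose U s z := \row_j Num.min M (I j s z) : 'rV[R]_N.
have UM j s z : `|Num.min M (I j s z)| <= M.
  by rewrite ler_norml ge_min lexx/= le_min Ilb andbT -subr_ge0 opprK addr_ge0.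
have UL j s z z' : `|Num.min M (I j s z) - Num.min M (I j s z')| <= L * `|z - z'|.
  apply: (le_trans (min_lip _ _ _ _)); rewrite subrr normr0 ge_max IL andbT.
  by rewrite mulr_ge0.
exists U; split.
- move=> j; split.
    exists (M + L); first exact: addr_ge0.
    move=> s _ z; split; first by rewrite mxE; apply: (le_trans (UM j s z)); rewrite lerDl.
    move=> z'; rewrite !mxE; apply: (le_trans (UL j s z z')).
    by rewrite ler_wpM2r// lerDr.
  move=> Z cZ.
  have -> : (fun s => U s (Z s) ord0 j) = (fun s => Num.min M (I j s (Z s))).
    by apply/funext => s; rewrite mxE.
  apply: measurable_minr; first exact: measurable_cst.
  have -> : (fun s => I j s (Z s)) = (fun s => infs ((fun k s => h j s (Z s) k)^~ s) 0%N).
    apply/funext => s; rewrite /infs /sdrop /I; congr inf; apply/seteqP.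
    by split => x [k _ <-]; exists k.
  apply: measurable_fun_infs => [s _|k]; first exact: hlb.
  apply: measurable_funD.
    have [|||Cb _] := @side_cara setT (fun=> d k) 0 => //.
      by move=> s s'; rewrite subrr normr0 mul0r.
    exact: (@measurable_cara_comp R A cA setT _ al measurableT (Cb j) mal).
  apply: measurable_funM; first exact: measurable_cst.
  apply: continuous_measurable_fun => s; apply: cvg_norm.
  by apply: cvgB; [exact: cZ|exact: cvg_cst].
- by move=> s z; apply: norm_le_coord => // j; rewrite mxE.
- move=> s z z'; apply: norm_le_coord; first by rewrite mulr_ge0.
  by move=> j; rewrite !mxE.
- move=> s z cz; apply/matrixP => i j; rewrite ord1 mxE Ib//; apply/min_idPr.
  have [h1 _] := bM _ _ (al s) cz (tauT s).
  by apply: le_trans h1; apply: le_trans (coord_le_norm _ j); exact: ler_norm.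
Qed.

End Fields.

(** * Transfer of trajectories between nearby data *)

Section Clock.
Context {R : realType}.
Notation mu := (@lebesgue_measure R).
Variables (t K lam0 : R).
Hypotheses (t0 : 0 <= t) (lam00 : 0 < lam0) (K1 : 1 <= K).
Hypothesis lam_half : lam0 * expR (K * t) <= 2^-1.

(* The solution of [c' s = 1 - lam0 * expR (K * s)], [c 0 = 0]. *)
Definition clock (s : R) : R := s - (lam0 / K * expR (K * s) - lam0 / K).

Let K0 : 0 < K. Proof. exact: lt_le_trans K1. Qed.
Let lK0 : 0 < lam0 / K. Proof. exact: divr_gt0. Qed.

Lemma clock0 : clock 0 = 0.
Proof. by rewrite /clock mulr0 expR0 mulr1 !subrr. Qed.

Lemma hasd_clock s : hasd clock s (1 - lam0 * expR (K * s)).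
Proof.
have -> : 1 - lam0 * expR (K * s) = 1 - (lam0 / K * K * expR (K * s) - 0).
  by rewrite subr0 divfK ?gt_eqF.
apply: hasdB; first by have := @hasd_scale R 1 s; congr hasd; apply/funext => r; rewrite mul1r.
by apply: hasdB; [exact: hasd_expR|exact: hasd_cst].
Qed.

Lemma clock_lag s : s \in `[0, t] ->
  0 <= s - clock s /\ s - clock s <= lam0 * expR (K * s) / K.
Proof.
rewrite in_itv/= => /andP[s0 st].
have -> : s - clock s = lam0 / K * (expR (K * s) - 1) by rewrite /clock; ring.
have e1 : 1 <= expR (K * s) by rewrite -expR0 ler_expR mulr_ge0// ltW.
split; first by rewrite mulr_ge0 ?subr_ge0// ltW.
by rewrite [leRHS]mulrAC ler_pM2l// lerBlDr lerDl.
Qed.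

(** The clock runs at speed [1 - lam], which lies between one half and one. *)
Lemma clock_incr s s' : s \in `[0, t] -> s' \in `[0, t] -> s <= s' ->
  (s' - s) / 2 <= clock s' - clock s <= s' - s.
Proof.
rewrite !in_itv/= => /andP[s0 st] /andP[s'0 s't] ss'.
have -> : clock s' - clock s = s' - s - lam0 / K * (expR (K * s') - expR (K * s)).
  by rewrite /clock; ring.
have e1 : expR (K * s) <= expR (K * s') by rewrite ler_expR ler_pM2l.
have e2 := @expR_lip R (K * t) (K * s') (K * s) (ltac:(by rewrite ler_pM2l)) (ltac:(by rewrite ler_pM2l)).
have e3 : lam0 / K * (expR (K * s') - expR (K * s)) <= (s' - s) / 2.
  apply: (@le_trans _ _ (lam0 / K * (expR (K * t) * `|K * s' - K * s|))).
    by rewrite ler_pM2l// (le_trans (ler_norm _)).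
  rewrite -mulrBr ger0_norm; last by rewrite mulr_ge0 ?subr_ge0// ltW.
  have -> : lam0 / K * (expR (K * t) * (K * (s' - s))) = lam0 * expR (K * t) * (s' - s).
    by field; rewrite gt_eqF.
  by rewrite mulrC ler_wpM2l// subr_ge0.
have e4 : 0 <= lam0 / K * (expR (K * s') - expR (K * s)).
  by rewrite mulr_ge0 ?subr_ge0// ltW.
move: e3 e4; move: (lam0 / K * _) => y e3 e4; apply/andP; split; lra.
Qed.

Lemma clock_itv s : s \in `[0, t] -> clock s \in `[0, t].
Proof.
move=> st; have [l1 _] := clock_lag st.
have z0 : 0 \in `[0, t] by rewrite in_itv/= lexx.
move: (st); rewrite in_itv/= => /andP[s0 s1]; have := clock_incr z0 st s0.
rewrite clock0 in_itv/= => /andP[h _]; apply/andP; split; lra.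
Qed.

Lemma clock_oitv s : s \in `]0, t[ -> clock s \in `]0, t[.
Proof.
move=> st; have sc : s \in `[0, t] by move: st; rewrite !in_itv/= => /andP[/ltW-> /ltW->].
have [l1 _] := clock_lag sc.
have z0 : 0 \in `[0, t] by rewrite in_itv/= lexx.
move: (st); rewrite in_itv/= => /andP[s0 s1]; have := clock_incr z0 sc (ltW s0).
rewrite clock0 in_itv/= => /andP[h _]; apply/andP; split; lra.
Qed.

Lemma clock_lip s s' : s \in `[0, t] -> s' \in `[0, t] -> `|clock s - clock s'| <= `|s - s'|.
Proof.
move=> st st'; wlog ss' : s s' st st' / s <= s'.
  move=> W; have [/W|/ltW/W] := leP s s'; first exact.
  by rewrite distrC (distrC s'); exact.
have /andP[h1 h2] := clock_incr st st' ss'.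
rewrite distrC (distrC s) !ger0_norm//; lra.
Qed.

Lemma clock_expand s s' : s \in `[0, t] -> s' \in `[0, t] ->
  `|s - s'| <= 2 * `|clock s - clock s'|.
Proof.
move=> st st'; wlog ss' : s s' st st' / s <= s'.
  move=> W; have [/W|/ltW/W] := leP s s'; first exact.
  by rewrite distrC (distrC (clock s')); exact.
have /andP[h1 h2] := clock_incr st st' ss'.
rewrite distrC (distrC (clock s)) !ger0_norm//; lra.
Qed.

(** The clock shrinks distances by at most a factor 2, so preimages of null sets are null by
    [negligible_expand]. *)
Lemma ae_clock (Q : R -> Prop) : {ae mu, forall s, s \in `]0, t[ -> Q s} ->
  {ae mu, forall s, s \in `]0, t[ -> Q (clock s)}.
Proof.
move=> HQ.
have E : forall x y, `]0, t[%classic x -> `]0, t[%classic y ->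
    `|x - y| <= 2 * `|clock x - clock y|.
  move=> x y; rewrite /= !in_itv/= => /andP[x0 xt] /andP[y0 yt].
  by apply: clock_expand; rewrite in_itv/= ?(ltW x0) ?(ltW y0) ltW.
apply: negligibleS (negligible_expand (ltr0Sn R 1) E HQ).
move=> s /= nQ; apply: contrapT => h; apply: nQ => st; apply: contrapT => nQ.
by apply: h; split => //=; move=> /(_ (clock_oitv st)).
Qed.

End Clock.

(** For the primitives [P'] and [P], the function [P' s - P (clock s)] has derivative at most [d] in
    size. The final piece of the original path, which the slowed one never reaches, lasts at most
    [lam0 * expR (K * t)] and costs at most [C] times that. *)
Lemma clock_cost (R : realType) (t K lam0 C d : R) (F F' : R -> R) : 0 < t -> 0 < lam0 -> 1 <= K ->
  lam0 * expR (K * t) <= 2^-1 -> 0 <= C ->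
  measurable_fun setT F -> measurable_fun setT F' ->
  (forall s, s \in `[0, t] -> `|F s| <= C) -> (forall s, s \in `[0, t] -> `|F' s| <= C) ->
  (forall s, s \in `]0, t[ -> `|F' s - (1 - lam0 * expR (K * s)) * F (clock K lam0 s)| <= d) ->
  \int[lebesgue_measure]_(s in `[0, t]) F' s <=
  \int[lebesgue_measure]_(s in `[0, t]) F s + (d * t + C * (lam0 * expR (K * t))).
Proof.
move=> t0 l0 K1 lh C0 mF mF' FC F'C Fd.
rewrite -!primE; set P := prim t F; set P' := prim t F'; set sg := clock K lam0.
have tt : t \in `[0, t] by rewrite in_itv/= lexx ltW.
have [lag0 lag1] := clock_lag l0 K1 tt.
have PL := prim_lip C0 mF FC; have P'L := prim_lip C0 mF' F'C.
have h1 : `|(P' t - P (sg t)) - (P' 0 - P (sg 0))| <= d * t - d * 0.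
  apply: (@lip_ae_le R (fun s => P' s - P (sg s)) (fun s => d * s) 0 t (C + C) `|d|
    (fun s => F' s - (1 - lam0 * expR (K * s)) * F (sg s)) (fun=> d)) => //; first exact: ltW.
  - move=> x y xt yt.
    have -> : P' x - P (sg x) - (P' y - P (sg y)) = (P' x - P' y) + (P (sg y) - P (sg x)).
      by ring.
    apply: (le_trans (ler_normD _ _)); rewrite mulrDl.
    apply: lerD; first exact: P'L.
    apply: (le_trans (PL _ _)); rewrite distrC ler_wpM2l//.
    by apply: (clock_lip l0 K1 lh).
  - by move=> x y _ _; rewrite -mulrBr normrM.
  - apply: aeS2 (prim_ae C0 mF' F'C) (ae_clock (ltW t0) l0 K1 lh (prim_ae C0 mF FC)).
    move=> s h2 h3 st; apply: hasdB; first exact: h2.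
    exact: (hasd_comp (hasd_clock lam0 K1 s) (h3 st)).
  - by apply: ae_all => s _; have := @hasd_scale R d s.
  - by apply: ae_all => s; exact: Fd.
have P0 : P 0 = 0 by exact: prim0.
have P'0 : P' 0 = 0 by exact: prim0.
have sg0 : sg 0 = 0 by exact: clock0.
rewrite sg0 P0 P'0 subrr subr0 mulr0 subr0 in h1.
have h2 : `|P t - P (sg t)| <= C * (lam0 * expR (K * t)).
  apply: (le_trans (PL _ _)); rewrite ler_wpM2l// ger0_norm//.
  have K0 : 0 < K by exact: lt_le_trans K1.
  by apply: (le_trans lag1); rewrite ler_pdivrMr// ler_peMr// mulr_ge0 ?expR_ge0// ltW.
move: h1 h2; rewrite !ler_norml => /andP[_ h1] /andP[h2 _]; lra.
Qed.

(** * The two phases and their weights *)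

Section Phases.
Context {R : realType} (N : nat).
Variables (Om1 Om2 H : set 'rV[R]_N) (n1 : 'rV[R]_N -> 'rV[R]_N).
Hypothesis HO : H_Omega Om1 Om2 H.

Definition phase (i : bool) : set 'rV[R]_N := if i then Om1 else Om2.

(** The share of side [i], [true] being the first phase. It writes the discontinuous velocity as one
    convex combination of the two sides at every point of space. *)
Definition weight (i : bool) (z : 'rV[R]_N) (m : R) : R :=
  \1_(phase i) z + \1_H z * (if i then m else 1 - m).

Lemma closure_phase i z : closure (phase i) z <-> phase i z \/ H z.
Proof.
have [ op1 op2 _ _ _] := HO.
split=> [cz|[Oz|Hz]]; last 2 first.
- exact: subset_closure.
- by case: i; [exact: (H_closure HO Hz).1|exact: (H_closure HO Hz).2].
have no (U V : set 'rV[R]_N) : open V -> (forall y, U y -> ~ V y) -> closure U z -> ~ V z.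
  move=> oV UV cU Vz; have [y [Uy Vy]] := cU V (open_nbhs_nbhs (conj oV Vz)).
  exact: UV Uy Vy.
case: i cz => cz; have [Oz|Oz|Hz] := Omega_cover HO z; try by [left|right].
  by case: (no _ _ op2 (Omega_disjoint HO) cz Oz).
by case: (no _ _ op1 (fun y h1 h2 => Omega_disjoint HO h2 h1) cz Oz).
Qed.

Lemma weight_ge0 i z m : 0 <= m <= 1 -> 0 <= weight i z m.
Proof.
by move=> /andP[m0 m1]; rewrite addr_ge0 ?mulr_ge0//; case: i => //; rewrite subr_ge0.
Qed.

Lemma weight_sum z m : weight true z m + weight false z m = 1.
Proof.
have i0 (U : set 'rV[R]_N) : ~ U z -> \1_U z = 0 :> R by move=> nU; rewrite indicE memNset.
have i1 (U : set 'rV[R]_N) : U z -> \1_U z = 1 :> R by move=> Uz; rewrite indicE mem_set.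
rewrite /weight/=; have [Oz|Oz|Hz] := Omega_cover HO z.
- have nO := Omega_disjoint HO Oz; have nH : ~ H z by move=> /(H_disjoint HO)[].
  by rewrite (i1 Om1)// (i0 Om2)// (i0 H)// !mul0r !addr0.
- have nO : ~ Om1 z by move=> /(Omega_disjoint HO).
  have nH : ~ H z by move=> /(H_disjoint HO)[].
  by rewrite (i1 Om2)// (i0 Om1)// (i0 H)// !mul0r !addr0 add0r.
- have [nO1 nO2] := H_disjoint HO Hz.
  by rewrite (i0 Om2)// (i0 Om1)// (i1 H)// !mul1r !add0r addrC subrK.
Qed.

Lemma weight_closure i z m : weight i z m != 0 -> closure (phase i) z.
Proof.
move=> w0; apply/closure_phase; apply: contrapT => /not_orP[nO nH].
by move: w0; rewrite /weight !indicE !memNset// mul0r addr0 eqxx.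
Qed.

Lemma weight_same i z z' m : (phase i z <-> phase i z') -> (H z <-> H z') ->
  weight i z m = weight i z' m.
Proof.
have e (U : set 'rV[R]_N) : (U z <-> U z') -> \1_U z = \1_U z' :> R.
  by move=> h; rewrite !indicE; congr (_%:R); congr nat_of_bool; apply/idP/idP => /set_mem/h/mem_set.
by move=> h1 h2; rewrite /weight (e _ h1) (e _ h2).
Qed.

Lemma measurable_weight i (Y : R -> 'rV[R]_N) (m : R -> R) : continuous Y ->
  measurable_fun setT m -> measurable_fun setT (fun s => weight i (Y s) (m s)).
Proof.
have [ op1 op2 _ U _] := HO => cY mm.
have mop V : open V -> measurable (Y @^-1` V).
  by move=> oV; apply: open_measurable; apply: open_comp => // x _; exact: cY.
have mO j : measurable (Y @^-1` phase j) by case: j; exact: mop.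
have mH : measurable (Y @^-1` H).
  rewrite (_ : _ @^-1` H = ~` (Y @^-1` Om1 `|` Y @^-1` Om2)).
    by apply: measurableC; apply: measurableU; exact: mop.
  apply/seteqP; split => s /=.
    by move=> /(H_disjoint HO)[h1 h2] [].
  by move=> h; have [?|?|//] := Omega_cover HO (Y s); case: h; [left|right].
apply: measurable_funD; first exact: (@measurable_indic _ _ R setT _ (mO i)).
apply: measurable_funM; first exact: (@measurable_indic _ _ R setT _ mH).
case: i => //; apply: measurable_funB => //; exact: measurable_cst.
Qed.

Lemma strict_phase Phi G z : weak_defining Om1 Om2 H n1 Phi G -> strict_at Om1 Om2 H n1 Phi G z ->
  [/\ (Om1 z <-> Phi z < 0), (Om2 z <-> 0 < Phi z) & (H z <-> Phi z = 0)].
Proof.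
move=> [_ /(_ z)[_ _ W3]] [S1 S2 _].
split; split; [exact: S1| |exact: S2| |by move=> /W3[]|].
- move=> P0; have [//|/S2 P1|/W3[P1 _]] := Omega_cover HO z.
    by have := lt_trans P0 P1; rewrite ltxx.
  by move: P0; rewrite P1 ltxx.
- move=> P0; have [/S1 P1|//|/W3[P1 _]] := Omega_cover HO z.
    by have := lt_trans P0 P1; rewrite ltxx.
  by move: P0; rewrite P1 ltxx.
- by move=> P0; have [/S1|/S2|//] := Omega_cover HO z; rewrite P0 ltxx.
Qed.

Lemma same_phase Phi G z z' (k : R) : weak_defining Om1 Om2 H n1 Phi G ->
  strict_at Om1 Om2 H n1 Phi G z -> strict_at Om1 Om2 H n1 Phi G z' -> 0 < k ->
  Phi z' = Phi z * k -> (forall i, phase i z' <-> phase i z) /\ (H z' <-> H z).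
Proof.
move=> W /(strict_phase W)[a1 a2 a3] /(strict_phase W)[c1 c2 c3] k0 E.
split=> [[]|].
- by rewrite /phase a1 c1 E pmulr_llt0.
- by rewrite /phase a2 c2 E pmulr_lgt0.
- rewrite a3 c3 E; split=> [/eqP|->]; last by rewrite mul0r.
  by rewrite mulf_eq0 (gt_eqF k0) orbF => /eqP.
Qed.

End Phases.

(** * Trajectories written through the two sides *)

Section Transfer.
Context {R : realType} (N : nat) (A : bool -> metricType R).
Notation mu := (@lebesgue_measure R).
Variables (Om1 Om2 H : set 'rV[R]_N) (n1 : 'rV[R]_N -> 'rV[R]_N).
Hypothesis HO : H_Omega Om1 Om2 H.
Local Notation Om := (phase Om1 Om2).
Local Notation wt := (weight Om1 Om2 H).
Implicit Types (b : forall i, 'rV[R]_N -> R -> A i -> 'rV[R]_N)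
  (l : forall i, 'rV[R]_N -> R -> A i -> R).

Definition ivel b z s (al : forall i, A i) m : 'rV[R]_N :=
  wt true z m *: b true z s (al true) + wt false z m *: b false z s (al false).

Definition icost l z s (al : forall i, A i) m : R :=
  wt true z m * l true z s (al true) + wt false z m * l false z s (al false).

(** The sign on the second side is reversed because it is tested against [n1], the opposite of the
    outward normal there. *)
Definition ireg b z s (al : forall i, A i) (m : R) : Prop :=
  [/\ dot (m *: b true z s (al true) + (1 - m) *: b false z s (al false)) (n1 z) = 0,
      0 <= dot (b true z s (al true)) (n1 z) & dot (b false z s (al false)) (n1 z) <= 0].

(** A version of [traj] in which the path is Lipschitz and the controls are Borel on the whole line,
    so that both can be reparametrised freely. *)
Definition itraj b x t (X : R -> 'rV[R]_N) (al : forall i, R -> A i) (m : R -> R) : Prop :=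
  [/\ (exists MX, forall s s', `|X s - X s'| <= MX * `|s - s'|), X 0 = x,
      forall i, bmeas (al i),
      measurable_fun setT m /\ forall s, 0 <= m s <= 1
    & {ae mu, forall s, s \in `]0, t[ -> hasd X s (ivel b (X s) (t - s) (al^~ s) (m s))}].

Variables (T M L Ml : R) (ml : R -> R).
Hypotheses (cA : forall i, compact [set: A i]) (M0 : 0 <= M) (L0 : 0 <= L) (Ml0 : 0 <= Ml)
  (mlm : modulus ml).

Lemma ivel_bound b l z s al m : (forall i, side_ok (Om i) T M L Ml ml (b i) (l i)) ->
  s \in `[0, T] -> 0 <= m <= 1 -> `|ivel b z s al m| <= M.
Proof.
move=> side sT m01; rewrite /ivel.
have h i : `|wt i z m *: b i z s (al i)| <= wt i z m * M.
  rewrite normrZ (ger0_norm (weight_ge0 _ _ _ i z m01)).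
  have [->|w0] := eqVneq (wt i z m) 0; first by rewrite !mul0r.
  rewrite ler_wpM2l ?weight_ge0//.
  by have [bM _ _ _ _] := side i; case: (bM z s (al i) (weight_closure HO w0) sT).
apply: (le_trans (ler_normD _ _)); apply: (le_trans (lerD (h true) (h false))).
by rewrite -mulrDl (weight_sum HO) mul1r.
Qed.

(** The Lipschitz constant of the individual path is replaced by the bound on the velocities; all
    trajectories from a bounded set then stay in one ball. *)
Lemma itraj_speed b l x t X al m : (forall i, side_ok (Om i) T M L Ml ml (b i) (l i)) ->
  t <= T -> itraj b x t X al m ->
  forall s s', s \in `[0, t] -> s' \in `[0, t] -> `|X s - X s'| <= M * `|s - s'|.
Proof.
move=> side tT [[MX XL] _ _ [_ m01] Xd] s s' st st'.
wlog ss' : s s' st st' / s <= s'.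
  move=> W; have [/W|/ltW/W] := leP s s'; first exact.
  by rewrite distrC (distrC s); exact.
move: st st'; rewrite !in_itv/= => /andP[s0 st] /andP[s'0 s't].
apply: norm_le_coord; first by rewrite mulr_ge0.
move=> j; rewrite distrC (ger0_norm (_ : 0 <= s' - s)) ?subr_ge0//.
rewrite (_ : _ ord0 j = X s ord0 j - X s' ord0 j); last by rewrite !mxE.
rewrite distrC mulrBr.
apply: (@lip_ae_le R (fun r => X r ord0 j) (fun r => M * r) s s' MX `|M|
   (fun r => ivel b (X r) (t - r) (al^~ r) (m r) ord0 j) (fun=> M)) => //.
- move=> p q _ _; have -> : X p ord0 j - X q ord0 j = (X p - X q) ord0 j by rewrite !mxE.
  exact: le_trans (coord_le_norm _ _) (XL _ _).
- by move=> p q _ _; rewrite -mulrBr normrM.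
- apply: aeS Xd => p h; rewrite in_itv/= => /andP[p1 p2]; apply: (hasd_coord _ _ _).1; apply: h.
  by rewrite in_itv/= (le_lt_trans s0 p1) (lt_le_trans p2 s't).
- by apply: ae_all => p _; have := @hasd_scale R M p.
- apply: ae_all => p; rewrite in_itv/= => /andP[p1 p2].
  apply: (le_trans (coord_le_norm _ _)); apply: (ivel_bound _ _ side) => //.
  rewrite in_itv/= subr_ge0 (le_trans (ltW p2) s't)/=.
  by rewrite (le_trans _ tT)// lerBlDr lerDl (le_trans s0 (ltW p1)).
Qed.

(** The running costs are controlled only on the closure of their side and for times in [[0, T]].
    Time is therefore clamped and each cost cut off to the times at which the path is on its side,
    where its weight lives. *)
Lemma icost_measurable b l x t X al m : (forall i, side_ok (Om i) T M L Ml ml (b i) (l i)) ->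
  0 <= t -> t <= T -> itraj b x t X al m ->
  exists F : R -> R, [/\ measurable_fun setT F, (forall s, s \in `[0, t] -> `|F s| <= Ml)
    & forall s, s \in `[0, t] -> F s = icost l (X s) (t - s) (al^~ s) (m s)].
Proof.
move=> side t0 tT [[MX XL] _ mal [mm m01] _].
have cX := lip_continuous XL.
pose tau s := t - clamp t s.
have tauT s : tau s \in `[0, T].
  have := clamp_itv s t0; rewrite !in_itv/= => /andP[c1 c2].
  by rewrite subr_ge0 c2 (le_trans _ tT)// lerBlDr lerDl.
have tauL s s' : `|tau s - tau s'| <= `|s - s'|.
  by rewrite opprB addrC addrA subrK distrC clamp_lip.
pose S i := [set s | closure (Om i) (X s)].
have mS i : measurable (S i).
  apply: closed_measurable; rewrite (_ : S i = X @^-1` closure (Om i))//.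
  by apply: closed_comp => [s _|]; [exact: cX|exact: closed_closure].
pose k i := (fun s => l i (X s) (tau s) (al i s)) \_ (S i).
have mk i : measurable_fun setT (k i).
  have XS s : S i s -> closure (Om i) (X s) by [].
  have [_ Cl] := side_cara L0 mlm (side i) tauT tauL (mS i) XL XS.
  have := @measurable_cara_comp R (A i) (@cA i) (S i) _ (al i) (mS i) Cl (mal i).
  by move/(measurable_restrictT _ (mS i)).1.
have kE i s : s \in `[0, t] -> wt i (X s) (m s) * k i s =
    wt i (X s) (m s) * l i (X s) (t - s) (al i s).
  move=> st; have [->|w0] := eqVneq (wt i (X s) (m s)) 0; first by rewrite !mul0r.
  by rewrite /k patchE mem_set ?/tau ?clamp_id//; exact: (weight_closure HO w0).
have kM i s : `|k i s| <= Ml.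
  rewrite /k patchE; case: ifPn => [/set_mem h|_]; last by rewrite normr0.
  by have [bM _ _ _ _] := side i; case: (bM _ _ (al i s) h (tauT s)).
exists (fun s => wt true (X s) (m s) * k true s + wt false (X s) (m s) * k false s); split.
- apply: measurable_funD; apply: measurable_funM => //; exact: measurable_weight.
- move=> s st.
  have h i : `|wt i (X s) (m s) * k i s| <= wt i (X s) (m s) * Ml.
    by rewrite normrM (ger0_norm (weight_ge0 _ _ _ i _ (m01 s))) ler_wpM2l ?weight_ge0.
  apply: (le_trans (ler_normD _ _)); apply: (le_trans (lerD (h true) (h false))).
  by rewrite -mulrDl (weight_sum HO) mul1r.
- by move=> s st; rewrite /icost !kE.
Qed.

End Transfer.

(** * Transfer of one trajectory *)

Section TransferTheorem.
Context {R : realType} (N : nat) (A : bool -> metricType R).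
Notation mu := (@lebesgue_measure R).
Variables (Om1 Om2 H : set 'rV[R]_N) (n1 : 'rV[R]_N -> 'rV[R]_N).
Hypothesis HO : H_Omega Om1 Om2 H.
Local Notation Om := (phase Om1 Om2).
Local Notation wt := (weight Om1 Om2 H).
Variables (T M L Ml : R) (ml : R -> R)
  (b b' : forall i, 'rV[R]_N -> R -> A i -> 'rV[R]_N)
  (l l' : forall i, 'rV[R]_N -> R -> A i -> R).
Arguments b : clear implicits.
Arguments b' : clear implicits.
Arguments l : clear implicits.
Arguments l' : clear implicits.
Hypotheses (cA : forall i, compact [set: A i]) (M0 : 0 <= M) (L0 : 0 <= L) (Ml0 : 0 <= Ml)
  (mlm : modulus ml).
Hypotheses (side : forall i, side_ok (Om i) T M L Ml ml (b i) (l i))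
  (side' : forall i, side_ok (Om i) T M L Ml ml (b' i) (l' i)).
Variables (Phi : 'rV[R]_N -> R) (G : 'rV[R]_N -> 'rV[R]_N) (Cg r c0 a K lam0 err rho : R).
Hypotheses (W : weak_defining Om1 Om2 H n1 Phi G) (Cg0 : 0 <= Cg) (HPhi : C11on setT Phi G Cg).
Hypothesis St : forall z, `|z| <= rho -> strict_at Om1 Om2 H n1 Phi G z.
Hypothesis near_data : forall i z s al, `|z| <= rho -> closure (Om i) z -> s \in `[0, T] ->
  `|b i z s al - b' i z s al| <= err /\ `|l i z s al - l' i z s al| <= err.
Hypothesis ctrl : forall i z s, `|z| <= rho -> `|Phi z| < r -> closure (Om i) z ->
  s \in `[0, T] -> (exists al, c0 <= dot (G z) (b' i z s al)) /\
                   (exists al, c0 <= dot (- G z) (b' i z s al)).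
Let kx := 2 * (1 + M) / K.
Let nN : R := N%:R.
Let kq := 2 * (nN * Cg * (2 * M + L + 1) / r) / K.
Hypotheses (r0 : 0 < r) (c00 : 0 < c0) (a0 : 0 < a) (a1 : a <= 1) (K1 : 1 <= K)
  (KL : L <= K * (a / 2)) (lam00 : 0 < lam0) (lamT : lam0 * expR (K * T) <= 2^-1)
  (err0 : 0 <= err) (errl : err <= lam0 * (a / 2)).
Hypotheses (HK1 : 2 * L <= K) (HK1' : kx <= 1)
  (HK2 : 2 * (nN * Cg * (2 * M + L + 1) / r) <= K)
  (HK3 : nN * Cg * (M * kq + (M + L) * kx + a) <= c0 / 2).
Variables (x : 'rV[R]_N) (t : R) (X : R -> 'rV[R]_N) (al : forall i, R -> A i) (m : R -> R).
Hypotheses (t0 : 0 < t) (tT : t <= T) (xrho : `|x| + M * T + 1 <= rho).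
Hypothesis HX : itraj Om1 Om2 H b x t X al m.

Let lam s := lam0 * expR (K * s).
(** The clock frozen outside [[0, t]]; [Y], [ah] and [mh] are the given path and controls read along
    it. The original data are then evaluated at time [taur], the new data at time [tau]. *)
Let rt s := clock K lam0 (clamp t s).
Let Y s := X (rt s).
Let ah i s := al i (rt s).
Let mh s := m (rt s).
Let w i s := wt i (Y s) (mh s).
Let tau s := t - clamp t s.
Let taur s := t - rt s.
Let act i s := closure (Om i) (Y s).

Let t0w : 0 <= t. Proof. exact: ltW. Qed.
Let K0 : 0 < K. Proof. exact: lt_le_trans K1. Qed.
Let cI s : clamp t s \in `[0, t]. Proof. exact: clamp_itv. Qed.
Let lamt : lam t <= lam0 * expR (K * T).
Proof. by rewrite ler_pM2l// ler_expR ler_pM2l. Qed.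
Let lamt2 : lam t <= 2^-1. Proof. exact: le_trans lamt lamT. Qed.
Let lam_gt0 s : 0 < lam s. Proof. by rewrite mulr_gt0// expR_gt0. Qed.
Let lam_t s : s \in `[0, t] -> lam s <= lam t.
Proof. by rewrite in_itv/= => /andP[_ st]; rewrite ler_pM2l// ler_expR ler_pM2l. Qed.
Let lam_ge s : s \in `[0, t] -> lam0 <= lam s.
Proof.
rewrite in_itv/= => /andP[s0 _]; rewrite ler_peMr//; first exact: ltW.
by rewrite -expR0 ler_expR mulr_ge0// ltW.
Qed.
Let rtI s : rt s \in `[0, t]. Proof. exact: (clock_itv t0w lam00 K1 lamt2). Qed.
Let rtL s s' : `|rt s - rt s'| <= `|s - s'|.
Proof.
apply: le_trans (clamp_lip t s s').
exact: (clock_lip lam00 K1 lamt2 (cI s) (cI s')).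
Qed.
Let toT s : s \in `[0, t] -> t - s \in `[0, T].
Proof.
rewrite !in_itv/= => /andP[s0 st]; rewrite subr_ge0 st/= (le_trans _ tT)//.
by rewrite lerBlDr lerDl.
Qed.
Let tauT s : tau s \in `[0, T]. Proof. exact: toT. Qed.
Let taurT s : taur s \in `[0, T]. Proof. exact: toT. Qed.
Let subL (f : R -> R) : (forall s s', `|f s - f s'| <= `|s - s'|) ->
  forall s s', `|(t - f s) - (t - f s')| <= `|s - s'|.
Proof. by move=> fL s s'; rewrite opprB addrC addrA subrK distrC. Qed.
Let tauL s s' : `|tau s - tau s'| <= `|s - s'|. Proof. by apply: subL => *; exact: clamp_lip. Qed.
Let taurL s s' : `|taur s - taur s'| <= `|s - s'|. Proof. exact: subL. Qed.
Let crt : continuous rt.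
Proof. by apply: (@lip_continuous R R R rt 1) => s s'; rewrite mul1r. Qed.

Let XM s s' : s \in `[0, t] -> s' \in `[0, t] -> `|X s - X s'| <= M * `|s - s'|.
Proof. exact: (itraj_speed HO M0 side tT HX). Qed.
Let YM s s' : `|Y s - Y s'| <= M * `|s - s'|.
Proof. by apply: (le_trans (XM (rtI s) (rtI s'))); rewrite ler_wpM2l. Qed.
Let cY : continuous Y. Proof. exact: lip_continuous YM. Qed.
Let X0 : X 0 = x. Proof. by have [_] := HX. Qed.
Let rt0 : rt 0 = 0. Proof. by rewrite /rt clamp_id ?clock0// in_itv/= lexx. Qed.
(** The unit left free in the ball is room for [Z], which stays within [lam s <= 2^-1] of [Y]. *)
Let Yrho s : `|Y s| <= rho - 1.
Proof.
have z0 : 0 \in `[0, t] by rewrite in_itv/= lexx.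
have := XM (rtI s) z0; rewrite X0 subr0 -/(Y s) => h.
have h2 : `|rt s| <= T.
  by have := rtI s; rewrite in_itv/= => /andP[h1 h2]; rewrite ger0_norm// (le_trans h2).
have h3 : M * `|rt s| <= M * T by rewrite ler_wpM2l.
have h4 : `|Y s| <= `|Y s - x| + `|x| by rewrite -{1}(subrK x (Y s)) ler_normD.
by move: h h3 h4 xrho; lra.
Qed.
Let mah i : bmeas (ah i).
Proof. by have [_ _ /(_ i) h _ _] := HX; exact: (bmeas_comp crt h). Qed.
Let mmh : measurable_fun setT mh.
Proof.
have [_ _ _ [h _] _] := HX.
by apply: (measurableT_comp h); exact: continuous_measurable_fun.
Qed.
Let mh01 s : 0 <= mh s <= 1. Proof. by have [_ _ _ [_ h] _] := HX; exact: h. Qed.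
Let mS i (Z : R -> 'rV[R]_N) : continuous Z -> measurable [set s | closure (Om i) (Z s)].
Proof.
move=> cZ; apply: closed_measurable.
by apply: (@closed_comp _ _ Z (closure (Om i))) => [s _|]; [exact: cZ|exact: closed_closure].
Qed.

Let rt_lag s : s \in `[0, t] -> 0 <= s - rt s <= lam s / K.
Proof. by move=> st; rewrite /rt clamp_id//; apply/andP; exact: (clock_lag lam00 K1 st). Qed.

Let Yder (f : bool -> R -> 'rV[R]_N) :
  (forall i s, s \in `[0, t] -> act i s -> f i s = b i (Y s) (taur s) (ah i s)) ->
  {ae mu, forall s, s \in `]0, t[ ->
    hasd Y s ((1 - lam s) *: (w true s *: f true s + w false s *: f false s))}.
Proof.
move=> fE; have [_ _ _ _ Xd] := HX.
apply: aeS (ae_clock t0w lam00 K1 lamt2 Xd) => s h st.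
have sc : s \in `[0, t] by move: st; rewrite !in_itv/= => /andP[/ltW-> /ltW->].
have rE : rt s = clock K lam0 s by rewrite /rt clamp_id.
have wf i : w i s *: f i s = w i s *: b i (Y s) (taur s) (ah i s).
  have [->|w0] := eqVneq (w i s) 0; first by rewrite !scale0r.
  by rewrite fE//; exact: (weight_closure HO w0).
have hX : hasd X (clock K lam0 s) (w true s *: f true s + w false s *: f false s).
  by rewrite !wf; have := h st; rewrite -rE.
have := hasd_comp (hasd_clock lam0 K1 s) hX; apply: hasd_near.
apply: filterS (near_in_itvoo st) => p; rewrite in_itv/= => /andP[p0 pt].
by rewrite /Y /rt clamp_id// in_itv/= !ltW.
Qed.

Section Synchronised.
Variables (U p n : bool -> R -> 'rV[R]_N -> 'rV[R]_N) (f : bool -> R -> 'rV[R]_N)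
  (ap an : forall i, R -> A i) (Z : R -> 'rV[R]_N) (q : R -> R) (B : bool -> R -> 'rV[R]_N)
  (th : bool -> R -> R) (CZ : R).
Arguments ap : clear implicits.
Arguments an : clear implicits.
Hypotheses (admU : forall i j, admissible t (fun s z => U i s z ord0 j))
  (admp : forall i j, admissible t (fun s z => p i s z ord0 j))
  (admn : forall i j, admissible t (fun s z => n i s z ord0 j)).
Hypotheses (map : forall i, bmeas (ap i)) (man : forall i, bmeas (an i)).
Hypotheses (UE : forall i s z, closure (Om i) z -> U i s z = b' i z (tau s) (ah i s))
  (pE : forall i s z, closure (Om i) z -> p i s z = b' i z (tau s) (ap i s))
  (nE : forall i s z, closure (Om i) z -> n i s z = b' i z (tau s) (an i s))
  (fE : forall i s, s \in `[0, t] -> act i s -> f i s = b i (Y s) (taur s) (ah i s)).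
Hypotheses (Z0 : Z 0 = x) (ZL : forall s s', `|Z s - Z s'| <= CZ * `|s - s'|)
  (Zd : {ae mu, forall s, s \in `]0, t[ ->
     hasd Z s (w true s *: B true s + w false s *: B false s)})
  (BE : forall i s, s \in `[0, t] -> 0 <= th i s <= 1 /\
     B i s = (1 - lam s) *: U i s (Z s) +
       lam s *: (th i s *: p i s (Z s) + (1 - th i s) *: n i s (Z s)))
  (mth : forall i, measurable_fun setT (th i))
  (ZY : forall s, s \in `[0, t] -> [/\ `|Z s - Y s| <= kx * lam s, `|q s| <= 2^-1
     & Phi (Z s) = Phi (Y s) * (1 + q s)])
  (GB : forall i s, s \in `[0, t] -> act i s -> `|Phi (Y s)| < r ->
     dot (G (Z s)) (B i s) = (1 - lam s) * (1 + q s) * dot (G (Y s)) (f i s)).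

Let q0 s : s \in `[0, t] -> 0 < 1 + q s.
Proof. by move=> /ZY[_]; rewrite ler_norml => /andP[h _] _; lra. Qed.
Let kx0 : 0 <= kx. Proof. by rewrite divr_ge0 ?mulr_ge0 ?addr_ge0// ltW. Qed.
Let ZYlam s : s \in `[0, t] -> `|Z s - Y s| <= lam s.
Proof.
move=> st; have [h _ _] := ZY st; apply: (le_trans h); rewrite ler_piMl//; exact: ltW.
Qed.
Let Zrho s : s \in `[0, t] -> `|Z s| <= rho.
Proof.
move=> st; have h1 := ZYlam st; have h2 := lam_t st; have h3 := Yrho s; have h4 := lamt2.
have h5 : `|Z s| <= `|Z s - Y s| + `|Y s| by rewrite -{1}(subrK (Y s) (Z s)) ler_normD.
by move: h1 h2 h3 h4 h5; move: (lam s) (lam t) => u v; lra.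
Qed.
Let Yrho' s : `|Y s| <= rho. Proof. by have := Yrho s; lra. Qed.
(** The ratio [1 + q s] of [Phi (Z s)] to [Phi (Y s)] is positive. Hence the weights of [Y] used to
    drive [Z] are the weights of [Z] itself, and [Z] is a trajectory of the new data. *)
Let phaseZ s : s \in `[0, t] -> (forall i, Om i (Z s) <-> Om i (Y s)) /\ (H (Z s) <-> H (Y s)).
Proof.
move=> st; have [_ _ E] := ZY st.
exact: (same_phase HO W (St (Yrho' s)) (St (Zrho st)) (q0 st) E).
Qed.
Let wZ i s : s \in `[0, t] -> wt i (Z s) (mh s) = w i s.
Proof. by move=> st; have [h1 h2] := phaseZ st; exact: weight_same. Qed.
Let actZ i s : s \in `[0, t] -> act i s <-> closure (Om i) (Z s).
Proof. by move=> /phaseZ[h1 h2]; rewrite /act !(closure_phase HO) h1 h2. Qed.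
Let cZ : continuous Z. Proof. exact: lip_continuous ZL. Qed.
Let S i := `[0, t] `&` [set s | closure (Om i) (Z s)].
Let mSi i : measurable (S i). Proof. by apply: measurableI => //; exact: mS. Qed.
Let mlam : measurable_fun setT lam.
Proof.
apply: measurable_funM; first exact: measurable_cst.
apply: measurableT_comp; first exact: measurable_expR.
by apply: measurable_funM; [exact: measurable_cst|exact: measurable_id].
Qed.
Let m1B (h : R -> R) : measurable_fun setT h -> measurable_fun setT (fun s => 1 - h s).
Proof. by move=> mh'; apply: measurable_funB => //; exact: measurable_cst. Qed.
Let cost (be : forall i, R -> A i) i s := l' i (Z s) (tau s) (be i s).
Let mcost be i : bmeas (be i) -> measurable_fun (S i) (cost be i).
Proof.
move=> mbe; have ZS s : S i s -> closure (Om i) (Z s) by case.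
have [_ Cl] := side_cara L0 mlm (side' i) tauT tauL (mSi i) ZL ZS.
exact: (measurable_cara_comp (@cA i) (mSi i) Cl mbe).
Qed.
(** Target velocity and target cost use the same coefficients, so that convexity of the joint set of
    velocities and costs provides one control for both. *)
Let V i s := (1 - lam s) *: U i s (Z s) +
  lam s *: (th i s *: p i s (Z s) + (1 - th i s) *: n i s (Z s)).
Let v i s := (1 - lam s) * cost ah i s +
  lam s * (th i s * cost ap i s + (1 - th i s) * cost an i s).
Let mV i j : measurable_fun (S i) (fun s => V i s ord0 j).
Proof.
apply: measurable_funTS.
have -> : (fun s => V i s ord0 j) = (fun s => (1 - lam s) * U i s (Z s) ord0 j +
   lam s * (th i s * p i s (Z s) ord0 j + (1 - th i s) * n i s (Z s) ord0 j)).
  by apply/funext => s; rewrite !mxE.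
have [_ /(_ Z cZ) mU] := admU i j; have [_ /(_ Z cZ) mp] := admp i j.
have [_ /(_ Z cZ) mn] := admn i j.
apply: measurable_funD; apply: measurable_funM => //; first exact: m1B.
by apply: measurable_funD; apply: measurable_funM => //; exact: m1B.
Qed.
Let mv i : measurable_fun (S i) (v i).
Proof.
have mS1 (h : R -> R) : measurable_fun setT h -> measurable_fun (S i) h.
  by move=> ?; apply: measurable_funTS.
have m1 : measurable_fun (S i) (fun s => 1 - lam s) by exact: mS1 (m1B mlam).
have m2 : measurable_fun (S i) (fun s => 1 - th i s) by exact: mS1 (m1B (mth i)).
have m3 : measurable_fun (S i) (cost ah i) by apply: mcost; exact: mah.
have m4 : measurable_fun (S i) (cost ap i) by apply: mcost; exact: map.
have m5 : measurable_fun (S i) (cost an i) by apply: mcost; exact: man.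
have m6 := mS1 _ mlam; have m7 := mS1 _ (mth i).
apply: (measurable_funD (measurable_funM m1 m3)); apply: measurable_funM => //.
exact: measurable_funD (measurable_funM m7 m4) (measurable_funM m2 m5).
Qed.
Let lam1 s : s \in `[0, t] -> 0 <= 1 - lam s <= 1.
Proof.
move=> /lam_t h; have := lam_gt0 s; have := lamt2; move: h; move: (lam s) (lam t) => u' v'.
by move=> *; apply/andP; split; lra.
Qed.
(** Convexity is applied twice: to the two pushing controls with weight [th], then to the original
    control and the result with weight [1 - lam]. *)
Let select i : exists al', bmeas al' /\ forall s, S i s ->
  b' i (Z s) (tau s) (al' s) = V i s /\ l' i (Z s) (tau s) (al' s) = v i s.
Proof.
have [_ _ _ _ cv] := side' i.
apply: (side_select (@cA i) L0 mlm (side' i) tauT tauL (ah i 0) (mSi i) ZL) => //.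
  by move=> s [_ cz]; exact: cz.
move=> s [st cz]; have [th01 _] := BE i st.
have [e1 [b1E l1E]] := cv (Z s) (tau s) (ap i s) (an i s) (th i s) cz (tauT s) th01.
have [e2 [b2E l2E]] := cv (Z s) (tau s) (ah i s) e1 (1 - lam s) cz (tauT s) (lam1 st).
exists e2; rewrite b2E l2E b1E l1E /V /v /cost UE// pE// nE//.
by rewrite subKr.
Qed.

Lemma transfer_synchronised : exists (X' : R -> 'rV[R]_N) (al' : forall i, R -> A i) (m' : R -> R),
  let LT := lam0 * expR (K * T) in
  [/\ itraj Om1 Om2 H b' x t X' al' m',
      ({ae mu, forall s, s \in `]0, t[ -> H (X s) -> ireg n1 b (X s) (t - s) (al^~ s) (m s)} ->
       {ae mu, forall s, s \in `]0, t[ -> H (X' s) ->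
          ireg n1 b' (X' s) (t - s) (al'^~ s) (m' s)}),
      `|X' t - X t| <= (1 + M) * LT
    & \int[mu]_(s in `[0, t]) icost Om1 Om2 H l' (X' s) (t - s) (al'^~ s) (m' s) <=
      \int[mu]_(s in `[0, t]) icost Om1 Om2 H l (X s) (t - s) (al^~ s) (m s) +
      ((ml (nN * (2 * LT)) + err + LT * Ml) * T + Ml * LT)].
Proof.
have sel i : {al' : R -> A i | bmeas al' /\ forall s, S i s ->
    b' i (Z s) (tau s) (al' s) = V i s /\ l' i (Z s) (tau s) (al' s) = v i s}.
  by apply/cid; exact: select.
pose al' i := sval (sel i).
have mal' i : bmeas (al' i) by have [] := svalP (sel i).
have al'E i s : s \in `[0, t] -> act i s ->
    b' i (Z s) (t - s) (al' i s) = B i s /\ l' i (Z s) (t - s) (al' i s) = v i s.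
  move=> st /(actZ _ st) cz; have [_ /(_ s (conj st cz))] := svalP (sel i).
  by rewrite /tau clamp_id// => -[-> ->]; split => //; have [_ ->] := BE i st.
have oc s : s \in `]0, t[ -> s \in `[0, t].
  by rewrite !in_itv/= => /andP[/ltW-> /ltW->].
have rtE s : s \in `[0, t] -> rt s = clock K lam0 s by move=> st; rewrite /rt clamp_id.
have wact i s : w i s != 0 -> act i s by exact: (weight_closure HO).
have HX' : itraj Om1 Om2 H b' x t Z al' mh.
  split => //; first by exists CZ.
  apply: aeS Zd => s h st; have := h st; congr hasd; rewrite /ivel !wZ ?oc//.
  have e i : w i s *: B i s = w i s *: b' i (Z s) (t - s) (al' i s).
    have [->|w0] := eqVneq (w i s) 0; first by rewrite !scale0r.
    by have [->] := al'E i s (oc _ st) (wact _ _ w0).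
  by rewrite !e.
exists Z, al', mh; split => //.
- move=> reg; apply: aeS (ae_clock t0w lam00 K1 lamt2 reg) => s h st HZ.
  have sc := oc _ st; have [_ HE] := phaseZ sc.
  have HY : H (Y s) by apply/HE.
  have [_ _ E] := ZY sc.
  have act' i : act i s by apply/(closure_phase HO); right.
  have [_ _ /(_ HZ)[k k0 Gk]] := St (Zrho sc).
  have [_ _ /(_ HY)[k' k'0 Gk']] := St (Yrho' s).
  have [_ /(_ (Y s))[_ _ /(_ HY)[Phi0 _]]] := W.
  have nr : `|Phi (Y s)| < r by rewrite Phi0 normr0.
  have [|h1 h2 h3] := h st; first by rewrite -rtE.
  rewrite -rtE// in h1 h2 h3.
  (* One nonnegative factor serves both sides: it rescales both normal components, so tangency and
     the sign conditions carry over. *)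
  pose c := (1 - lam s) * (1 + q s) * k' / k.
  have c_ge0 : 0 <= c.
    have /andP[l1 _] := lam1 sc; have q1 := ltW (q0 sc).
    have h4 : 0 <= (1 - lam s) * (1 + q s) by exact: mulr_ge0.
    exact: divr_ge0 (mulr_ge0 h4 (ltW k'0)) (ltW k0).
  have dB i : dot (b' i (Z s) (t - s) (al' i s)) (n1 (Z s)) =
      c * dot (b i (Y s) (taur s) (ah i s)) (n1 (Y s)).
    have [-> _] := al'E i s sc (act' i).
    have := GB sc (act' i) nr; rewrite Gk Gk' !dotZl fE// => e.
    have kN : k != 0 by rewrite gt_eqF.
    apply: (mulfI kN); rewrite dotC e (dotC (b _ _ _ _)) /c.
    by move: (1 - lam s) (1 + q s) (dot _ _) => u1 u2 u3; field.
  split.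
  + move: h1; rewrite !dotDl !dotZl !dB => h1.
    have -> : forall u1 u2 u3 u4 : R, u1 * (c * u2) + u3 * (c * u4) = c * (u1 * u2 + u3 * u4).
      by move=> *; ring.
    by rewrite h1 mulr0.
  + by rewrite (dB true) mulr_ge0.
  + by rewrite (dB false) mulr_ge0_le0.
- have tt : t \in `[0, t] by rewrite in_itv/= lexx t0w.
  have /andP[l1 l2] := rt_lag tt.
  have h1 : `|Y t - X t| <= M * (t - rt t).
    by have := XM (rtI t) tt; rewrite distrC (distrC (rt t)) (ger0_norm l1) distrC.
  have h2 : lam t / K <= lam t.
    by rewrite ler_pdivrMr// ler_peMr// ltW.
  have h3 : M * (t - rt t) <= M * (lam0 * expR (K * T)).
    rewrite ler_wpM2l//; apply: (le_trans l2); exact: le_trans h2 lamt.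
  have h4 := ZYlam tt.
  rewrite -(subrKA (Y t)) (le_trans (ler_normD _ _))// mulrDl mul1r.
  apply: lerD; first exact: le_trans h4 lamt.
  exact: le_trans h1 h3.
have [F [mF FM FE]] := icost_measurable HO (@cA) L0 Ml0 mlm side t0w tT HX.
have [F' [mF' F'M F'E]] := icost_measurable HO (@cA) L0 Ml0 mlm side' t0w tT HX'.
set LT := lam0 * expR (K * T).
have LT0 : 0 <= LT by rewrite mulr_ge0 ?expR_ge0// ltW.
have [ml0 mln _] := mlm.
have ml_ge0 u0 : 0 <= u0 -> 0 <= ml u0 by move=> u00; rewrite -ml0; apply: mln.
(* The rate of the cost error: the modulus accounts for shifts in space and in time, each at most
   [LT], [err] for the change of data, and [LT * Ml] for the freed share. *)
set d := ml (nN * (2 * LT)) + err + LT * Ml.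
have d0 : 0 <= d.
  have nN0 : 0 <= nN by exact: ler0n.
  have e1 := ml_ge0 _ (mulr_ge0 nN0 (mulr_ge0 (ler0n _ 2) LT0)).
  exact: addr_ge0 (addr_ge0 e1 err0) (mulr_ge0 LT0 Ml0).
have Fd s : s \in `]0, t[ -> `|F' s - (1 - lam s) * F (clock K lam0 s)| <= d.
  move=> st; have sc := oc _ st; rewrite F'E// -rtE// FE//.
  rewrite /icost !wZ//.
  have term i : `|w i s * l' i (Z s) (t - s) (al' i s) -
      (1 - lam s) * (w i s * l i (Y s) (taur s) (ah i s))| <= w i s * d.
    have w0 : 0 <= w i s by exact: weight_ge0.
    have -> : w i s * l' i (Z s) (t - s) (al' i s) -
        (1 - lam s) * (w i s * l i (Y s) (taur s) (ah i s)) =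
      w i s * (l' i (Z s) (t - s) (al' i s) - (1 - lam s) * l i (Y s) (taur s) (ah i s)).
      by ring.
    rewrite normrM (ger0_norm w0).
    have [->|wn0] := eqVneq (w i s) 0; first by rewrite !mul0r.
    rewrite ler_wpM2l//; have ac := wact _ _ wn0.
    have [_ ->] := al'E i s sc ac; rewrite /v.
    have cz := (actZ i sc).1 ac; have sT := toT sc.
    have [b'M _ lL' _ _] := side' i.
    have l'M be : `|cost be i s| <= Ml by case: (b'M _ _ (be i s) cz (tauT s)).
    have h1 : `|cost ah i s - l i (Y s) (taur s) (ah i s)| <= ml (nN * (2 * LT)) + err.
      rewrite -(subrKA (l' i (Y s) (taur s) (ah i s))) (le_trans (ler_normD _ _))//.
      apply: lerD; last first.
        by rewrite distrC; case: (near_data (ah i s) (Yrho' s) ac (taurT s)).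
      apply: (le_trans (lL' _ _ _ _ _ cz ac (tauT s) (taurT s))).
      apply: mln; first by rewrite mulr_ge0// addr_ge0.
      rewrite ler_wpM2l//.
      have k1 : `|Z s - Y s| <= LT.
        by apply: (le_trans (ZYlam sc)); apply: (le_trans (lam_t sc)).
      have k2 : `|tau s - taur s| <= LT.
        have /andP[g1 g2] := rt_lag sc.
        have -> : tau s - taur s = - (s - rt s) by rewrite /tau /taur clamp_id//; ring.
        rewrite normrN ger0_norm//; apply: (le_trans g2).
        apply: (@le_trans _ _ (lam s)); first by rewrite ler_pdivrMr// ler_peMr// ltW.
        exact: le_trans (lam_t sc) lamt.
      by rewrite mulr2n mulrDl mul1r; exact: lerD.
    have [th01 _] := BE i sc.
    have h2 : `|th i s * cost ap i s + (1 - th i s) * cost an i s| <= Ml.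
      move: th01 => /andP[g1 g2].
      rewrite (le_trans (ler_normD _ _))// !normrM (ger0_norm g1) (ger0_norm (_ : 0 <= 1 - th i s)) ?subr_ge0//.
      apply: (@le_trans _ _ (th i s * Ml + (1 - th i s) * Ml)); last by rewrite -mulrDl addrC subrK mul1r.
      by apply: lerD; apply: ler_wpM2l; rewrite ?subr_ge0.
    have -> : forall u1 u2 u3 u4 : R, (1 - u1) * u2 + u1 * u3 - (1 - u1) * u4 =
        (1 - u1) * (u2 - u4) + u1 * u3 by move=> *; ring.
    have /andP[g1 g2] := lam1 sc; have g3 := ltW (lam_gt0 s).
    rewrite (le_trans (ler_normD _ _))// (normrM (1 - lam s)) (normrM (lam s)) (ger0_norm g1) (ger0_norm g3).
    apply: lerD.
      by apply: le_trans h1; rewrite ler_piMl.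
    apply: ler_pM => //; exact: le_trans (lam_t sc) lamt.
  apply: (@le_trans _ _ (w true s * d + w false s * d)); last first.
    by rewrite -mulrDl (weight_sum HO) mul1r.
  apply: le_trans (lerD (term true) (term false)).
  apply: le_trans (ler_normD _ _); rewrite le_eqVlt; apply/orP; left; apply/eqP.
  congr (`|_|); have gen : forall u1 u2 v1 v2 z1 z2 u : R, u1 * v1 + u2 * v2 - u * (u1 * z1 + u2 * z2) =
      u1 * v1 - u * (u1 * z1) + (u2 * v2 - u * (u2 * z2)) by move=> *; ring.
  exact: gen.
have := clock_cost t0 lam00 K1 lamt2 Ml0 mF mF' FM F'M Fd.
have e1 : \int[mu]_(s in `[0, t]) F s = \int[mu]_(s in `[0, t]) icost Om1 Om2 H l (X s) (t - s) (al^~ s) (m s).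
  by apply: eq_Rintegral => s /set_mem/= sc; exact: FE.
have e2 : \int[mu]_(s in `[0, t]) F' s = \int[mu]_(s in `[0, t]) icost Om1 Om2 H l' (Z s) (t - s) (al'^~ s) (mh s).
  by apply: eq_Rintegral => s /set_mem/= sc; exact: F'E.
rewrite e1 e2 => h; apply: (le_trans h); rewrite lerD2l; apply: lerD.
  by rewrite ler_wpM2l.
by rewrite ler_wpM2l.
Qed.

End Synchronised.

Lemma transfer : exists (X' : R -> 'rV[R]_N) (al' : forall i, R -> A i) (m' : R -> R),
  let LT := lam0 * expR (K * T) in
  [/\ itraj Om1 Om2 H b' x t X' al' m',
      ({ae mu, forall s, s \in `]0, t[ -> H (X s) -> ireg n1 b (X s) (t - s) (al^~ s) (m s)} ->
       {ae mu, forall s, s \in `]0, t[ -> H (X' s) ->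
          ireg n1 b' (X' s) (t - s) (al'^~ s) (m' s)}),
      `|X' t - X t| <= (1 + M) * LT
    & \int[mu]_(s in `[0, t]) icost Om1 Om2 H l' (X' s) (t - s) (al'^~ s) (m' s) <=
      \int[mu]_(s in `[0, t]) icost Om1 Om2 H l (X s) (t - s) (al^~ s) (m s) +
      ((ml (nN * (2 * LT)) + err + LT * Ml) * T + Ml * LT)].
Proof.
have [_ HPhi2 HG2 _] := HPhi.
have cPhi : continuous Phi.
  by apply: (@lip_continuous _ _ _ Phi Cg) => z z'; rewrite distrC (distrC z); exact: HPhi2.
have cG : continuous G.
  by apply: (@lip_continuous _ _ _ G Cg) => z z'; rewrite distrC (distrC z); exact: HG2.
have Yrho' s : `|Y s| <= rho by have := Yrho s; lra.
(* Pushing controls matter only on this set; elsewhere the selected ones are arbitrary. *)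
pose D i : set R := [set s | closure (Om i) (Y s)] `&` [set s | `|Phi (Y s)| < r].
have mD i : measurable (D i).
  apply: measurableI; first exact: mS.
  apply: open_measurable; apply: (@open_comp _ _ (fun s => `|Phi (Y s)|) [set z | z < r]).
    move=> s _; apply: cvg_norm; apply: (@continuous_comp _ _ _ Y Phi); [exact: cY|exact: cPhi].
  exact: open_lt.
have mGY j : measurable_fun setT (fun s => G (Y s) ord0 j).
  apply: continuous_measurable_fun; apply: (@lip_continuous _ _ _ _ (Cg * M)) => s s'.
  have -> : G (Y s) ord0 j - G (Y s') ord0 j = (G (Y s) - G (Y s')) ord0 j by rewrite !mxE.
  apply: (le_trans (coord_le_norm _ _)); rewrite distrC.
  apply: (le_trans (HG2 _ _ I I)); rewrite -mulrA ler_wpM2l// distrC; exact: YM.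
have DY i s : D i s -> closure (Om i) (Y s) by case.
have selp i : {be : R -> A i | bmeas be /\ forall s, D i s ->
    c0 <= dot (G (Y s)) (b' i (Y s) (tau s) (be s))}.
  apply/cid.
  apply: (side_select_dot (@cA i) L0 mlm (side' i) tauT tauL (ah i 0) (mD i) YM (@DY i)).
    by move=> j; apply: measurable_funTS; exact: mGY.
  by move=> s [cY' Pr]; have [] := ctrl (Yrho' s) Pr cY' (tauT s).
have seln i : {be : R -> A i | bmeas be /\ forall s, D i s ->
    c0 <= dot (- G (Y s)) (b' i (Y s) (tau s) (be s))}.
  apply/cid.
  apply: (side_select_dot (g := fun s => - G (Y s)) (@cA i) L0 mlm (side' i) tauT tauL
    (ah i 0) (mD i) YM (@DY i)).
    move=> j; apply: measurable_funTS.
    have -> : (fun s => (- G (Y s)) ord0 j) = (fun s => - G (Y s) ord0 j).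
      by apply/funext => s; rewrite mxE.
    exact: measurableT_comp.
  by move=> s [cY' Pr]; have [] := ctrl (Yrho' s) Pr cY' (tauT s).
pose ap i := sval (selp i); pose an i := sval (seln i).
have map i : bmeas (ap i) by have [] := svalP (selp i).
have man i : bmeas (an i) by have [] := svalP (seln i).
have field i (be : R -> A i) : bmeas be -> exists U : R -> 'rV[R]_N -> 'rV[R]_N,
  [/\ (forall j, admissible t (fun s z => U s z ord0 j)), (forall s z, `|U s z| <= M),
      (forall s z z', `|U s z - U s z'| <= L * `|z - z'|)
    & forall s z, closure (Om i) z -> U s z = b' i z (tau s) (be s)].
  exact: (ext_field (@cA i) M0 L0 mlm (side' i) tauT tauL t).
have [U UP] := choice (fun i => field i _ (@mah i)).
have [p pP] := choice (fun i => field i _ (@map i)).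
have [n nP] := choice (fun i => field i _ (@man i)).
have /choice[f0 fP] : forall i : bool, exists U' : R -> 'rV[R]_N -> 'rV[R]_N,
  [/\ (forall j, admissible t (fun s z => U' s z ord0 j)), (forall s z, `|U' s z| <= M),
      (forall s z z', `|U' s z - U' s z'| <= L * `|z - z'|)
    & forall s z, closure (Om i) z -> U' s z = b i z (taur s) (ah i s)].
  move=> i; apply: (ext_field (@cA i) M0 L0 mlm (side i) taurT taurL t); exact: mah.
pose f i s := f0 i s (Y s).
have fE i s : s \in `[0, t] -> act i s -> f i s = b i (Y s) (taur s) (ah i s).
  by move=> _ ac; have [_ _ _] := fP i; apply.
have wact i s : s \in `[0, t] -> w i s != 0 -> act i s by move=> _; exact: (weight_closure HO).
(* Half of [a] pays for the time shift through [KL], the other half for the change of data through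
   [errl]. *)
have uf i s : s \in `[0, t] -> act i s -> `|U i s (Y s) - f i s| <= a * lam s.
  move=> st ac; rewrite fE//; have [_ _ _ ->//] := UP i.
  rewrite -(subrKA (b' i (Y s) (taur s) (ah i s))) (le_trans (ler_normD _ _))//.
  have [_ bL _ _ _] := side' i.
  have h1 := bL (Y s) (Y s) (tau s) (taur s) (ah i s) ac ac (tauT s) (taurT s).
  have [h2 _] := near_data (ah i s) (Yrho' s) ac (taurT s).
  have /andP[g1 g2] := rt_lag st.
  have h3 : `|tau s - taur s| <= lam s / K.
    have -> : tau s - taur s = - (s - rt s) by rewrite /tau /taur clamp_id//; ring.
    by rewrite normrN ger0_norm.
  have h4 : L * `|tau s - taur s| <= a / 2 * lam s.
    apply: (@le_trans _ _ (K * (a / 2) * (lam s / K))); first exact: ler_pM.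
    by move: (lam s) => u1; rewrite le_eqVlt; apply/orP; left; apply/eqP; field; rewrite gt_eqF.
  rewrite subrr normr0 add0r in h1; rewrite distrC in h2.
  have h5 : lam0 * (a / 2) <= a / 2 * lam s.
    by rewrite mulrC ler_wpM2l ?lam_ge// divr_ge0// ltW.
  have h6 := le_trans h1 h4; have h7 := le_trans (le_trans h2 errl) h5.
  have -> : a * lam s = a / 2 * lam s + a / 2 * lam s by move: (lam s) => u1; field.
  exact: lerD.
have ctrl' i s : s \in `[0, t] -> act i s -> `|Phi (Y s)| < r ->
    c0 <= dot (G (Y s)) (p i s (Y s)) /\ dot (G (Y s)) (n i s (Y s)) <= - c0.
  move=> st ac Pr; have [_ _ _ pE] := pP i; have [_ _ _ nE] := nP i.
  rewrite pE// nE//; have [_ /(_ s (conj ac Pr)) h1] := svalP (selp i).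
  have [_ /(_ s (conj ac Pr)) h2] := svalP (seln i).
  by rewrite dotNl lerNr in h2.
have wge0 i s : s \in `[0, t] -> 0 <= w i s by move=> _; exact: weight_ge0.
have wsum s : s \in `[0, t] -> w true s + w false s = 1 by move=> _; exact: (weight_sum HO).
have mw i : measurable_fun setT (w i) by exact: (measurable_weight HO).
have mf i j : measurable_fun setT (fun s => f i s ord0 j).
  by have [/(_ j)[_ h] _ _ _] := fP i; exact: h _ cY.
have [Z [q [B [th [Z0 [CZ ZL] Zd BE [mth ZY GB]]]]]] := @tracking R N t K lam0 M L Cg r c0 a
  Phi G U p n f w Y M act t0w lam00 K0 M0 L0 Cg0 r0 c00 (ltW a0) a1 lamt2 HPhi
  (fun i => let: And4 h _ _ _ := UP i in h) (fun i => let: And4 h _ _ _ := pP i in h)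
  (fun i => let: And4 h _ _ _ := nP i in h)
  (fun i s z _ => let: And4 _ h _ _ := UP i in h s z)
  (fun i s z _ => let: And4 _ h _ _ := pP i in h s z)
  (fun i s z _ => let: And4 _ h _ _ := nP i in h s z)
  (fun i s _ => let: And4 _ h _ _ := fP i in h s (Y s))
  (fun i s z z' _ => let: And4 _ _ h _ := UP i in h s z z')
  (fun i s z z' _ => let: And4 _ _ h _ := pP i in h s z z')
  (fun i s z z' _ => let: And4 _ _ h _ := nP i in h s z z')
  mf mw wge0 wsum YM (Yder fE) wact uf ctrl' HK1 HK1' HK2 HK3.
have Z0x : Z 0 = x by rewrite Z0 /Y rt0 X0.
apply: (@transfer_synchronised U p n f ap an Z q B th CZ) => //.
- exact: (fun i => let: And4 h _ _ _ := UP i in h).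
- exact: (fun i => let: And4 h _ _ _ := pP i in h).
- exact: (fun i => let: And4 h _ _ _ := nP i in h).
- exact: (fun i => let: And4 _ _ _ h := UP i in h).
- exact: (fun i => let: And4 _ _ _ h := pP i in h).
- exact: (fun i => let: And4 _ _ _ h := nP i in h).
Qed.

End TransferTheorem.

(** * Limit data and controllability near the interface *)

Lemma uniform_dist (R : realType) (U : choiceType) (V : normedModType R) (K : set U)
    (F : R -> U -> V) (f : U -> V) :
  {uniform K, F @ 0^'+ --> f} -> forall c : R, 0 < c ->
  \forall e \near 0^'+, forall y, K y -> `|f y - F e y| < c.
Proof.
move=> H c c0.
apply: (H [set h | forall y, K y -> `|f y - h y| < c]); apply/uniform_nbhs.
exists [set xy : V * V | ball xy.1 c xy.2]; split; last first.
  by move=> h /= hK y Ky; have := hK y Ky; rewrite -ball_normE.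
exact: (@entourage_ball R V (PosNum c0)).
Qed.

Section LimitData.
Context {R : realType} (N : nat) (A : metricType R).
Variables (Om : set 'rV[R]_N) (T M L Ml : R) (ml : R -> R).
Variables (be : R -> 'rV[R]_N -> R -> A -> 'rV[R]_N) (le : R -> 'rV[R]_N -> R -> A -> R)
  (b : 'rV[R]_N -> R -> A -> 'rV[R]_N) (l : 'rV[R]_N -> R -> A -> R).
Hypothesis cA : compact [set: A].
Hypothesis side : forall e, 0 < e -> side_ok Om T M L Ml ml (be e) (le e).
Hypotheses (cvb : loc_unif_cvg Om T be b) (cvl : loc_unif_cvg Om T (V := R^o) le l).

Lemma data_near (K : set 'rV[R]_N) : compact K -> K `<=` closure Om -> forall c : R, 0 < c ->
  \forall e \near 0^'+, forall z s al, K z -> s \in `[0, T] ->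
    `|b z s al - be e z s al| < c /\ `|l z s al - le e z s al| < c.
Proof.
move=> cK KO c c0; have h1 := uniform_dist (cvb cK KO) c0.
have h2 := uniform_dist (cvl cK KO) c0.
apply: filterS2 h1 h2 => e h1 h2 z s al Kz sT.
have KT : ((K `*` `[0, T]%classic) `*` [set: A]) (z, s, al) by [].
by split; [exact: (h1 _ KT)|exact: (h2 _ KT)].
Qed.

Let approx z z' (c : R) : closure Om z -> closure Om z' -> 0 < c ->
  exists2 e : R, 0 < e & forall s al, s \in `[0, T] ->
    [/\ `|b z s al - be e z s al| < c, `|l z s al - le e z s al| < c,
        `|b z' s al - be e z' s al| < c & `|l z' s al - le e z' s al| < c].
Proof.
move=> cz cz' c0.
have cK : compact [set z; z'] by apply: compactU; exact: compact_set1.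
have KO : [set z; z'] `<=` closure Om by move=> y [->|->].
have H : \forall e \near (0 : R)^'+, 0 < e by exact: nbhs_right_gt.
have [e [e0 h]] := filter_ex (filterI H (data_near cK KO c0)).
exists e => // s al sT.
by have [h1 h2] := h z s al (or_introl erefl) sT; have [h3 h4] := h z' s al (or_intror erefl) sT.
Qed.

(** Bounds and moduli pass to the limit pointwise, continuity in the control by uniformity. For
    convexity the controls given by the approximations may fail to converge; they solve the equation
    of the limit up to any error, and [compact_inf0] turns this into an exact solution. *)
Lemma side_ok_limit : side_ok Om T M L Ml ml b l.
Proof.
have tri (V : normedModType R) (u v u' v' : V) (c B : R) : `|u - u'| < c -> `|v - v'| < c ->
    `|u' - v'| <= B -> `|u - v| <= B + c + c.
  move=> h1 h2 h3.
  rewrite -(subrKA u') (le_trans (ler_normD _ _))// -(subrKA v' u').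
  have := ler_normD (u' - v') (v' - v); rewrite (distrC v') => h4.
  by move: h1 h2 h3 h4; lra.
have lim (x B : R) : (forall c, 0 < c -> x <= B + c + c) -> x <= B.
  move=> h; apply/ler_addgt0Pr => c c0; rewrite (splitr c) addrA; apply: h.
  by rewrite divr_gt0.
have bnd (V : normedModType R) (u u' : V) (c B : R) : 0 < c -> `|u - u'| < c -> `|u'| <= B ->
    `|u| <= B + c + c.
  by move=> c0 h1 h2; rewrite -(subr0 u); apply: (tri _ _ _ u' 0); rewrite ?subr0 ?normr0.
have cont z s : closure Om z -> s \in `[0, T] -> continuous (b z s) /\ continuous (l z s).
  move=> cz sT; split => al; apply/cvgrPdist_le => c c0; have c3 : 0 < c / 3 by rewrite divr_gt0.
    have [e e0 h] := approx cz cz c3; have [_ _ _ cb _] := side e0; have [g1 _] := cb z s cz sT.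
    have /cvgrPdist_le/(_ _ c3) := g1 al; apply: filterS => al' g.
    have [h1 _ _ _] := h s al sT; have [h2 _ _ _] := h s al' sT.
    by apply: (le_trans (tri _ _ _ _ _ _ _ h1 h2 g)); lra.
  have [e e0 h] := approx cz cz c3; have [_ _ _ cb _] := side e0; have [_ g1] := cb z s cz sT.
  have /cvgrPdist_le/(_ _ c3) := g1 al; apply: filterS => al' g.
  have [_ h1 _ _] := h s al sT; have [_ h2 _ _] := h s al' sT.
  by apply: (le_trans (tri _ _ _ _ _ _ _ h1 h2 g)); lra.
split => //.
- move=> z s al cz sT; split; apply: lim => c c0; have [e e0 /(_ s al sT)[h1 h2 _ _]] := approx cz cz c0;
    have [/(_ z s al cz sT)[g1 g2] _ _ _ _] := side e0; first exact: bnd c0 h1 g1.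
  exact: bnd c0 h2 g2.
- move=> z z' s s' al cz cz' sT sT'; apply: lim => c c0.
  have [e e0 h] := approx cz cz' c0; have [h1 _ _ _] := h s al sT; have [_ _ h2 _] := h s' al sT'.
  by have [_ g _ _ _] := side e0; exact: tri h1 h2 (g _ _ _ _ _ cz cz' sT sT').
- move=> z z' s s' al cz cz' sT sT'; apply: lim => c c0.
  have [e e0 h] := approx cz cz' c0; have [_ h1 _ _] := h s al sT; have [_ _ _ h2] := h s' al sT'.
  by have [_ _ g _ _] := side e0; exact: (tri _ _ _ _ _ _ _ h1 h2 (g _ _ _ _ _ cz cz' sT sT')).
- move=> z s al al' th cz sT th01; have [cb cl] := cont z s cz sT.
  set v := th *: b z s al + (1 - th) *: b z s al'.
  set c := th * l z s al + (1 - th) * l z s al'.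
  have mix (V : normedModType R) (u u' w w' : V) (d : R) : `|u - u'| < d -> `|w - w'| < d ->
      `|(th *: u' + (1 - th) *: w') - (th *: u + (1 - th) *: w)| <= d.
    move=> h1 h2; rewrite opprD addrACA -!scalerBr; move: (th01) => /andP[t0 t1].
    rewrite (le_trans (ler_normD _ _))// !normrZ (ger0_norm t0) ger0_norm ?subr_ge0//.
    rewrite (_ : d = th * d + (1 - th) * d); last by ring.
    by apply: lerD; apply: ler_wpM2l; rewrite ?subr_ge0// distrC ltW.
  have [||a /eqP] := @compact_inf0 R A cA (fun a => `|b z s a - v| + `|l z s a - c|).
  + move=> a; apply: cvgD; apply: cvg_norm; apply: cvgB; try exact: cvg_cst.
      exact: cb.
    exact: cl.
  (* Velocity and cost each lose two errors [d / 5], so the total stays strictly below [d]. *)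
  + move=> d d0; have d5 : 0 < d / 5 by rewrite divr_gt0.
    have [e e0 h] := approx cz cz d5; have [_ _ _ _ cv] := side e0.
    have [a [bE lE]] := cv z s al al' th cz sT th01; exists a.
    have [h1 h2 _ _] := h s a sT; have [h3 h4 _ _] := h s al sT; have [h5 h6 _ _] := h s al' sT.
    have g1 := mix _ _ _ _ _ _ h3 h5; have g2 := mix R^o _ _ _ _ _ h4 h6.
    rewrite -bE -/v in g1; rewrite -[_ *: _ + _ in X in X - _]lE -/c in g2.
    have k1 : `|b z s a - v| <= d / 5 + d / 5.
      by rewrite -(subrKA (be e z s a)) (le_trans (ler_normD _ _))// lerD// ltW.
    have k2 : `|l z s a - c| <= d / 5 + d / 5.
      by rewrite -(subrKA (le e z s a)) (le_trans (ler_normD _ _))// lerD// ltW.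
    by rewrite ger0_norm ?addr_ge0//; lra.
  rewrite paddr_eq0// !normr_eq0 !subr_eq0 => /andP[/eqP <- /eqP <-].
  by exists a.
Qed.

End LimitData.

Lemma compact_norm_le (R : realType) n (rho : R) : compact [set z : 'rV[R]_n | `|z| <= rho].
Proof.
apply: bounded_closed_compact.
  exists rho; split; first exact: num_real.
  by move=> x rx z /= zr; apply: (le_trans zr); exact: ltW.
apply: (@closed_comp _ _ (fun z : 'rV[R]_n => `|z|) [set y | y <= rho]); last exact: closed_le.
by move=> z _; exact: norm_continuous.
Qed.

(** * Normal controllability near the interface *)

Section Control.
Context {R : realType} (N : nat) (A : bool -> metricType R).
Variables (Om1 Om2 H : set 'rV[R]_N) (n1 : 'rV[R]_N -> 'rV[R]_N).
Hypothesis HO : H_Omega Om1 Om2 H.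
Local Notation Om := (phase Om1 Om2).
Variables (T M L Ml : R) (ml : R -> R) (b : forall i, 'rV[R]_N -> R -> A i -> 'rV[R]_N)
  (l : forall i, 'rV[R]_N -> R -> A i -> R).
Arguments b : clear implicits.
Arguments l : clear implicits.
Variables (Phi : 'rV[R]_N -> R) (G : 'rV[R]_N -> 'rV[R]_N) (Cg rho delta : R).
Hypotheses (M0 : 0 <= M) (L0 : 0 <= L) (Cg0 : 0 <= Cg) (delta0 : 0 < delta).
Hypothesis side : forall i, side_ok (Om i) T M L Ml ml (b i) (l i).
Hypothesis HPhi : C11on setT Phi G Cg.
Hypothesis St : forall z, `|z| <= rho -> strict_at Om1 Om2 H n1 Phi G z.
Hypothesis C4 : forall i z s, H z -> s \in `[0, T] ->
  (exists al, dot (b i z s al) (n1 z) = delta) /\ (exists al, dot (b i z s al) (n1 z) = - delta).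

Let controlled i z s (c : R) := (exists al, c <= dot (G z) (b i z s al)) /\
                                (exists al, c <= dot (- G z) (b i z s al)).

(** Where [Phi z0] is nonzero, a small [r] excludes [Phi z] from the range considered. On the
    interface (C4) gives normal speed [k * delta], and the continuity of [G] and [b] keeps half of
    it nearby. The same [r] measures the width of the strip and the strength of the push. *)
Let local_control z0 : `|z0| <= rho -> \forall z \near z0 & r \near (0 : R)^'+,
  forall i s, `|Phi z| < r -> closure (Om i) z -> s \in `[0, T] -> controlled i z s r.
Proof.
move=> z0rho; have [_ PL GL _] := HPhi; have [GC _ _ _] := HPhi.
have [S1 S2 S3] := St z0rho.
have ball0 (d : R) : 0 < d -> \forall z \near z0, `|z - z0| < d.
  by move=> d0; have := nbhsx_ballx z0 d d0; apply: filterS => z; rewrite -ball_normE/= distrC.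
have rlt (d : R) : 0 < d -> \forall r \near (0 : R)^'+, r < d.
  by move=> d0; exact: nbhs_right_lt.
have [P0|P0] := eqVneq (Phi z0) 0; last first.
  have p0 : 0 < `|Phi z0| by rewrite normr_gt0.
  have C1 : 0 < 2 * (Cg + 1) by rewrite mulr_gt0// ltr_wpDl.
  have hz := ball0 _ (divr_gt0 p0 C1); have hr := rlt _ (divr_gt0 p0 (ltr0Sn R 1)).
  exists ([set z | `|z - z0| < `|Phi z0| / (2 * (Cg + 1))], [set r | r < `|Phi z0| / 2]) => //=.
  move=> [z r] /= [zz rr] i s Pr; exfalso.
  have h1 := PL z0 z I I; move: zz; rewrite ltr_pdivlMr// => zz.
  have h2 : `|Phi z0| <= `|Phi z - Phi z0| + `|Phi z|.
    by rewrite distrC -{1}(subrK (Phi z) (Phi z0)) ler_normD.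
  have h3 : `|z - z0| * (2 * (Cg + 1)) = 2 * (Cg * `|z - z0|) + 2 * `|z - z0| by ring.
  have h4 := normr_ge0 (z - z0).
  by move: h1 h2 h3 h4 zz Pr rr; lra.
have Hz0 : H z0.
  by have [/S1|/S2|//] := Omega_cover HO z0; rewrite P0 ltxx.
have [k k0 Gk] := S3 Hz0; set c := k * delta; have c0 : 0 < c by exact: mulr_gt0.
pose D := N%:R * Cg * (M + L); have D0 : 0 <= D by rewrite !mulr_ge0// addr_ge0.
have D1 : 0 < 2 * (D + 1) by rewrite mulr_gt0// ltr_wpDl.
have hz := ball0 _ (divr_gt0 c0 D1); have hr := rlt _ (divr_gt0 c0 (ltr0Sn R 1)).
exists ([set z | `|z - z0| < c / (2 * (D + 1))], [set r | r < c / 2]) => //=.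
move=> [z r] /= [zz rr] i s _ cz sT.
have [bM bL _ _ _] := side i.
have cz0 : closure (Om i) z0 by apply/(closure_phase HO); right.
have near_dot al : `|dot (G z) (b i z s al) - dot (G z0) (b i z0 s al)| <= c / 2.
  have -> : dot (G z) (b i z s al) - dot (G z0) (b i z0 s al) =
     dot (G z - G z0) (b i z s al) + dot (G z0) (b i z s al - b i z0 s al).
    by rewrite dotBl dotBr addrA subrK.
  have h1 : `|dot (G z - G z0) (b i z s al)| <= N%:R * ((Cg * `|z - z0|) * M).
    apply: (le_trans (dot_norm _ _)); rewrite ler_wpM2l//; apply: ler_pM => //; first exact: GL.
    by case: (bM z s al cz sT).
  have h2 : `|dot (G z0) (b i z s al - b i z0 s al)| <= N%:R * (Cg * (L * `|z - z0|)).
    apply: (le_trans (dot_norm _ _)); rewrite ler_wpM2l//; apply: ler_pM => //.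
      by case: (GC z0 I).
    by have := bL z z0 s s al cz cz0 sT sT; rewrite subrr normr0 addr0.
  apply: (le_trans (ler_normD _ _)); apply: (le_trans (lerD h1 h2)).
  have -> : N%:R * ((Cg * `|z - z0|) * M) + N%:R * (Cg * (L * `|z - z0|)) = D * `|z - z0|.
    by rewrite /D; ring.
  move: zz; rewrite ltr_pdivlMr// => zz; have h4 := normr_ge0 (z - z0).
  have h3 : `|z - z0| * (2 * (D + 1)) = 2 * (D * `|z - z0|) + 2 * `|z - z0| by ring.
  by move: zz; rewrite h3; move: (D * _) h4 => u1; lra.
have [[a1 e1] [a2 e2]] := @C4 i z0 s Hz0 sT.
split; [exists a1|exists a2].
  have := near_dot a1; rewrite Gk dotZl dotC (dotC (n1 z0)) e1 -/c ler_norml => /andP[h _].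
  by rewrite dotC; move: h rr; rewrite dotC; lra.
have := near_dot a2; rewrite Gk dotZl (dotC (n1 z0)) e2 mulrN -/c ler_norml dotNl => /andP[_ h].
by move: h rr; lra.
Qed.

Lemma control_near : exists2 r : R, 0 < r & forall i z s, `|z| <= rho -> `|Phi z| < r ->
  closure (Om i) z -> s \in `[0, T] ->
  (exists al, r <= dot (G z) (b i z s al)) /\ (exists al, r <= dot (- G z) (b i z s al)).
Proof.
have cB := @compact_norm_le R N rho.
have H0 : \forall r \near (0 : R)^'+, 0 < r by exact: nbhs_right_gt.
have FF : Filter (0 : R)^'+ by exact: _.
have h1 := (compact_near_coveringP _).1 cB R _ (fun r z => forall i s, `|Phi z| < r ->
  closure (Om i) z -> s \in `[0, T] -> controlled i z s r) FF local_control.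
near (0 : R)^'+ => r; exists r; first by near: r.
move=> i z s zr Pr cz sT.
have h : [set z : 'rV[R]_N | `|z| <= rho] `<=` (fun z => forall i s, `|Phi z| < r ->
  closure (Om i) z -> s \in `[0, T] -> controlled i z s r) by near: r; exact: h1.
exact: h.
Unshelve. all: by end_near. Qed.

End Control.

(** * Value functions *)

Section Conversion.
Context {R : realType} (N : nat) (A1 A2 : metricType R).
Notation mu := (@lebesgue_measure R).
Implicit Types (D : control_data N A1 A2) (z x : 'rV[R]_N).

(** Both control sets form one family indexed by booleans, so that each one-sided estimate is stated
    once. *)
Definition two (i : bool) : metricType R := if i then A1 else A2.

Definition bside D (i : bool) : 'rV[R]_N -> R -> two i -> 'rV[R]_N :=
  match i with true => b1 D | false => b2 D end.

Definition lside D (i : bool) : 'rV[R]_N -> R -> two i -> R :=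
  match i with true => l1 D | false => l2 D end.

Definition pack (a1 : A1) (a2 : A2) (i : bool) : two i :=
  match i with true => a1 | false => a2 end.

Variables (Om1 Om2 H : set 'rV[R]_N) (n1 n2 : 'rV[R]_N -> 'rV[R]_N).
Hypothesis HO : H_Omega Om1 Om2 H.

Lemma ivelE D z s (al : forall i, two i) m :
  ivel Om1 Om2 H (bside D) z s al m = velocity Om1 Om2 H D z s (al true, al false, m).
Proof.
rewrite /ivel /velocity /bH /weight/= scalerDr !scalerA !scalerDl.
by rewrite addrACA.
Qed.

Lemma icostE D z s (al : forall i, two i) m :
  icost Om1 Om2 H (lside D) z s al m = running_cost Om1 Om2 H D z s (al true, al false, m).
Proof. by rewrite /icost /running_cost /lH /weight/=; ring. Qed.

Lemma iregE D z s (al : forall i, two i) m : n2 z = - n1 z -> 0 <= m <= 1 ->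
  ireg n1 (bside D) z s al m <-> A0reg n1 n2 D z s (al true, al false, m).
Proof.
move=> n12 m01; rewrite /ireg /A0reg /= /Aset/= /bH/= n12 dotNr oppr_ge0.
by split=> [[? ? ?]|[_ ? ? ?]].
Qed.

(** Measurability of the given control is known inside []0, T[] only; outside, it is replaced by its
    value at the midpoint. *)
Lemma control_components T (c : R -> control A1 A2) : 0 < T -> Linfty_control T c ->
  exists (al : forall i, R -> two i) (m : R -> R),
  [/\ (forall i, bmeas (al i)), measurable_fun setT m, (forall s, 0 <= m s <= 1)
    & forall s, s \in `]0, T[ -> (al true s, al false s, m s) = c s].
Proof.
move=> T0 [cA mc]; pose s0 := T / 2.
have s0T : s0 \in `]0, T[.
  by rewrite in_itv/= divr_gt0//= ltr_pdivrMr// ltr_pMr// ltr1n.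
pose cn s := if s \in `]0, T[ then c s else c s0.
have mcn U : open U -> measurable (cn @^-1` U).
  move=> oU.
  have -> : cn @^-1` U = (`]0, T[%classic `&` c @^-1` U) `|`
      (~` `]0, T[%classic `&` [set _ | U (c s0)]).
    apply/seteqP; split => s /=; rewrite /cn /=.
      by case: ifPn => sT Us; [left|right; split => //; exact/negP].
    by case: ifPn => [sT [[_ //]|[]//]|sT [[sT']|[]//]]; rewrite sT' in sT.
  apply: measurableU; first exact: mc.
  apply: measurableI; first by apply: measurableC; exact: measurable_itv.
  have [Us|Us] := pselect (U (c s0)).
    by rewrite (_ : [set _ | _] = setT)//; apply/seteqP; split.
  by rewrite (_ : [set _ | _] = set0)//; apply/seteqP; split.
have cnA s : Aset (cn s).
  by rewrite /cn; case: ifPn => sT; exact: cA.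
exists (fun i s => pack (cn s).1.1 (cn s).1.2 i), (fun s => (cn s).2); split.
- move=> [] U oU.
    apply: (mcn ((fun a : A1 * A2 * R => a.1.1) @^-1` U)); apply: open_comp => // p _.
    by apply: (@continuous_comp _ _ _ fst fst); exact: cvg_fst.
  apply: (mcn ((fun a : A1 * A2 * R => a.1.2) @^-1` U)); apply: open_comp => // p _.
  by apply: (@continuous_comp _ _ _ fst snd); [exact: cvg_fst|exact: cvg_snd].
- apply: (measurability _ (RGenOInfty.measurableE R)) => _ [_ [y ->] <-].
  rewrite setTI; apply: (mcn [set a : A1 * A2 * R | `]y, +oo[%classic a.2]).
  apply: (@open_comp _ _ snd); last exact: interval_open.
  by move=> p _; exact: cvg_snd.
- exact: cnA.
- by move=> s sT /=; rewrite /cn sT; case: (c s) => [[]].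
Qed.

(** An open set of the product is a union of boxes centred on dense sequences and on rationals;
    these are countably many, so measurability of the components suffices. *)
Lemma components_control T (al : forall i, R -> two i) (m : R -> R) :
  compact [set: A1] -> compact [set: A2] ->
  (forall i, bmeas (al i)) -> measurable_fun setT m -> (forall s, 0 <= m s <= 1) ->
  Linfty_control T (fun s => (al true s, al false s, m s) : control A1 A2).
Proof.
move=> cA1 cA2 mal mm m01; split=> [s _|U oU]; first exact: m01.
apply: measurableI => //.
have [u1 u1P] := compact_dense_seq cA1 (al true 0 : A1).
have [u2 u2P] := compact_dense_seq cA2 (al false 0 : A2).
pose k0 (k : nat) : nat * nat * rat := odflt (0%N, 0%N, 0%Q) (unpickle k).
pose r_ (n : nat) : R := n.+1%:R^-1.
pose box n k : set (A1 * A2 * R) := [set a | [/\ mdist (u1 (k0 k).1.1) a.1.1 < r_ n,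
   mdist (u2 (k0 k).1.2) a.1.2 < r_ n & `|ratr (k0 k).2 - a.2| < r_ n]].
pose cb n k : set R := [set s | mdist (u1 (k0 k).1.1) (al true s) < r_ n] `&`
   [set s | mdist (u2 (k0 k).1.2) (al false s) < r_ n] `&`
   [set s | `|ratr (k0 k).2 - m s| < r_ n].
rewrite (_ : _ @^-1` U = \bigcup_n \bigcup_(k in [set k | box n k `<=` U]) cb n k).
  apply: bigcupT_measurable => n; apply: bigcup_measurable => k _.
  apply: measurableI; first apply: measurableI.
  - exact: (mal true _ (@mdist_open _ A1 (u1 (k0 k).1.1) (r_ n))).
  - exact: (mal false _ (@mdist_open _ A2 (u2 (k0 k).1.2) (r_ n))).
  - have := mm measurableT _ (open_measurable (@ball_open R R (ratr (k0 k).2) (r_ n))).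
    by rewrite setTI.
apply/seteqP; split => [s /= Us|s [n _ [k kU [[h1 h2] h3]]]]; last exact: kU.
have [[P12 P3] /= [[[P1 P2] /= [n1' n2'] sub12] n3'] sub] : nbhs (al true s, al false s, m s) U.
  exact: open_nbhs_nbhs.
have /nbhs_ballP[e1 /= e10 e1P] := n1'; have /nbhs_ballP[e2 /= e20 e2P] := n2'.
have /nbhs_ballP[e3 /= e30 e3P] := n3'.
have [n nP] : exists n, r_ n < Num.min (Num.min e1 e2) e3 / 2.
  by apply: natSinv_lt; rewrite divr_gt0// !lt_min e10 e20.
have {}nP : r_ n + r_ n < Num.min (Num.min e1 e2) e3 by rewrite [ltRHS]splitr ltrD.
rewrite !lt_min -andbA in nP; have /and3P[g1 g2 g3] := nP.
have r0 : 0 < r_ n by rewrite invr_gt0.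
have [k1 k1P] := u1P (al true s) _ r0; have [k2 k2P] := u2P (al false s) _ r0.
have [q] := @rat_in_itvoo R (m s - r_ n) (m s + r_ n) (ltac:(by lra)).
rewrite in_itv/= => /andP[q1 q2].
have kE : k0 (pickle (k1, k2, q)) = (k1, k2, q) by rewrite /k0 pickleK.
exists n => //; exists (pickle (k1, k2, q)); last first.
  rewrite /cb kE/=; split; first by split; rewrite /= metric_sym.
  by rewrite /= ltr_norml; apply/andP; split; lra.
move=> [[y1 y2] y3]; rewrite /box kE/= => -[d1 d2 d3]; apply: (sub ((y1, y2), y3)).
split => /=; first apply: (sub12 (y1, y2)); first split => /=.
- apply: e1P; rewrite ballEmdist/=; apply: (le_lt_trans (metric_triangle _ (u1 k1) _)).
  by apply: lt_trans g1; exact: ltrD.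
- apply: e2P; rewrite ballEmdist/=; apply: (le_lt_trans (metric_triangle _ (u2 k2) _)).
  by apply: lt_trans g2; exact: ltrD.
- apply: e3P; rewrite /ball/= ltr_norml; move: d3; rewrite ltr_norml => /andP[? ?].
  by apply/andP; split; lra.
Qed.

End Conversion.

Arguments bside {R N A1 A2} D i _ _ _.
Arguments lside {R N A1 A2} D i _ _ _.

(** * Passing between the two descriptions of trajectories *)

Section ValueTransfer.
Context {R : realType} (N : nat) (A1 A2 : metricType R).
Notation mu := (@lebesgue_measure R).
Local Notation bs := bside.
Local Notation ls := lside.
Implicit Types (D : control_data N A1 A2) (z x : 'rV[R]_N).
Variables (Om1 Om2 H : set 'rV[R]_N) (n1 n2 : 'rV[R]_N -> 'rV[R]_N).
Hypothesis HO : H_Omega Om1 Om2 H.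
Hypothesis n12 : forall z, H z -> n2 z = - n1 z.
Local Notation Om := (phase Om1 Om2).
Variables (T M L Ml : R) (ml : R -> R).
Hypotheses (cA1 : compact [set: A1]) (cA2 : compact [set: A2]) (M0 : 0 <= M) (L0 : 0 <= L)
  (Ml0 : 0 <= Ml) (mlm : modulus ml).

Lemma traj_itraj D x t Xc : (forall i, side_ok (Om i) T M L Ml ml (bs D i) (ls D i)) ->
  0 < t -> t < T -> traj Om1 Om2 H T D x t Xc ->
  exists X (al : forall i, R -> two A1 A2 i) m,
  [/\ itraj Om1 Om2 H (bs D) x t X al m, X t = Xc.1 t,
      \int[mu]_(s in `[0, t]) running_cost Om1 Om2 H D (Xc.1 s) (t - s) (Xc.2 s) =
      \int[mu]_(s in `[0, t]) icost Om1 Om2 H (ls D) (X s) (t - s) (al^~ s) (m s)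
    & traj_reg Om1 Om2 H n1 n2 T D x t Xc ->
      {ae mu, forall s, s \in `]0, t[ -> H (X s) -> ireg n1 (bs D) (X s) (t - s) (al^~ s) (m s)}].
Proof.
move=> side t0 tT [XL X0 cL Xd]; have t0w := ltW t0.
have [al [m [mal mm m01 alE]]] := control_components (lt_trans t0 tT) cL.
have alE' s : s \in `]0, t[ -> (al true s, al false s, m s) = Xc.2 s.
  by rewrite in_itv/= => /andP[s0 st]; apply: alE; rewrite in_itv/= s0 (lt_trans st).
have oc s : s \in `]0, t[ -> s \in `[0, t].
  by rewrite !in_itv/= => /andP[/ltW-> /ltW->].
have HX : itraj Om1 Om2 H (bs D) x t (fun s => Xc.1 (clamp t s)) al m.
  split => //.
  - have [M1 [_ M1P]] := XL.
    have M2 : M1 < `|M1| + 1 by rewrite (le_lt_trans (ler_norm _))// ltrDl.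
    exists (`|M1| + 1) => s s'.
    have := M1P _ M2 (clamp t s, clamp t s').
    move=> /(_ (conj (clamp_itv s t0w) (clamp_itv s' t0w)))/= h; apply: (le_trans h).
    by rewrite ler_wpM2l ?clamp_lip// addr_ge0.
  - by rewrite clamp_id// in_itv/= lexx.
  - apply: aeS Xd => s h st; rewrite ivelE alE'// clamp_id ?oc//.
    have /hasdP := h st; apply: hasd_near.
    by apply: filterS (near_in_itvoo st) => r rt; rewrite clamp_id// oc.
exists (fun s => Xc.1 (clamp t s)), al, m; split => //.
- by rewrite clamp_id// in_itv/= lexx t0w.
- have cA i : compact [set: two A1 A2 i] by case: i.
  have [F [mF FM FE]] := icost_measurable HO (@cA) L0 Ml0 mlm side t0w (ltW tT) HX.
  apply: (@etrans _ _ (\int[mu]_(s in `[0, t]) F s)); last first.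
    by apply: eq_Rintegral => s /set_mem/= sc; rewrite FE.
  have fE s : s \in `]0, t] -> F s = running_cost Om1 Om2 H D (Xc.1 s) (t - s) (Xc.2 s).
    rewrite in_itv/= => /andP[s0 st]; have sc : s \in `[0, t] by rewrite in_itv/= (ltW s0).
    by rewrite FE// icostE clamp_id// alE// in_itv/= s0 (le_lt_trans st).
  have iF : mu.-integrable `]0, t] (EFin \o F).
    apply: (@bounded_integrable _ _ _ Ml) => //; first by rewrite lebesgue_measure_itv/= lte_fin t0 -EFinB ltry.
      exact: measurable_funTS.
    by move=> s; rewrite /= in_itv/= => /andP[s0 st]; apply: FM; rewrite in_itv/= (ltW s0).
  (* At [s = 0] the two controls may differ, so this point is removed from both integrals. *)
  rewrite -!Rintegral_itv_obnd_cbnd//.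
    by apply: eq_Rintegral => s /set_mem/= sc; rewrite fE.
  by apply: eq_integrable iF => // s /set_mem/= sc; rewrite fE.
- move=> [_]; apply: aeS => s h st HX'; have sc := oc _ st.
  move: HX'; rewrite /= clamp_id// => HX'; have := h st HX'; rewrite -alE'//.
  by move=> h'; apply/iregE; [exact: n12|exact: m01|exact: h'].
Qed.

Lemma itraj_traj D x t X (al : forall i, R -> two A1 A2 i) m :
  itraj Om1 Om2 H (bs D) x t X al m ->
  let Xc := (X, (fun s => (al true s, al false s, m s) : control A1 A2)) in
  traj Om1 Om2 H T D x t Xc /\
  ({ae mu, forall s, s \in `]0, t[ -> H (X s) -> ireg n1 (bs D) (X s) (t - s) (al^~ s) (m s)} ->
   traj_reg Om1 Om2 H n1 n2 T D x t Xc).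
Proof.
move=> [[MX XL] X0 mal [mm m01] Xd] Xc.
have tr : traj Om1 Om2 H T D x t Xc.
  split => //.
  - exists MX; split; first exact: num_real.
    by move=> k kM [s s'] _ /=; apply: (le_trans (XL _ _)); rewrite ler_wpM2r// ltW.
  - exact: components_control.
  - by apply: aeS Xd => s h st; apply/hasdP; have := h st; rewrite ivelE.
split => // reg; split => //; apply: aeS reg => s h st HX.
exact: (iregE D (t - s) (al^~ s) (n12 HX) (m01 s)).1 (h st HX).
Qed.

End ValueTransfer.

(** An empty [S] makes the right-hand side infinite, in agreement with the convention of
    [value_cvg]. *)
Lemma ereal_inf_transfer (R : realType) (U : Type) (S S' : set U) (F F' : U -> R) (eta : R) :
  (forall p, S p -> exists2 p', S' p' & F' p' <= F p + eta) ->
  (ereal_inf [set (F' p)%:E | p in S'] <= ereal_inf [set (F p)%:E | p in S] + eta%:E)%E.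
Proof.
move=> h; rewrite -leeBlDr//; apply: le_ereal_inf_tmp => _ [p Sp <-]; rewrite leeBlDr//.
have [p' S'p' FF'] := h p Sp.
apply: (@le_trans _ _ (F' p')%:E); first by apply: ereal_inf_lbound; exists p'.
by rewrite -EFinD lee_fin.
Qed.

(** * One-sided inequality between value functions *)

Section OneSidedBound.
Context {R : realType} (N : nat) (A1 A2 : metricType R).
Notation mu := (@lebesgue_measure R).
Implicit Types (D : control_data N A1 A2) (z x : 'rV[R]_N).
Variables (Om1 Om2 H : set 'rV[R]_N) (n1 n2 : 'rV[R]_N -> 'rV[R]_N).
Hypothesis HO : H_Omega Om1 Om2 H.
Hypothesis n12 : forall z, H z -> n2 z = - n1 z.
Local Notation Om := (phase Om1 Om2).
Variables (T M L Ml : R) (ml : R -> R).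
Hypotheses (cA1 : compact [set: A1]) (cA2 : compact [set: A2]) (M0 : 0 <= M) (L0 : 0 <= L)
  (Ml0 : 0 <= Ml) (mlm : modulus ml).
Variables (Phi : 'rV[R]_N -> R) (G : 'rV[R]_N -> 'rV[R]_N) (Cg r c0 a K lam0 err rho eta : R).
Hypotheses (W : weak_defining Om1 Om2 H n1 Phi G) (Cg0 : 0 <= Cg) (HPhi : C11on setT Phi G Cg).
Hypothesis St : forall z, `|z| <= rho -> strict_at Om1 Om2 H n1 Phi G z.
Let kx := 2 * (1 + M) / K.
Let nN : R := N%:R.
Let kq := 2 * (nN * Cg * (2 * M + L + 1) / r) / K.
Let LT := lam0 * expR (K * T).
Hypotheses (r0 : 0 < r) (c00 : 0 < c0) (a0 : 0 < a) (a1 : a <= 1) (K1 : 1 <= K)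
  (KL : L <= K * (a / 2)) (lam00 : 0 < lam0) (lamT : LT <= 2^-1)
  (err0 : 0 <= err) (errl : err <= lam0 * (a / 2)).
Hypotheses (HK1 : 2 * L <= K) (HK1' : kx <= 1)
  (HK2 : 2 * (nN * Cg * (2 * M + L + 1) / r) <= K)
  (HK3 : nN * Cg * (M * kq + (M + L) * kx + a) <= c0 / 2).
Hypothesis eta_cost : (ml (nN * (2 * LT)) + err + LT * Ml) * T + Ml * LT <= eta / 2.

(** The final costs are compared at different points because the transferred trajectory does not end
    where the original one does. *)
Definition data_close D D' : Prop :=
  (forall i z s al, `|z| <= rho -> closure (Om i) z -> s \in `[0, T] ->
     `|bside D i z s al - bside D' i z s al| <= err /\
     `|lside D i z s al - lside D' i z s al| <= err) /\
  (forall y y', `|y| <= rho -> `|y'| <= rho -> `|y' - y| <= (1 + M) * LT ->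
     `|g D' y' - g D y| <= eta / 2).

Definition controllable D : Prop := forall i z s, `|z| <= rho -> `|Phi z| < r ->
  closure (Om i) z -> s \in `[0, T] -> (exists al, c0 <= dot (G z) (bside D i z s al)) /\
                   (exists al, c0 <= dot (- G z) (bside D i z s al)).

Lemma traj_transfer D D' x t Xc :
  (forall i, side_ok (Om i) T M L Ml ml (bside D i) (lside D i)) ->
  (forall i, side_ok (Om i) T M L Ml ml (bside D' i) (lside D' i)) ->
  data_close D D' -> controllable D' -> 0 <= t -> t < T -> `|x| + M * T + 1 <= rho ->
  traj Om1 Om2 H T D x t Xc -> exists Xc', [/\ traj Om1 Om2 H T D' x t Xc',
    (traj_reg Om1 Om2 H n1 n2 T D x t Xc -> traj_reg Om1 Om2 H n1 n2 T D' x t Xc')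
    & J Om1 Om2 H D' t Xc' <= J Om1 Om2 H D t Xc + eta].
Proof.
move=> side side' [bl gg] ctrl t0 tT xrho tr.
have T0 : 0 < T by exact: le_lt_trans tT.
have LT0 : 0 <= LT by rewrite mulr_ge0 ?expR_ge0// ltW.
have [ml0 mln _] := mlm.
have eta0 : 0 <= eta / 2.
  apply: le_trans eta_cost; apply: addr_ge0; last exact: mulr_ge0.
  have nN0 : 0 <= nN by exact: ler0n.
  have h : 0 <= nN * (2 * LT) by exact: mulr_ge0 nN0 (mulr_ge0 (ler0n _ 2) LT0).
  have := mln _ _ (lexx 0) h; rewrite ml0 => h'.
  exact: mulr_ge0 (addr_ge0 (addr_ge0 h' err0) (mulr_ge0 LT0 Ml0)) (ltW T0).
(* At horizon 0 the conditions holding almost everywhere are void and the cost is the final cost at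
   [x], so the same pair serves both data. *)
have [t0'|t0'] := eqVneq t 0.
  exists Xc; move: tr; rewrite t0' => -[h1 h2 h3 h4].
  have no (P : R -> Prop) : {ae mu, forall s, s \in `]0, 0[ -> P s}.
    apply: (@ae_all R (fun s => s \in `]0, 0[ -> P s)) => s.
    by rewrite in_itv/= => /andP[u1 u2]; have := lt_trans u1 u2; rewrite ltxx.
  have tr' : traj Om1 Om2 H T D' x 0 Xc by split => //; exact: no.
  split; [exact: tr'|move=> _; split; [exact: tr'|exact: no]|].
  rewrite /J !set_itv1 !Rintegral_set1 !add0r h2.
  have xr : `|x| <= rho.
    by apply: le_trans xrho; rewrite -addrA lerDl addr_ge0// mulr_ge0// ltW.
  have xx : `|x - x| <= (1 + M) * LT.
    by rewrite subrr normr0; apply: mulr_ge0 => //; exact: addr_ge0.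
  have := gg x x xr xr xx.
  by rewrite ler_norml => /andP[_ h5]; move: eta0 h5; lra.
have tp : 0 < t by rewrite lt_neqAle eq_sym t0'.
have [X [al [m [HX Xt JE regE]]]] := traj_itraj HO n12 cA1 cA2 L0 Ml0 mlm side tp tT tr.
have cA i : compact [set: two A1 A2 i] by case: i.
have [X' [al' [m' [HX' reg' XX' JJ]]]] := transfer HO (@cA) M0 L0 Ml0 mlm side side' W Cg0 HPhi
  St bl ctrl r0 c00 a0 a1 K1 KL lam00 lamT err0 errl HK1 HK1' HK2 HK3 tp (ltW tT) xrho HX.
have [tr1 tr2] := itraj_traj n12 T cA1 cA2 HX'.
exists (X', fun s => (al' true s, al' false s, m' s)); split => //.
  by move=> /regE/reg'/tr2.
have tt : t \in `[0, t] by rewrite in_itv/= lexx t0.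
have zt : 0 \in `[0, t] by rewrite in_itv/= lexx.
have inball b l X1 al1 m1 : (forall i, side_ok (Om i) T M L Ml ml (b i) (l i)) ->
    itraj (A := two A1 A2) Om1 Om2 H b x t X1 al1 m1 -> `|X1 t| <= rho.
  move=> sd H1; have := itraj_speed HO M0 sd (ltW tT) H1 tt zt.
  have [_ -> _ _ _] := H1; rewrite subr0 (ger0_norm t0) => h.
  have h1 : `|X1 t| <= `|X1 t - x| + `|x| by rewrite -{1}(subrK x (X1 t)) ler_normD.
  have h2 : M * t <= M * T by rewrite ler_wpM2l// ltW.
  by move: h h1 h2 xrho; lra.
have gX := gg _ _ (inball _ _ _ _ _ side HX) (inball _ _ _ _ _ side' HX') XX'.
rewrite /J JE -Xt/=.
have -> : \int[mu]_(s in `[0, t]) running_cost Om1 Om2 H D' (X' s) (t - s) (al' true s, al' false s, m' s) =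
  \int[mu]_(s in `[0, t]) icost Om1 Om2 H (lside D') (X' s) (t - s) (al'^~ s) (m' s).
  by apply: eq_Rintegral => s _; rewrite icostE.
move: gX; rewrite ler_norml => /andP[_ gX].
by move: JJ gX eta_cost; rewrite -/LT -/nN; lra.
Qed.

Lemma value_bound D D' x t :
  (forall i, side_ok (Om i) T M L Ml ml (bside D i) (lside D i)) ->
  (forall i, side_ok (Om i) T M L Ml ml (bside D' i) (lside D' i)) ->
  data_close D D' -> controllable D' -> 0 <= t -> t < T -> `|x| + M * T + 1 <= rho ->
  (Uminus Om1 Om2 H T D' x t <= Uminus Om1 Om2 H T D x t + eta%:E)%E /\
  (Uplus Om1 Om2 H n1 n2 T D' x t <= Uplus Om1 Om2 H n1 n2 T D x t + eta%:E)%E.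
Proof.
move=> side side' cl ctrl t0 tT xrho; split; apply: ereal_inf_transfer => Xc tr.
  by have [Xc' [h1 _ h3]] := traj_transfer side side' cl ctrl t0 tT xrho tr; exists Xc'.
have [Xc' [_ h2 h3]] := traj_transfer side side' cl ctrl t0 tT xrho tr.1.
by exists Xc' => //; exact: h2.
Qed.

End OneSidedBound.

(** * Choice of the constants *)

Section Constants.
Context {R : realType}.

(** [a] is fixed by [D * a <= c0 / 4]. The remaining terms of the last inequality add up to [Q / K],
    and [K] is a sum with one term per requirement, the last one making [Q / K <= c0 / 4]. *)
Lemma tracking_constants (M L D k c0 : R) : 0 <= M -> 0 <= L -> 0 <= D -> 0 <= k -> 0 < c0 ->
  exists a K : R, [/\ 0 < a, a <= 1, D * a <= c0 / 4, 1 <= K & L <= K * (a / 2)] /\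
    [/\ 2 * L <= K, 2 * (1 + M) / K <= 1, 2 * k <= K &
        D * (M * (2 * k / K) + (M + L) * (2 * (1 + M) / K) + a) <= c0 / 2].
Proof.
move=> M0 L0 D0 k0 c00.
have D1 : 0 < 4 * (D + 1) by rewrite mulr_gt0// ltr_wpDl.
pose a := Num.min 1 (c0 / (4 * (D + 1))).
have a0 : 0 < a by rewrite lt_min ltr01 divr_gt0.
have a1 : a <= 1 by rewrite ge_min lexx.
have Da : D * a <= c0 / 4.
  have : a <= c0 / (4 * (D + 1)) by rewrite ge_min lexx orbT.
  rewrite ler_pdivlMr// => h.
  have e : a * (4 * (D + 1)) = 4 * (D * a) + 4 * a by ring.
  by move: h a0; rewrite e; move: (D * a) => Da; lra.
pose Q := D * (M * (2 * k) + (M + L) * (2 * (1 + M))).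
have Q0 : 0 <= Q.
  apply: mulr_ge0 => //; apply: addr_ge0; apply: mulr_ge0; rewrite ?addr_ge0 ?mulr_ge0//.
  exact: addr_ge0.
pose K := 1 + 2 * L / a + 2 * L + 2 * (1 + M) + 2 * k + 4 * Q / c0.
have h1 : 0 <= 2 * L / a by exact: divr_ge0 (mulr_ge0 (ler0n _ 2) L0) (ltW a0).
have h2 : 0 <= 4 * Q / c0 by exact: divr_ge0 (mulr_ge0 (ler0n _ 4) Q0) (ltW c00).
have K1 : 1 <= K by rewrite /K; move: h1 h2 M0 L0 k0; lra.
have K0 : 0 < K by exact: lt_le_trans K1.
exists a, K; split; split => //.
- have : 2 * L / a <= K by rewrite /K; move: h1 h2 M0 L0 k0; lra.
  by rewrite ler_pdivrMr// => h; move: h; rewrite [K * (a / 2)]mulrA; move: (K * a) => Ka; lra.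
- by rewrite /K; move: h1 h2 M0 L0 k0; lra.
- by rewrite ler_pdivrMr// mul1r /K; move: h1 h2 M0 L0 k0; lra.
- by rewrite /K; move: h1 h2 M0 L0 k0; lra.
- have -> : D * (M * (2 * k / K) + (M + L) * (2 * (1 + M) / K) + a) = Q / K + D * a.
    by rewrite /Q; move: (K) K0 => K' K'0; field; rewrite gt_eqF.
  have : 4 * Q / c0 <= K by rewrite /K; move: h1 h2 M0 L0 k0; lra.
  rewrite ler_pdivrMr// => h.
  have : Q / K <= c0 / 4.
    by rewrite ler_pdivrMr//; move: h; rewrite mulrAC [c0 * K]mulrC; move: (K * c0) => Kc; lra.
  by move: Da; move: (Q / K) (D * a) => q1 q2; lra.
Qed.

(** [u] stands for the final value [lam0 * expR (K * T)] of the freed share. The four members of the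
    minimum answer, in order, for invertibility of the clock, the displacement of the end point, the
    modulus of the costs, and the terms linear in [u]. *)
Lemma small_lag (ml : R -> R) (M Ml n T d eta : R) : modulus ml -> 0 <= M -> 0 <= Ml -> 0 <= n ->
  0 < T -> 0 < d -> 0 < eta ->
  exists u : R, [/\ 0 < u, u <= 2^-1, (1 + M) * u <= d &
    forall err, err <= u -> (ml (n * (2 * u)) + err + u * Ml) * T + Ml * u <= eta / 2].
Proof.
move=> mlm M0 Ml0 n0 T0 d0 eta0.
have T1 : 0 < 8 * (T + 1) by rewrite mulr_gt0// ltr_wpDl// ltW.
have [d1 d10 d1P] := modulus_small mlm (divr_gt0 eta0 T1).
pose P := (T + 1) * (Ml + 1).
have T2 : 0 < T + 1 by rewrite ltr_wpDl// ltW.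
have Ml1 : 0 < Ml + 1 by rewrite ltr_wpDl.
have P0 : 0 < 8 * P by exact: mulr_gt0 (ltr0Sn R 7) (mulr_gt0 T2 Ml1).
have n1 : 0 < 2 * n + 1 by rewrite ltr_wpDl// mulr_ge0.
have M1 : 0 < 1 + M by rewrite ltr_wpDr.
pose u := Num.min (Num.min 2^-1 (d / (1 + M))) (Num.min (d1 / 2 / (2 * n + 1)) (eta / (8 * P))).
have u0 : 0 < u by rewrite !lt_min invr_gt0 ltr0Sn !divr_gt0.
have [u1 u2 u3 u4] : [/\ u <= 2^-1, u <= d / (1 + M), u <= d1 / 2 / (2 * n + 1) & u <= eta / (8 * P)].
  by split; rewrite /u !ge_min lexx ?orbT.
exists u; split => //; first by move: u2; rewrite ler_pdivlMr// mulrC.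
move=> err eu.
have m1 : ml (n * (2 * u)) < eta / (8 * (T + 1)).
  apply: d1P; first exact: mulr_ge0 n0 (mulr_ge0 (ler0n _ 2) (ltW u0)).
  move: u3; rewrite ler_pdivlMr// => u3.
  have e : u * (2 * n + 1) = n * (2 * u) + u by ring.
  by move: u3 u0 d10; rewrite e; move: (n * _) => nu; lra.
rewrite ltr_pdivlMr// in m1; rewrite ler_pdivlMr// in u4.
move: m1; set m := ml _ => m1; clearbody m u.
have e1 : u * (8 * P) = 8 * (u * T * Ml) + 8 * (u * T) + 8 * (u * Ml) + 8 * u by rewrite /P; ring.
have e2 : (m + err + u * Ml) * T + Ml * u = m * T + err * T + u * T * Ml + u * Ml by ring.
have T0' := ltW T0; have u0' := ltW u0.
have e3 : err * T <= u * T by exact: ler_wpM2r.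
have e4 : m * (8 * (T + 1)) = 8 * (m * T) + 8 * m by ring.
have e5 : 0 <= u * T * Ml by exact: mulr_ge0 (mulr_ge0 u0' T0') Ml0.
have e6 : 0 <= u * T by exact: mulr_ge0.
have e7 : 0 <= u * Ml by exact: mulr_ge0.
rewrite e2; rewrite e1 in u4; rewrite e4 in m1.
have [m0|m0] := leP 0 m; last first.
  have e8 : m * T <= 0 by exact: mulr_le0_ge0 (ltW m0) T0'.
  by move: u4 e3 e5 e6 e7 e8 u0; clear -eta0; lra.
by move: u4 m1 e3 e5 e6 e7 m0 u0; clear -eta0; lra.
Qed.

Lemma uniformly_continuous_ball n (f : 'rV[R]_n -> R) (rho c : R) : continuous f -> 0 < c ->
  exists2 d : R, 0 < d & forall y y', `|y| <= rho -> `|y' - y| <= d -> `|f y' - f y| <= c.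
Proof.
move=> cf c0.
have cB : compact [set z : 'rV[R]_n | `|z| <= rho] by exact: compact_norm_le.
have FF : Filter (0 : R)^'+ by exact: _.
have h1 := (compact_near_coveringP _).1 cB R _ (fun d y => forall y', `|y' - y| <= d ->
  `|f y' - f y| <= c) FF.
near (0 : R)^'+ => d; exists d; first by near: d; exact: nbhs_right_gt.
move=> y y' yr yd.
have h : [set z : 'rV[R]_n | `|z| <= rho] `<=` (fun y => forall y', `|y' - y| <= d ->
  `|f y' - f y| <= c); last exact: h.
near: d; apply: h1 => y0 _.
have c2 : 0 < c / 2 by rewrite divr_gt0.
have /cvgrPdist_lt/(_ _ c2) := cf y0; rewrite -nbhs_ballE => -[e /= e0 eP].
exists ([set z | `|z - y0| < e / 2], [set d | d < e / 2]) => /=.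
  split; last by apply: nbhs_right_lt; rewrite divr_gt0.
  have := nbhsx_ballx y0 (e / 2) (divr_gt0 e0 (ltr0Sn R 1)).
  by apply: filterS => z; rewrite -ball_normE/= distrC.
move=> [z d'] /= [zy d'e] z' zz'.
have in1 v : `|v - y0| < e -> `|f y0 - f v| < c / 2.
  by move=> h; apply: eP; rewrite -ball_normE/= distrC.
have g1 : `|f y0 - f z| < c / 2 by apply: in1; lra.
have g2 : `|f y0 - f z'| < c / 2.
  apply: in1; rewrite -(subrKA z) (le_lt_trans (ler_normD _ _))// [ltRHS]splitr.
  exact: ltrD (le_lt_trans zz' d'e) zy.
rewrite -(subrKA (f y0)) (le_trans (ler_normD _ _))// [leRHS]splitr distrC.
exact: lerD (ltW g2) (ltW g1).
Unshelve. all: by end_near. Qed.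

End Constants.

(** * Convergence of the value functions *)

Theorem theorem5p5 (R : realType) (N : nat) (A1 A2 : metricType R)
    (Omega1 Omega2 H : set 'rV[R]_N) (n1 n2 : 'rV[R]_N -> 'rV[R]_N)
    (T Mb Lb Ml : R) (ml : R -> R)
    (D : control_data N A1 A2) (De : R -> control_data N A1 A2) :
  (0 < N)%N -> 0 < T ->
  H_Omega Omega1 Omega2 H ->
  (forall z, H z -> outward_unit_normal Omega1 z (n1 z)) ->
  (forall z, H z -> outward_unit_normal Omega2 z (n2 z)) ->
  modulus ml ->
  bounded_continuous (g D) ->
  (forall e, 0 < e -> bounded_continuous (g (De e))) ->
  (forall e, 0 < e -> condC123 Omega1 Omega2 T Mb Lb Ml ml (De e)) ->
  loc_unif_cvg Omega1 T (fun e => b1 (De e)) (b1 D) ->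
  loc_unif_cvg Omega2 T (fun e => b2 (De e)) (b2 D) ->
  loc_unif_cvg Omega1 T (V := R^o) (fun e => l1 (De e)) (l1 D) ->
  loc_unif_cvg Omega2 T (V := R^o) (fun e => l2 (De e)) (l2 D) ->
  (forall K : set 'rV[R]_N, compact K ->
     {uniform K, (fun e => g (De e)) @ 0^'+ --> g D}) ->
  (exists delta : R, [/\ 0 < delta, condC4 T H n1 delta (b1 D)
                       & condC4 T H n2 delta (b2 D)]) ->
  value_cvg T
    (fun e => Uminus Omega1 Omega2 H T (De e)) (Uminus Omega1 Omega2 H T D) /\
  value_cvg T
    (fun e => Uplus Omega1 Omega2 H n1 n2 T (De e))
    (Uplus Omega1 Omega2 H n1 n2 T D).
Proof.
move=> N0 T0 HO Hn1 Hn2 mlm [cgD _] _ C cb1 cb2 cl1 cl2 cg [delta [delta0 C41 C42]].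
have n12 z : H z -> n2 z = - n1 z by exact: (normal_opposite HO Hn1 Hn2).
have [[[cA1 _ _ _] [cA2 _ _ _]] _ _] := C 1 ltr01.
pose M := `|Mb|; pose L := `|Lb| * N%:R : R; pose Ml' := `|Ml|.
have M0 : 0 <= M by exact: normr_ge0.
have L0 : 0 <= L by exact: mulr_ge0.
have Ml0 : 0 <= Ml' by exact: normr_ge0.
have side e : 0 < e -> forall i, side_ok (phase Omega1 Omega2 i) T M L Ml' ml
    (bside (De e) i) (lside (De e) i).
  by move=> e0; have [[h1 h2] [h3 h4] [h5 h6]] := C e e0; case; exact: side_ok_of_cond.
have sideD i : side_ok (phase Omega1 Omega2 i) T M L Ml' ml (bside D i) (lside D i).
  case: i; first by apply: (side_ok_limit cA1 _ cb1 cl1) => e e0; exact: (side e e0 true).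
  by apply: (side_ok_limit cA2 _ cb2 cl2) => e e0; exact: (side e e0 false).
have dataN (K : set 'rV[R]_N) : compact K -> forall c : R, 0 < c ->
    \forall e \near 0^'+, forall i z s al, K z -> closure (phase Omega1 Omega2 i) z ->
      s \in `[0, T] -> `|bside D i z s al - bside (De e) i z s al| <= c /\
        `|lside D i z s al - lside (De e) i z s al| <= c.
  move=> cK c c0.
  have cKi i : compact (K `&` closure (phase Omega1 Omega2 i)).
    by apply: compact_closedI => //; exact: closed_closure.
  have h1 := data_near cb1 cl1 (cKi true) (@subIsetr _ _ _) c0.
  have h2 := data_near cb2 cl2 (cKi false) (@subIsetr _ _ _) c0.
  apply: filterS2 h1 h2 => e h1 h2 [] z s al Kz cz sT.
    by have [/ltW ? /ltW ?] := h1 z s al (conj Kz cz) sT.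
  by have [/ltW ? /ltW ?] := h2 z s al (conj Kz cz) sT.
(* A compact set of pairs enters only through one radius [rho]; two transfers yield the four
   inequalities at once. *)
suff main (rho eta : R) : 0 < eta -> \forall e \near 0^'+, forall x t, 0 <= t -> t < T ->
    `|x| + M * T + 1 <= rho ->
    ((Uminus Omega1 Omega2 H T (De e) x t <= Uminus Omega1 Omega2 H T D x t + eta%:E)%E /\
     (Uplus Omega1 Omega2 H n1 n2 T (De e) x t <= Uplus Omega1 Omega2 H n1 n2 T D x t + eta%:E)%E) /\
    ((Uminus Omega1 Omega2 H T D x t <= Uminus Omega1 Omega2 H T (De e) x t + eta%:E)%E /\
     (Uplus Omega1 Omega2 H n1 n2 T D x t <= Uplus Omega1 Omega2 H n1 n2 T (De e) x t + eta%:E)%E).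
  have bound (K : set ('rV[R]_N * R)) : compact K -> exists rho, forall p, K p ->
      `|p.1| + M * T + 1 <= rho.
    move=> /compact_bounded[B [_ BP]]; exists (`|B| + 1 + M * T + 1) => p Kp.
    have B1 : B < `|B| + 1 by rewrite (le_lt_trans (ler_norm _))// ltrDl.
    have := BP _ B1 p Kp; rewrite /= !lerD2r => h; apply: le_trans h.
    by rewrite prod_normE le_max lexx.
  split=> K cK KT eta eta0; have [rho rhoP] := bound K cK;
    apply: filterS (main rho eta eta0) => e h p Kp; have [_ /=] := KT p Kp;
    rewrite in_itv/= => /andP[t0 tT]; have [[h1 h2] [h3 h4]] := h p.1 p.2 t0 tT (rhoP p Kp);
    by split.
move=> eta0.
have cB : compact [set z : 'rV[R]_N | `|z| <= rho] by exact: compact_norm_le.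
have [Phi [G [W St]]] := defining_function HO Hn1 cB.
have [[Cg Cg0 HPhi] _] := W.
have C4 i z s : H z -> s \in `[0, T] -> (exists al, dot (bside D i z s al) (n1 z) = delta) /\
    (exists al, dot (bside D i z s al) (n1 z) = - delta).
  move=> Hz sT.
  have d1 : `[- delta, delta]%classic delta by rewrite /= in_itv/= lexx andbT ge0_cp// ltW.
  have d2 : `[- delta, delta]%classic (- delta) by rewrite /= in_itv/= lexx ge0_cp// ltW.
  case: i.
    by have [a1 _ e1] := C41 z s Hz sT _ d1; have [a2 _ e2] := C41 z s Hz sT _ d2; split;
      [exists a1|exists a2].
  have [a1 _ e1] := C42 z s Hz sT _ d1; have [a2 _ e2] := C42 z s Hz sT _ d2.
  (* With opposite normals, the controls for [delta] and [- delta] exchange their roles on the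
     second side. *)
  rewrite n12// dotNr in e1; rewrite n12// dotNr in e2; split; [exists a2|exists a1].
    by apply: oppr_inj; rewrite e2.
  by rewrite -e1 opprK.
have [r r0 ctrl] := control_near HO M0 L0 Cg0 delta0 sideD HPhi St C4.
pose nN : R := N%:R; have nN0 : 0 <= nN by exact: ler0n.
pose k := nN * Cg * (2 * M + L + 1) / r.
have k0 : 0 <= k.
  by apply: divr_ge0; [apply: mulr_ge0; [exact: mulr_ge0|]|exact: ltW];
    rewrite !addr_ge0// mulr_ge0.
(* The limit data are controllable with size [r], close data keep half of it; both transfers are run
   with this half. *)
have c00 : 0 < r / 2 by rewrite divr_gt0.
have [a [K [[a0 a1 Da K1 KL] [HK1 HK1' HK2 HK3]]]] :=
  tracking_constants M0 L0 (mulr_ge0 nN0 Cg0) k0 c00.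
have eta4 : 0 < eta / 4 by rewrite divr_gt0.
have [d d0 dP] := uniformly_continuous_ball rho cgD eta4.
have [u [u0 u2 ud uP]] := small_lag mlm M0 Ml0 nN0 T0 d0 eta0.
(* Normalised so that the freed share reaches exactly [u] at time [T]. *)
pose lam0 := u / expR (K * T).
have lam00 : 0 < lam0 by rewrite divr_gt0// expR_gt0.
have lamE : lam0 * expR (K * T) = u by rewrite divfK// gt_eqF// expR_gt0.
(* The largest data error allowed by [errl]; it fixes how small [e] has to be. *)
pose err := lam0 * (a / 2).
have err0 : 0 < err by rewrite mulr_gt0// divr_gt0.
have e1 : 1 <= expR (K * T) by rewrite -expR0 ler_expR mulr_ge0// ?(ltW T0)// (le_trans ler01).
have lamu : lam0 <= u by rewrite -lamE ler_peMr// ltW.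
have erru : err <= u.
  by apply: le_trans lamu; rewrite ler_piMr ?(ltW lam00)//; lra.
have err_a : nN * Cg * err <= r / 2.
  have : nN * Cg * err <= nN * Cg * a.
    rewrite ler_wpM2l//; first exact: mulr_ge0.
    apply: (@le_trans _ _ (a / 2)); last by lra.
    by rewrite /err ler_piMl ?divr_ge0 ?(ltW a0)//; lra.
  by move: Da r0; move: (nN * Cg * _) (nN * Cg * _) => v1 v2; lra.
have lamT : lam0 * expR (K * T) <= 2^-1 by rewrite lamE.
have cost : (ml (nN * (2 * (lam0 * expR (K * T)))) + err + lam0 * expR (K * T) * Ml') * T +
    Ml' * (lam0 * expR (K * T)) <= eta / 2 by rewrite lamE; exact: uP.
have ctrl2 : controllable Omega1 Omega2 T Phi G r (r / 2) rho D.
  move=> i z s zr Pr cz sT; have [[al1 e3] [al2 e4]] := ctrl i z s zr Pr cz sT.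
  by split; [exists al1; apply: le_trans e3|exists al2; apply: le_trans e4]; lra.
have H0 : \forall e \near (0 : R)^'+, 0 < e by exact: nbhs_right_gt.
apply: filterS3 H0 (dataN _ cB err err0) (uniform_dist (cg _ cB) eta4) => e e0 De_D gE x t t0 tT xr.
have ctrlE : controllable Omega1 Omega2 T Phi G r (r / 2) rho (De e).
  have near_dot (v : 'rV[R]_N) i z s al : `|v| <= Cg -> `|z| <= rho ->
      closure (phase Omega1 Omega2 i) z -> s \in `[0, T] ->
      r <= dot v (bside D i z s al) -> r / 2 <= dot v (bside (De e) i z s al).
    move=> vC zr cz sT rv; have [h _] := De_D i z s al zr cz sT.
    have h1 : `|dot v (bside D i z s al - bside (De e) i z s al)| <= nN * Cg * err.
      by apply: (le_trans (dot_norm _ _)); rewrite -mulrA ler_wpM2l// ler_pM.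
    move: h1; rewrite dotBr ler_norml => /andP[_ h1].
    by move: rv h1 err_a; lra.
  have [/(_ _ I) GC _ _ _] := HPhi.
  move=> i z s zr Pr cz sT; have [[al1 e3] [al2 e4]] := ctrl i z s zr Pr cz sT.
  have [_ Gz] := GC z.
  split; [exists al1|exists al2]; apply: near_dot => //; by rewrite normrN.
have VB := value_bound HO n12 cA1 cA2 M0 L0 Ml0 mlm W Cg0 HPhi St r0 c00 a0 a1 K1 KL lam00 lamT
  (ltW err0) (lexx err) HK1 HK1' HK2 HK3 cost.
have dist0 (y y' : 'rV[R]_N) : `|y' - y| <= (1 + M) * (lam0 * expR (K * T)) -> `|y' - y| <= d.
  by rewrite lamE => h; exact: le_trans h ud.
have half (v1 v2 v3 : R) : `|v1 - v2| <= eta / 4 -> `|v2 - v3| <= eta / 4 -> `|v1 - v3| <= eta / 2.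
  move=> h1 h2; rewrite -(subrKA v2) (le_trans (ler_normD _ _))//.
  by have := lerD h1 h2; lra.
split.
(* From the limit data to the approximate ones; the other item goes back. Of the [eta / 2] allowed
   on the final cost, one half is for changing [g] and one half for moving its argument. *)
- apply: VB sideD (side e e0) _ ctrlE t0 tT xr; split=> [|y y' yr y'r /dist0 yd].
    by move=> i z s al zr cz sT; exact: De_D.
  apply: (half _ (g D y')); last exact: dP.
  by rewrite distrC; apply: ltW; exact: gE.
- apply: VB (side e e0) sideD _ ctrl2 t0 tT xr; split=> [|y y' yr y'r /dist0 yd].
    move=> i z s al zr cz sT; have [h1 h2] := De_D i z s al zr cz sT.
    by rewrite distrC [X in _ /\ X <= _]distrC.
  apply: (half _ (g D y)); first exact: dP.
  by apply: ltW; exact: gE.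
Qed.
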